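(* Let $n\ge1$. The algebra $Y_n$ is generated by the elements $\{D_i^{(r)},\widetilde D_i^{(r)}\}_{1\le i\le n,\,r\ge0}$ and $\{E_i^{(r)},F_i^{(r)}\}_{1\le i<n,\,r\ge1}$ (defined in the context) subject only to the following relations: \begin{align*} &(1)\quad D_i^{(0)}=1;\\ &(2)\quad \sum_{t=0}^rD_i^{(t)}\widetilde D_i^{(r-t)}=-\delta_{r,0};\\ &(3)\quad [D_i^{(r)},D_j^{(s)}]=0;\\ &(4)\quad [E_i^{(r)},F_j^{(s)}]=\delta_{i,j}\sum_{t=0}^{r+s-1}\widetilde D_i^{(t)}D_{i+1}^{(r+s-1-t)};\\ &(5)\quad [D_i^{(r)},E_j^{(s)}]=(\delta_{i,j}-\delta_{i,j+1})\sum_{t=0}^{r-1}D_i^{(t)}E_j^{(r+s-1-t)};\\ &(6)\quad [D_i^{(r)},F_j^{(s)}]=(\delta_{i,j+1}-\delta_{i,j})\sum_{t=0}^{r-1}F_j^{(r+s-1-t)}D_i^{(t)};\\ &(7)\quad [E_i^{(r)},E_i^{(s)}]=\sum_{t=1}^{s-1}E_i^{(t)}E_i^{(r+s-1-t)}-\sum_{t=1}^{r-1}E_i^{(t)}E_i^{(r+s-1-t)};\\ &(8)\quad [F_i^{(r)},F_i^{(s)}]=\sum_{t=1}^{r-1}F_i^{(r+s-1-t)}F_i^{(t)}-\sum_{t=1}^{s-1}F_i^{(r+s-1-t)}F_i^{(t)};\\ &(9)\quad [E_i^{(r)},E_{i+1}^{(s+1)}]-[E_i^{(r+1)},E_{i+1}^{(s)}]=-E_i^{(r)}E_{i+1}^{(s)};\\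 &(10)\quad [F_i^{(r+1)},F_{i+1}^{(s)}]-[F_i^{(r)},F_{i+1}^{(s+1)}]=-F_{i+1}^{(s)}F_i^{(r)};\\ &(11)\quad [E_i^{(r)},E_j^{(s)}]=0\ \text{ if }|i-j|>1;\\ &(12)\quad [F_i^{(r)},F_j^{(s)}]=0\ \text{ if }|i-j|>1;\\ &(13)\quad [E_i^{(r)},[E_i^{(s)},E_j^{(t)}]]+[E_i^{(s)},[E_i^{(r)},E_j^{(t)}]]=0\ \text{ if }|i-j|=1;\\ &(14)\quad [F_i^{(r)},[F_i^{(s)},F_j^{(t)}]]+[F_i^{(s)},[F_i^{(r)},F_j^{(t)}]]=0\ \text{ if }|i-j|=1; \end{align*} for all admissible $i,j,r,s,t$ (i.e. all values for which the generators on the left-hand sides belong to the list of generators above).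
   Context: All algebras are unital associative over $\mathbb C$. The Yangian $Y_n=Y(\mathfrak{gl}_n)$ is the algebra with generators $T_{i,j}^{(r)}$ ($1\le i,j\le n$, $r\ge1$) and relations $$[T_{i,j}^{(r)},T_{h,k}^{(s)}]=\sum_{t=0}^{\min(r,s)-1}\left(T_{i,k}^{(r+s-1-t)}T_{h,j}^{(t)}-T_{i,k}^{(t)}T_{h,j}^{(r+s-1-t)}\right)$$ for $1\le h,i,j,k\le n$, $r,s\ge0$, where $T_{i,j}^{(0)}:=\delta_{i,j}$. Put $T_{i,j}(u)=\sum_{r\ge0}T_{i,j}^{(r)}u^{-r}$ and $T(u)=(T_{i,j}(u))_{1\le i,j\le n}$. The matrix $T(u)$ over $Y_n[[u^{-1}]]$ has a unique Gauss factorization $T(u)=F(u)D(u)E(u)$ with $D(u)$ diagonal with diagonal entries $D_1(u),\dots,D_n(u)$, $E(u)$ upper unitriangular with $(i,j)$-entry $E_{i,j}(u)$ for $i<j$, and $F(u)$ lower unitriangular with $(j,i)$-entry denoted $F_{i,j}(u)$ for $i<j$. Write $D_i(u)=\sum_{r\ge0}D_i^{(r)}u^{-r}$, $\widetilde D_i(u):=-D_i(u)^{-1}=\sum_{r\ge0}\widetilde D_i^{(r)}u^{-r}$, $E_i(u):=E_{i,i+1}(u)=\sum_{r\ge1}E_i^{(r)}u^{-r}$, $F_i(u):=F_{i,i+1}(u)=\sum_{r\ge1}F_i^{(r)}u^{-r}$. Terms multiplied by a vanishing Kronecker delta are read as $0$. *)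

(* Defs.v *)
From HB Require Import structures.
From mathcomp Require Import all_boot all_order all_algebra.
From mathcomp Require Import finmap.
From mathcomp Require Import boolp.
From mathcomp Require Import monalg.
From mathcomp Require Import zify.

Set Implicit Arguments.
Unset Strict Implicit.
Unset Printing Implicit Defensive.

Import GRing.Theory.
Local Open Scope ring_scope.

(* The free associative unital K-algebra on I: finitely supported K-linear    *)
(* combinations of words over I, multiplied by concatenation.                 *)
Definition free_alg (K : comNzRingType) (I : choiceType) : Type :=
  {malg K[{fmonom I}]}.

HB.instance Definition _ (K : comNzRingType) (I : choiceType) :=
  GRing.Zmodule.on (free_alg K I).

Section FreeAlgebra.
Variables (K : comNzRingType) (I : choiceType).
Local Notation MA := {malg K[{fmonom I}]}.

(* Product and scaling are those of {malg K[{fmonom I}]}, locked so that      *)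
(* unification does not unfold them.                                          *)
Fact free_alg_key : unit. Proof. by []. Qed.
Definition free_mul : free_alg K I -> free_alg K I -> free_alg K I :=
  locked_with free_alg_key (fun p q : MA => p * q).
Definition free_scale : K -> free_alg K I -> free_alg K I :=
  locked_with free_alg_key (fun (c : K) (p : MA) => c *: p).

Fact free_mulE' (p q : MA) : free_mul p q = p * q :> MA.
Proof. by rewrite /free_mul unlock. Qed.

Fact free_scaleE' (c : K) (p : MA) : free_scale c p = c *: p :> MA.
Proof. by rewrite /free_scale unlock. Qed.

Fact free_mulA : associative free_mul.
Proof. by move=> p q s; rewrite !free_mulE' mulrA. Qed.
Fact free_mul1r : left_id (1 : MA) free_mul.
Proof. by move=> p; rewrite !free_mulE' mul1r. Qed.
Fact free_mulr1 : right_id (1 : MA) free_mul.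
Proof. by move=> p; rewrite !free_mulE' mulr1. Qed.
Fact free_mulDl : left_distributive free_mul +%R.
Proof. by move=> p q s; rewrite !free_mulE' mulrDl. Qed.
Fact free_mulDr : right_distributive free_mul +%R.
Proof. by move=> p q s; rewrite !free_mulE' mulrDr. Qed.
Fact free_oner_neq0 : (1 : MA) != 0.
Proof. exact: oner_neq0. Qed.

HB.instance Definition _ := GRing.Zmodule_isNzRing.Build (free_alg K I)
  free_mulA free_mul1r free_mulr1 free_mulDl free_mulDr free_oner_neq0.

Fact free_scaleA a b p : free_scale a (free_scale b p) = free_scale (a * b) p.
Proof. by rewrite !free_scaleE' scalerA. Qed.
Fact free_scale1 : left_id 1 free_scale.
Proof. by move=> p; rewrite free_scaleE' scale1r. Qed.
Fact free_scaleDr : right_distributive free_scale +%R.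
Proof. by move=> a p q; rewrite !free_scaleE' scalerDr. Qed.
Fact free_scaleDl p : {morph free_scale^~ p : a b / a + b}.
Proof. by move=> a b; rewrite !free_scaleE' scalerDl. Qed.

HB.instance Definition _ := GRing.Zmodule_isLmodule.Build K (free_alg K I)
  free_scaleA free_scale1 free_scaleDr free_scaleDl.

Lemma free_mulE (p q : free_alg K I) : p * q = (p : MA) * (q : MA) :> MA.
Proof. exact: free_mulE'. Qed.

Lemma free_scaleE (c : K) (p : free_alg K I) : c *: p = c *: (p : MA) :> MA.
Proof. exact: free_scaleE'. Qed.

Fact free_scalerAl (k : K) (x y : free_alg K I) : k *: (x * y) = k *: x * y.
Proof. by rewrite free_scaleE !free_mulE free_scaleE -scalerAl. Qed.

Fact free_scalerAr (k : K) (x y : free_alg K I) : k *: (x * y) = x * (k *: y).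
Proof.
have cent (a : K) (p : MA) : a%:MP * p = p * a%:MP.
  rewrite [p]monalgE mulr_suml mulr_sumr; apply: eq_bigr => m _.
  by rewrite !malgM_def !fgmulUU mul1m mulm1 mulrC.
rewrite free_scaleE !free_mulE free_scaleE.
by rewrite -!mul_malgC mulrA cent -mulrA.
Qed.

HB.instance Definition _ :=
  GRing.Lmodule_isLalgebra.Build K (free_alg K I) free_scalerAl.
HB.instance Definition _ :=
  GRing.Lalgebra_isAlgebra.Build K (free_alg K I) free_scalerAr.

Definition fgen (i : I) : free_alg K I := << fmu i >>.

Definition feval (A : algType K) (x : I -> A) (p : free_alg K I) : A :=
  mmap (in_alg A) (fun m : {fmonom I} => \prod_(i <- m) x i) p.

End FreeAlgebra.

Section FreeAlgebraEval.
Variables (K : comNzRingType) (I : choiceType) (A : algType K) (x : I -> A).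

Let word (m : {fmonom I}) : A := \prod_(i <- m) x i.

Fact word_mmorphism : mmorphism word.
Proof. by split=> [u v|]; rewrite /word ?fmM ?big_cat // fm1 big_nil. Qed.

HB.instance Definition _ := isMultiplicative.Build {fmonom I} A word
  word_mmorphism.

Fact feval_is_zmod_morphism : zmod_morphism (feval x).
Proof. by move=> p q; exact: mmap_is_additive. Qed.

Fact feval_is_monoid_morphism : monoid_morphism (feval x).
Proof.
have [|fM f1] := @commr_mmap_is_multiplicative _ _ _ (in_alg A) word.
  by move=> g m m'; rewrite /GRing.comm /= mulr_algl mulr_algr.
by split=> // p q; rewrite free_mulE; exact: fM.
Qed.

Fact feval_is_scalable : scalable (feval x).
Proof.
by move=> c p; rewrite /= free_scaleE [LHS](@mmapZ _ _ _ (in_alg A) word) /= mulr_algl.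
Qed.

HB.instance Definition _ := GRing.isZmodMorphism.Build (free_alg K I) A
  (feval x) feval_is_zmod_morphism.
HB.instance Definition _ := GRing.isMonoidMorphism.Build (free_alg K I) A
  (feval x) feval_is_monoid_morphism.
HB.instance Definition _ := GRing.isScalable.Build K (free_alg K I) A _
  (feval x) feval_is_scalable.

Lemma feval_gen i : feval x (fgen K i) = x i.
Proof. by rewrite /feval mmapU /= scale1r mul1r fmU big_seq1. Qed.

End FreeAlgebraEval.

Lemma feval_morph (K : comNzRingType) (I : choiceType) (A B : algType K)
    (f : {lrmorphism A -> B}) (x : I -> A) (p : free_alg K I) :
  f (feval x p) = feval (f \o x) p.
Proof.
rewrite /feval /mmap raddf_sum; apply: eq_bigr => m _ /=.
by rewrite !mulr_algl linearZ /= rmorph_prod.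
Qed.

Lemma feval_id (K : comNzRingType) (I : choiceType) (p : free_alg K I) :
  feval (@fgen K I) p = p.
Proof.
rewrite /feval /mmap [RHS]monalgE; apply: eq_bigr => m _ /=.
have -> : \prod_(i <- m) fgen K i = << m >> :> free_alg K I.
  case: m => s; elim: s => [|i s IHs] /=.
    by rewrite big_nil -fmoneE.
  rewrite big_cons IHs free_mulE malgM_def fgmulUU mul1r; congr << _ >>.
  by apply: val_inj; rewrite /= fmM fmU.
rewrite mulr_algl free_scaleE; apply/malgP => w.
by rewrite mcoeffZ !mcoeffU mulrnAr mulr1.
Qed.

(* A relation r p q stands for the equation p = q; ideal_gen r is the         *)
(* two-sided ideal generated by the differences p - q.                        *)
Inductive ideal_gen (A : nzRingType) (r : A -> A -> Prop) : A -> Prop :=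
| ideal_gen_rel p q : r p q -> ideal_gen r (p - q)
| ideal_gen0 : ideal_gen r 0
| ideal_genD p q : ideal_gen r p -> ideal_gen r q -> ideal_gen r (p + q)
| ideal_genMl a p : ideal_gen r p -> ideal_gen r (a * p)
| ideal_genMr a p : ideal_gen r p -> ideal_gen r (p * a).

Lemma ideal_gen_ker (A B : nzRingType) (r : A -> A -> Prop)
    (f : {rmorphism A -> B}) (p : A) :
  (forall p q, r p q -> f p = f q) -> ideal_gen r p -> f p = 0.
Proof.
move=> fr; elim=> {p} [p q /fr|| p q _ p0 _ q0|a p _ p0|a p _ p0].
- by rewrite rmorphB => ->; rewrite subrr.
- exact: rmorph0.
- by rewrite rmorphD p0 q0 addr0.
- by rewrite rmorphM p0 mulr0.
- by rewrite rmorphM p0 mul0r.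
Qed.

Definition ideal_pred (A : nzRingType) (r : A -> A -> Prop) : {pred A} :=
  fun p => `[< ideal_gen r p >].

Fact ideal_pred_zmod_closed (A : nzRingType) (r : A -> A -> Prop) :
  zmod_closed (ideal_pred r).
Proof.
split=> [|p q /asboolP Ip /asboolP Iq]; apply/asboolP.
  exact: ideal_gen0.
by apply: ideal_genD Ip _; rewrite -mulN1r; exact: ideal_genMl.
Qed.

HB.instance Definition _ (A : nzRingType) (r : A -> A -> Prop) :=
  GRing.isZmodClosed.Build A (ideal_pred r) (@ideal_pred_zmod_closed A r).

Section QuotientAlgebra.
Variables (K : comNzRingType) (A : algType K) (r : A -> A -> Prop).
Local Open Scope quotient_scope.

Definition quot_alg : Type := Quotient.quot (ideal_pred r).

HB.instance Definition _ := GRing.Zmodule.on quot_alg.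
HB.instance Definition _ := EqQuotient.on quot_alg.

Definition quot_pi (p : A) : quot_alg := \pi_(Quotient.quot (ideal_pred r)) p.

Lemma quot_piP p q : quot_pi p = quot_pi q <-> ideal_gen r (p - q).
Proof.
split=> [/eqP|Ipq]; last apply/eqP; rewrite -Quotient.idealrBE.
  by move/asboolP.
exact/asboolP.
Qed.

Lemma quot_pi_surj (y : quot_alg) : exists p, quot_pi p = y.
Proof. by exists (repr y); rewrite /quot_pi reprK. Qed.

Lemma quot_piB p q : quot_pi (p - q) = quot_pi p - quot_pi q.
Proof. by rewrite /quot_pi !piE. Qed.

Lemma quot_piD p q : quot_pi (p + q) = quot_pi p + quot_pi q.
Proof. by rewrite /quot_pi !piE. Qed.

Lemma quot_pi0 : quot_pi 0 = 0.
Proof. by rewrite -(subrr 0) quot_piB subrr. Qed.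

Let lift (y : quot_alg) : A := repr y.

Let liftK y : quot_pi (lift y) = y.
Proof. exact: reprK. Qed.

Definition quot_one : quot_alg := quot_pi 1.
Definition quot_mul (y z : quot_alg) : quot_alg := quot_pi (lift y * lift z).
Definition quot_scale (k : K) (y : quot_alg) : quot_alg :=
  quot_pi (k *: lift y).

Fact quot_piM p q : quot_pi (p * q) = quot_mul (quot_pi p) (quot_pi q).
Proof.
apply/quot_piP; set p' := lift _; set q' := lift _.
have -> : p * q - p' * q' = (p - p') * q + p' * (q - q').
  by rewrite mulrBl mulrBr addrA subrK.
by apply: ideal_genD; [apply: ideal_genMr|apply: ideal_genMl];
  apply/quot_piP; rewrite liftK.
Qed.

Fact quot_piZ k p : quot_pi (k *: p) = quot_scale k (quot_pi p).
Proof.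
apply/quot_piP; rewrite -scalerBr -mulr_algl; apply: ideal_genMl.
by apply/quot_piP; rewrite liftK.
Qed.

Fact quot_mulA : associative quot_mul.
Proof.
by move=> x y z; rewrite -(liftK x) -(liftK y) -(liftK z) -!quot_piM mulrA.
Qed.

Fact quot_mul1 : left_id quot_one quot_mul.
Proof. by move=> x; rewrite -(liftK x) -quot_piM mul1r. Qed.

Fact quot_mulr1 : right_id quot_one quot_mul.
Proof. by move=> x; rewrite -(liftK x) -quot_piM mulr1. Qed.

Fact quot_mulDl : left_distributive quot_mul +%R.
Proof.
move=> x y z; rewrite -(liftK x) -(liftK y) -(liftK z).
by rewrite -quot_piD -!quot_piM -quot_piD mulrDl.
Qed.

Fact quot_mulDr : right_distributive quot_mul +%R.
Proof.
move=> x y z; rewrite -(liftK x) -(liftK y) -(liftK z).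
by rewrite -quot_piD -!quot_piM -quot_piD mulrDr.
Qed.

HB.instance Definition _ := GRing.Zmodule_isPzRing.Build quot_alg
  quot_mulA quot_mul1 quot_mulr1 quot_mulDl quot_mulDr.

Fact quot_scaleA a b y : quot_scale a (quot_scale b y) = quot_scale (a * b) y.
Proof. by rewrite -(liftK y) -!quot_piZ scalerA. Qed.

Fact quot_scale1 : left_id 1 quot_scale.
Proof. by move=> y; rewrite -(liftK y) -quot_piZ scale1r. Qed.

Fact quot_scaleDr : right_distributive quot_scale +%R.
Proof.
move=> k x y; rewrite -(liftK x) -(liftK y).
by rewrite -quot_piD -!quot_piZ -quot_piD scalerDr.
Qed.

Fact quot_scaleDl y : {morph quot_scale^~ y : a b / a + b}.
Proof.
by move=> a b; rewrite -(liftK y) /= -!quot_piZ -quot_piD scalerDl.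
Qed.

HB.instance Definition _ := GRing.Zmodule_isLmodule.Build K quot_alg
  quot_scaleA quot_scale1 quot_scaleDr quot_scaleDl.

Fact quot_scalerAl k (x y : quot_alg) : k *: (x * y) = k *: x * y.
Proof.
have -> : x * y = quot_mul x y by [].
rewrite -(liftK x) -(liftK y) -quot_piM -[LHS]quot_piZ scalerAl quot_piM.
by congr quot_mul; rewrite quot_piZ.
Qed.

Fact quot_scalerAr k (x y : quot_alg) : k *: (x * y) = x * (k *: y).
Proof.
have -> : x * y = quot_mul x y by [].
rewrite -(liftK x) -(liftK y) -quot_piM -[LHS]quot_piZ scalerAr quot_piM.
by congr quot_mul; rewrite quot_piZ.
Qed.

End QuotientAlgebra.

(* The algebra A is generated by the family x subject only to the relations   *)
(* r: evaluation from the free algebra is onto, and its kernel is the         *)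
(* two-sided ideal generated by r.                                            *)
Definition presents (K : comNzRingType) (I : choiceType) (A : algType K)
    (x : I -> A) (r : free_alg K I -> free_alg K I -> Prop) : Prop :=
  (forall a : A, exists p, feval x p = a) /\
  (forall p, feval x p = 0 <-> ideal_gen r p).

Notation "[ 'lie' x , y ]" := (x * y - y * x)
  (format "[ 'lie'  x ,  y ]") : ring_scope.

Section Yangian.
Variables (K : comNzRingType) (n : nat).

(* (i, j, r) stands for T_{i,j}^{(r.+1)}. *)
Definition Ygen : Type := ('I_n * 'I_n * nat)%type.
HB.instance Definition _ := Choice.on Ygen.

Let FA := free_alg K Ygen.

Definition fT (i j : 'I_n) (r : nat) : FA :=
  if r is s.+1 then fgen K ((i, j, s) : Ygen) else (i == j)%:R.

Inductive yangian_rel : FA -> FA -> Prop :=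
| Yangian_rel (i j h k : 'I_n) (r s : nat) :
  yangian_rel [lie fT i j r, fT h k s]
    (\sum_(t < minn r s)
       (fT i k (r + s - 1 - t) * fT h j t - fT i k t * fT h j (r + s - 1 - t))).

Definition Yangian : Type := quot_alg yangian_rel.

HB.instance Definition _ := GRing.PzRing.on Yangian.
HB.instance Definition _ := GRing.Lmodule.on Yangian.

Fact yangian_rel_augmentation (p q : FA) :
  yangian_rel p q -> feval (fun=> 0 : K^o) p = feval (fun=> 0 : K^o) q.
Proof.
pose ev : {rmorphism FA -> K^o} := feval (fun=> 0 : K^o).
have ev_gen g : ev (fgen K g) = 0 by exact: feval_gen.
rewrite -[feval _ p]/(ev p) -[feval _ q]/(ev q); clearbody ev.
have ev_fT i j r : (0 < r)%N -> ev (fT i j r) = 0.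
  by case: r => // r _; exact: ev_gen.
case=> i j h k r s; rewrite rmorphB rmorphM rmorphM [X in X - _]mulrC subrr.
rewrite rmorph_sum big1 // => t _.
have /andP[lt_tr lt_ts] : (t < r)%N && (t < s)%N by rewrite -leq_min.
have lt0 : (0 < r + s - 1 - t)%N by lia.
by rewrite rmorphB rmorphM rmorphM !(ev_fT _ _ _ lt0) mul0r mulr0 subr0.
Qed.

Fact Yangian_oner_neq0 : (1 : Yangian) != 0.
Proof.
apply/eqP; rewrite -(quot_pi0 yangian_rel) => /(quot_piP yangian_rel 1 0).
rewrite subr0.
move/(ideal_gen_ker (f := feval (fun=> 0 : K^o)) yangian_rel_augmentation).
by rewrite rmorph1; apply/eqP; exact: oner_neq0.
Qed.

HB.instance Definition _ :=
  GRing.PzSemiRing_isNonZero.Build Yangian Yangian_oner_neq0.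
HB.instance Definition _ :=
  GRing.Lmodule_isLalgebra.Build K Yangian (@quot_scalerAl _ _ _).
HB.instance Definition _ :=
  GRing.Lalgebra_isAlgebra.Build K Yangian (@quot_scalerAr _ _ _).

Definition yangian_pi (p : FA) : Yangian := quot_pi yangian_rel p.

HB.instance Definition _ := GRing.isZmodMorphism.Build FA Yangian yangian_pi
  (quot_piB yangian_rel).
HB.instance Definition _ := GRing.isMonoidMorphism.Build FA Yangian yangian_pi
  (erefl, quot_piM yangian_rel).
HB.instance Definition _ := GRing.isScalable.Build K FA Yangian _ yangian_pi
  (quot_piZ yangian_rel).

Definition yangian_gen (g : Ygen) : Yangian := yangian_pi (fgen K g).

Lemma feval_yangian_gen p : feval yangian_gen p = yangian_pi p.
Proof. by rewrite -[in RHS](feval_id p) feval_morph. Qed.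

Lemma yangian_presents : presents yangian_gen yangian_rel.
Proof.
split=> [y|p].
  have [p <-] := quot_pi_surj y.
  by exists p; rewrite feval_yangian_gen.
by rewrite feval_yangian_gen -[0](quot_pi0 yangian_rel) quot_piP subr0.
Qed.

Definition yangianT (i j : 'I_n) (r : nat) : Yangian :=
  if r is s.+1 then yangian_gen (i, j, s) else (i == j)%:R.

End Yangian.

(* A[[u^-1]]: the series f stands for \sum_(r >= 0) f r u^-r. *)
Definition fps (A : nzRingType) : Type := nat -> A.

HB.instance Definition _ (A : nzRingType) := gen_eqMixin (fps A).
HB.instance Definition _ (A : nzRingType) := gen_choiceMixin (fps A).

Section PowerSeries.
Variable A : nzRingType.
Implicit Types f g h : fps A.

Lemma fpsP f g : f =1 g <-> f = g.
Proof. by split=> [/funext|->]. Qed.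

Definition fps_zero : fps A := fun=> 0.
Definition fps_opp f : fps A := fun r => - f r.
Definition fps_add f g : fps A := fun r => f r + g r.
Definition fps_one : fps A := fun r => (r == 0)%:R.
Definition fps_mul f g : fps A := fun r => \sum_(t < r.+1) f t * g (r - t)%N.

Fact fps_addA : associative fps_add.
Proof. by move=> f g h; apply/fpsP => r; exact: addrA. Qed.
Fact fps_addC : commutative fps_add.
Proof. by move=> f g; apply/fpsP => r; exact: addrC. Qed.
Fact fps_add0 : left_id fps_zero fps_add.
Proof. by move=> f; apply/fpsP => r; exact: add0r. Qed.
Fact fps_addN : left_inverse fps_zero fps_opp fps_add.
Proof. by move=> f; apply/fpsP => r; exact: addNr. Qed.

HB.instance Definition _ := GRing.isZmodule.Build (fps A)
  fps_addA fps_addC fps_add0 fps_addN.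

Let trunc (N : nat) f : {poly A} := \poly_(i < N) f i.

Let trunc_mul N f g r : (r < N)%N -> fps_mul f g r = (trunc N f * trunc N g)`_r.
Proof.
move=> ltrN; rewrite coefM; apply: eq_bigr => t _; rewrite !coef_poly.
have ltt : (t < N)%N by have := ltn_ord t; lia.
by rewrite ltt (leq_ltn_trans (leq_subr _ _) ltrN).
Qed.

Fact fps_mulA : associative fps_mul.
Proof.
move=> f g h; apply/fpsP => r.
have E1 : fps_mul f (fps_mul g h) r =
    (trunc r.+1 f * (trunc r.+1 g * trunc r.+1 h))`_r.
  rewrite coefM; apply: eq_bigr => t _.
  rewrite coef_poly ltn_ord (@trunc_mul r.+1) //.
  by rewrite ltnS leq_subr.
rewrite E1 mulrA coefM; apply: eq_bigr => t _.
rewrite -(@trunc_mul r.+1) ?ltn_ord // coef_poly.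
by rewrite ltnS leq_subr.
Qed.

Fact fps_mul1 : left_id fps_one fps_mul.
Proof.
move=> f; apply/fpsP => r; rewrite /fps_mul big_ord_recl /fps_one mul1r subn0.
by rewrite big1 ?addr0 // => t _; rewrite mul0r.
Qed.

Fact fps_mulr1 : right_id fps_one fps_mul.
Proof.
move=> f; apply/fpsP => r; rewrite /fps_mul big_ord_recr /= /fps_one subnn mulr1.
rewrite big1 ?add0r // => t _; rewrite subn_eq0 leqNgt ltn_ord mulr0 //.
Qed.

Fact fps_mulDl : left_distributive fps_mul fps_add.
Proof.
move=> f g h; apply/fpsP => r; rewrite /fps_mul /fps_add -big_split.
by apply: eq_bigr => t _; rewrite mulrDl.
Qed.

Fact fps_mulDr : right_distributive fps_mul fps_add.
Proof.
move=> f g h; apply/fpsP => r; rewrite /fps_mul /fps_add -big_split.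
by apply: eq_bigr => t _; rewrite mulrDr.
Qed.

Fact fps_oner_neq0 : fps_one != 0.
Proof.
apply/eqP => /fpsP/(_ 0); rewrite /fps_one eqxx => /eqP.
by rewrite (negbTE (oner_neq0 A)).
Qed.

HB.instance Definition _ := GRing.Zmodule_isNzRing.Build (fps A)
  fps_mulA fps_mul1 fps_mulr1 fps_mulDl fps_mulDr fps_oner_neq0.

Lemma fps0E r : (0 : fps A) r = 0. Proof. by []. Qed.
Lemma fps1E r : (1 : fps A) r = (r == 0)%:R. Proof. by []. Qed.
Lemma fpsNE f r : (- f) r = - f r. Proof. by []. Qed.
Lemma fpsDE f g r : (f + g) r = f r + g r. Proof. by []. Qed.
Lemma fpsBE f g r : (f - g) r = f r - g r. Proof. by []. Qed.
Lemma fpsME f g r : (f * g) r = \sum_(t < r.+1) f t * g (r - t)%N.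
Proof. by []. Qed.
Lemma fpsM0E f g : (f * g) 0 = f 0 * g 0.
Proof. by rewrite fpsME big_ord_recl big_ord0 addr0. Qed.
Lemma fps_sumE (I : Type) (s : seq I) (P : pred I) (F : I -> fps A) r :
  (\sum_(i <- s | P i) F i) r = \sum_(i <- s | P i) F i r.
Proof. by apply: (big_morph (fun f : fps A => f r)). Qed.

Let invertible f := exists g, g * f = 1 /\ f * g = 1.
Let fps_unit : pred (fps A) := fun f => `[< invertible f >].
Let fps_inv f : fps A :=
  if pselect (invertible f) is left ex_g then projT1 (cid ex_g) else f.

Fact fps_invP f : f \in fps_unit -> fps_inv f * f = 1 /\ f * fps_inv f = 1.
Proof.
move/asboolP => ex_g; rewrite /fps_inv.
by case: pselect => // ex_g'; case: cid.
Qed.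

Fact fps_mulVr : {in fps_unit, left_inverse 1 fps_inv *%R}.
Proof. by move=> f /fps_invP[]. Qed.
Fact fps_divrr : {in fps_unit, right_inverse 1 fps_inv *%R}.
Proof. by move=> f /fps_invP[]. Qed.
Fact fps_unitP f g : g * f = 1 /\ f * g = 1 -> fps_unit f.
Proof. by move=> fg1; apply/asboolP; exists g. Qed.
Fact fps_inv_out : {in [predC fps_unit], fps_inv =1 id}.
Proof.
move=> f /negP nf; rewrite /fps_inv; case: pselect => // ex_g.
by case: nf; exact/asboolP.
Qed.

HB.instance Definition _ := GRing.NzRing_hasMulInverse.Build (fps A)
  fps_mulVr fps_divrr fps_unitP fps_inv_out.

Let fps_expr_lt f k r : f 0 = 0 -> (r < k)%N -> (f ^+ k) r = 0.
Proof.
move=> f0; elim: k r => // k IHk r ltrk.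
rewrite exprS fpsME big1 // => -[[|t] ltt] _ /=; first by rewrite f0 mul0r.
by rewrite IHk ?mulr0 //; lia.
Qed.

Let fps_rinv f : f 0 = 1 -> exists2 g, f * g = 1 & g 0 = 1.
Proof.
move=> f0; pose x : fps A := 1 - f; have x0 : x 0 = 0.
  by rewrite /x fpsBE fps1E f0 subrr.
pose S N := \sum_(k < N) x ^+ k.
exists (fun r => S r.+1 r); last by rewrite /S big_ord_recl big_ord0 addr0.
have SE r N : (r < N)%N -> S N r = S r.+1 r.
  elim: N => // N IHN; rewrite ltnS leq_eqVlt => /orP[/eqP->//|ltrN].
  by rewrite -IHN // /S big_ord_recr /= fpsDE fps_expr_lt // addr0.
apply/fpsP => r.
transitivity ((f * S r.+1) r).
  rewrite !fpsME; apply: eq_bigr => t _; congr (_ * _).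
  by rewrite [RHS]SE // ltnS leq_subr.
have -> : f * S r.+1 = 1 - x ^+ r.+1.
  have -> : f = - (x - 1) by rewrite /x opprB subKr.
  by rewrite mulNr /S -subrX1 opprB.
by rewrite fpsBE fps_expr_lt // subr0.
Qed.

Lemma fps_unit1 f : f 0 = 1 -> f \is a GRing.unit.
Proof.
move=> f0; have [g fg1 g0] := fps_rinv f0; have [h gh1 _] := fps_rinv g0.
apply/unitrP; exists g; split=> //.
by have -> : f = h by rewrite -[f]mulr1 -gh1 mulrA fg1 mul1r.
Qed.

End PowerSeries.

(* is_trig_mx means lower triangular. *)
Definition gauss_factorization (R : nzRingType) (n : nat)
    (T F D E : 'M[R]_n) : Prop :=
  [/\ T = F *m D *m E,
      is_trig_mx F /\ (forall i, F i i = 1),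
      is_diag_mx D
    & is_trig_mx E^T /\ (forall i, E i i = 1)].

Section GaussFactorization.
Variable A : nzRingType.

Let unipotent0 n (T : 'M[fps A]_n) := forall i j, T i j 0 = (i == j)%:R.

Let mx11_unit (R : nzRingType) (a : 'M[R]_1) : a 0 0 = 1 -> a = 1%:M.
Proof. by move=> a1; rewrite [a]mx11_scalar a1. Qed.

Section Step.
Variables (n : nat) (T : 'M[fps A]_(1 + n)).
Hypothesis T0 : unipotent0 T.

Local Definition gauss_pivot : 'M[fps A]_1 := ulsubmx T.
Local Notation a := gauss_pivot.
Local Definition gauss_pivotV : 'M[fps A]_1 := ((a 0 0)^-1)%:M.
Local Notation ai := gauss_pivotV.
Local Definition schur : 'M[fps A]_n :=
  drsubmx T - dlsubmx T *m ai *m ursubmx T.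
Local Notation S := schur.

Let a_unit : a 0 0 \is a GRing.unit.
Proof. by apply: fps_unit1; rewrite !mxE T0 eqxx. Qed.

Let aiK : ai *m a = 1%:M.
Proof. by rewrite [a]mx11_scalar -scalar_mxM mulVr. Qed.

Let aKi : a *m ai = 1%:M.
Proof. by rewrite [a in LHS]mx11_scalar -scalar_mxM divrr. Qed.

Lemma schur0 : unipotent0 S.
Proof.
move=> i j; rewrite /schur mxE [X in _ + X]mxE fpsBE.
rewrite [X in X - _](_ : _ = (i == j)%:R); last first.
  by rewrite !mxE T0 (inj_eq (@rshift_inj _ _)).
rewrite mxE fps_sumE big1 ?subr0 // => k _.
by rewrite fpsM0E [ursubmx T k j]mxE [usubmx _ _ _]mxE T0 eq_lrshift mulr0.
Qed.

Lemma gauss_exists_step F D E : gauss_factorization S F D E ->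
  exists F1 D1 E1, gauss_factorization T F1 D1 E1.
Proof.
move=> [SE [Ft F1] Dd [Et E1]].
exists (block_mx 1%:M 0 (dlsubmx T *m ai) F), (block_mx a 0 0 D),
       (block_mx 1%:M (ai *m ursubmx T) 0 E).
split.
- rewrite !mulmx_block !mul1mx !mulmx1 !mul0mx !mulmx0 !addr0 !add0r.
  rewrite -!mulmxA aiK mulmx1 !(mulmxA a) aKi mul1mx.
  rewrite mul0mx addr0 (mulmxA F D E) -SE /schur -mulmxA addrC subrK.
  by rewrite submxK.
- split; first by rewrite is_trig_block_mx // mx11_is_trig eqxx.
  by move=> i; case: (split_ordP i) => k ->;
    rewrite ?block_mxEul ?block_mxEdr // mxE eqxx.
- by rewrite is_diag_block_mx // mx11_is_diag !eqxx.
- split; first by rewrite tr_block_mx is_trig_block_mx // trmx0 trmx1 mx11_is_trig eqxx.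
  by move=> i; case: (split_ordP i) => k ->;
    rewrite ?block_mxEul ?block_mxEdr // mxE eqxx.
Qed.

Lemma gauss_step F1 D1 E1 : gauss_factorization T F1 D1 E1 ->
  exists F D E, [/\ gauss_factorization S F D E,
    F1 = block_mx 1%:M 0 (dlsubmx T *m ai) F,
    D1 = block_mx a 0 0 D &
    E1 = block_mx 1%:M (ai *m ursubmx T) 0 E].
Proof.
move=> [TE [Ft Fd] Dd [Et Ed]].
move: TE Ft Fd Dd Et Ed.
rewrite -[F1]submxK -[D1]submxK -[E1]submxK.
set f := ulsubmx F1; set f' := dlsubmx F1; set F := drsubmx F1.
set d := ulsubmx D1; set D := drsubmx D1.
set e := ulsubmx E1; set e' := ursubmx E1; set E := drsubmx E1.
rewrite tr_block_mx !is_trig_block_mx // is_diag_block_mx //.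
rewrite mulmx_block mulmx_block.
move=> TE /and3P[/eqP F12 _ Ft] Fd /and4P[/eqP D12 /eqP D21 _ Dd].
rewrite -[_ == 0](inj_eq trmx_inj) trmxK trmx0.
move=> /and3P[/eqP E21 _ Et] Ed.
have f1 : f = 1%:M by apply: mx11_unit; rewrite -(Fd (lshift n 0)) block_mxEul.
have e1 : e = 1%:M by apply: mx11_unit; rewrite -(Ed (lshift n 0)) block_mxEul.
rewrite f1 e1 F12 D12 D21 E21 in TE *.
move: TE; rewrite !mul1mx ?mulmx1 ?mul0mx ?mulmx0 ?addr0 ?add0r ?mulmx1 ?mul0mx ?addr0.
rewrite -[LHS]submxK => /eq_block_mx[ad Tur Tdl Tdr].
rewrite -/a in ad; rewrite -ad in Tur Tdl Tdr *.
exists F, D, E; split.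
- split=> //.
  + rewrite /schur Tdr Tur Tdl -(mulmxA f' a ai) aKi mulmx1 mulmxA.
    by rewrite addrC addKr.
  + by split=> // i; rewrite -(Fd (rshift 1 i)) block_mxEdr.
  + by split=> // i; rewrite -(Ed (rshift 1 i)) block_mxEdr.
- by rewrite Tdl -mulmxA aKi mulmx1.
- by [].
- by rewrite Tur mulmxA aiK mul1mx.
Qed.

End Step.

Lemma gauss_factorization_exists n (T : 'M[fps A]_n) :
  (forall i j, T i j 0 = (i == j)%:R) ->
  exists F D E, gauss_factorization T F D E.
Proof.
elim: n T => [|n IHn] T T0.
  exists 0, 0, 0; split; do ?split; do ?[by case].
  - by apply/matrixP => -[].
  - by apply/is_trig_mxP => -[].
  - by apply/is_diag_mxP => -[].
  - by apply/is_trig_mxP => -[].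
have [F [D [E S_FDE]]] := IHn _ (schur0 T0).
have [F1 [D1 [E1 T_FDE]]] := gauss_exists_step T0 S_FDE.
by exists F1, D1, E1.
Qed.

Lemma gauss_factorization_unique n (T F D E F' D' E' : 'M[fps A]_n) :
  (forall i j, T i j 0 = (i == j)%:R) ->
  gauss_factorization T F D E -> gauss_factorization T F' D' E' ->
  [/\ F = F', D = D' & E = E'].
Proof.
elim: n T F D E F' D' E' => [|n IHn] T F D E F' D' E' T0.
  by move=> _ _; split; apply/matrixP => -[].
move=> /(gauss_step T0)[G [B [H [S1 -> -> ->]]]].
move=> /(gauss_step T0)[G' [B' [H' [S2 -> -> ->]]]].
by have [-> -> ->] := IHn _ _ _ _ _ _ _ (schur0 T0) S1 S2.
Qed.

End GaussFactorization.

Section Drinfeld.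
Variables (K : comNzRingType) (n : nat).

Definition yangian_mx : 'M[fps (Yangian K n)]_n :=
  \matrix_(i, j) (yangianT K i j : fps (Yangian K n)).

Lemma yangian_gauss :
  exists! FDE : 'M[fps (Yangian K n)]_n * 'M[fps (Yangian K n)]_n
                * 'M[fps (Yangian K n)]_n,
  gauss_factorization yangian_mx FDE.1.1 FDE.1.2 FDE.2.
Proof.
have T0 i j : yangian_mx i j 0 = (i == j)%:R by rewrite mxE.
have [F [D [E T_FDE]]] := gauss_factorization_exists T0.
exists (F, D, E); split=> // -[[F' D'] E'] /= T_FDE'.
by have [-> -> ->] := gauss_factorization_unique T0 T_FDE T_FDE'.
Qed.

(* Dgen i r and Dtgen i r stand for D_{i+1}^{(r)} and \widetilde D_{i+1}^{(r)},*)
(* Egen i r and Fgen i r for E_{i+1}^{(r.+1)} and F_{i+1}^{(r.+1)}.           *)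
Inductive Drinfeld_gen : Type :=
| Dgen of 'I_n & nat
| Dtgen of 'I_n & nat
| Egen of 'I_n.-1 & nat
| Fgen of 'I_n.-1 & nat.

Definition Drinfeld_gen_code (g : Drinfeld_gen) :
    ('I_n * nat + 'I_n * nat) + ('I_n.-1 * nat + 'I_n.-1 * nat) :=
  match g with
  | Dgen i r => inl (inl (i, r)) | Dtgen i r => inl (inr (i, r))
  | Egen i r => inr (inl (i, r)) | Fgen i r => inr (inr (i, r))
  end.

Definition Drinfeld_gen_decode
    (c : ('I_n * nat + 'I_n * nat) + ('I_n.-1 * nat + 'I_n.-1 * nat)) :=
  match c with
  | inl (inl (i, r)) => Dgen i r | inl (inr (i, r)) => Dtgen i r
  | inr (inl (i, r)) => Egen i r | inr (inr (i, r)) => Fgen i r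
  end.

Fact Drinfeld_gen_codeK : cancel Drinfeld_gen_code Drinfeld_gen_decode.
Proof. by case. Qed.

HB.instance Definition _ :=
  Choice.copy Drinfeld_gen (can_type Drinfeld_gen_codeK).

Fact ord_next_subproof (i : 'I_n.-1) : (i.+1 < n)%N.
Proof. by have := ltn_ord i; lia. Qed.

(* The positions i and i + 1 in {1, ..., n} of an index 1 <= i < n. *)
Definition ord_this (i : 'I_n.-1) : 'I_n := widen_ord (leq_pred n) i.
Definition ord_next (i : 'I_n.-1) : 'I_n := Ordinal (ord_next_subproof i).

(* F_i(u) = F_{i,i+1}(u) is the (i + 1, i)-entry of F(u). *)
Definition Drinfeld_elt (F D E : 'M[fps (Yangian K n)]_n) (g : Drinfeld_gen) :
    Yangian K n :=
  match g with
  | Dgen i r => D i i r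
  | Dtgen i r => (- (D i i)^-1) r
  | Egen i r => E (ord_this i) (ord_next i) r.+1
  | Fgen i r => F (ord_next i) (ord_this i) r.+1
  end.

Let FA := free_alg K Drinfeld_gen.

Definition fD (i : 'I_n) (r : nat) : FA := fgen K (Dgen i r).
Definition fDt (i : 'I_n) (r : nat) : FA := fgen K (Dtgen i r).
Definition fE (i : 'I_n.-1) (r : nat) : FA :=
  if r is s.+1 then fgen K (Egen i s) else 0.
Definition fF (i : 'I_n.-1) (r : nat) : FA :=
  if r is s.+1 then fgen K (Fgen i s) else 0.

(* Upper indices of E and F are always positive below: fE i 0 and fF i 0 do   *)
(* not occur.                                                                 *)
Inductive Drinfeld_rel : FA -> FA -> Prop :=
| Drinfeld_D0 i : Drinfeld_rel (fD i 0) 1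
| Drinfeld_DDt i r :
  Drinfeld_rel (\sum_(t < r.+1) fD i t * fDt i (r - t)) (- (r == 0)%:R)
| Drinfeld_DD i j r s : Drinfeld_rel [lie fD i r, fD j s] 0
| Drinfeld_EF i j r s : (0 < r)%N -> (0 < s)%N ->
  Drinfeld_rel [lie fE i r, fF j s]
    ((i == j)%:R *
      \sum_(t < r + s) fDt (ord_this i) t * fD (ord_next i) (r + s - 1 - t))
| Drinfeld_DE i j r s : (0 < s)%N ->
  Drinfeld_rel [lie fD i r, fE j s]
    (((i == ord_this j)%:R - (i == ord_next j)%:R) *
      \sum_(t < r) fD i t * fE j (r + s - 1 - t))
| Drinfeld_DF i j r s : (0 < s)%N ->
  Drinfeld_rel [lie fD i r, fF j s]
    (((i == ord_next j)%:R - (i == ord_this j)%:R) *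
      \sum_(t < r) fF j (r + s - 1 - t) * fD i t)
| Drinfeld_EE i r s : (0 < r)%N -> (0 < s)%N ->
  Drinfeld_rel [lie fE i r, fE i s]
    (\sum_(1 <= t < s) fE i t * fE i (r + s - 1 - t)
     - \sum_(1 <= t < r) fE i t * fE i (r + s - 1 - t))
| Drinfeld_FF i r s : (0 < r)%N -> (0 < s)%N ->
  Drinfeld_rel [lie fF i r, fF i s]
    (\sum_(1 <= t < r) fF i (r + s - 1 - t) * fF i t
     - \sum_(1 <= t < s) fF i (r + s - 1 - t) * fF i t)
| Drinfeld_EE_next (i j : 'I_n.-1) r s :
  j = i.+1 :> nat -> (0 < r)%N -> (0 < s)%N ->
  Drinfeld_rel ([lie fE i r, fE j s.+1] - [lie fE i r.+1, fE j s])
    (- (fE i r * fE j s))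
| Drinfeld_FF_next (i j : 'I_n.-1) r s :
  j = i.+1 :> nat -> (0 < r)%N -> (0 < s)%N ->
  Drinfeld_rel ([lie fF i r.+1, fF j s] - [lie fF i r, fF j s.+1])
    (- (fF j s * fF i r))
| Drinfeld_EE_far (i j : 'I_n.-1) r s :
  (i.+1 < j)%N || (j.+1 < i)%N -> (0 < r)%N -> (0 < s)%N ->
  Drinfeld_rel [lie fE i r, fE j s] 0
| Drinfeld_FF_far (i j : 'I_n.-1) r s :
  (i.+1 < j)%N || (j.+1 < i)%N -> (0 < r)%N -> (0 < s)%N ->
  Drinfeld_rel [lie fF i r, fF j s] 0
| Drinfeld_Serre_E (i j : 'I_n.-1) r s t :
  j = i.+1 :> nat \/ i = j.+1 :> nat -> (0 < r)%N -> (0 < s)%N -> (0 < t)%N ->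
  Drinfeld_rel
    ([lie fE i r, [lie fE i s, fE j t]] + [lie fE i s, [lie fE i r, fE j t]]) 0
| Drinfeld_Serre_F (i j : 'I_n.-1) r s t :
  j = i.+1 :> nat \/ i = j.+1 :> nat -> (0 < r)%N -> (0 < s)%N -> (0 < t)%N ->
  Drinfeld_rel
    ([lie fF i r, [lie fF i s, fF j t]] + [lie fF i s, [lie fF i r, fF j t]]) 0.

End Drinfeld.

(* Main.v *)
From HB Require Import structures.
Require Import Defs.
From mathcomp Require Import all_boot all_order all_algebra.
From mathcomp Require Import zify boolp monalg reals complex.

Set Implicit Arguments.
Unset Strict Implicit.
Unset Printing Implicit Defensive.
Import GRing.Theory.
Local Open Scope ring_scope.

(** Write x = 1/u, y = 1/v, and let z = y - x and d = xy, so that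
    z W = d W' means (u - v) W = W'.  The defining relations of the Yangian say
    that its matrix T satisfies the RTT relation
      z [T_ij(u), T_hk(v)] = d (T_hj(u) T_ik(v) - T_hj(v) T_ik(u)),
    and the theorem states that the RTT matrices T with constant term 1 over
    an algebra are the same thing as families D, E, F of series satisfying the
    Drinfeld relations, through the Gauss factorization T = F D E.  If so,
    both algebras represent the same functor, and the universal families of
    the two sides correspond to each other.

    From T to D, E, F ([rtt_Drel]).  The inverse of an RTT matrix is an RTT
    matrix for -z ([rtt_inv]), and the Schur complement of the upper left
    entry is the inverse of a block of the inverse; hence it is again an RTT
    matrix ([rtt_schur]).  The factorization is computed by iterating Schur
    complements, so it suffices to find the relations that involve the first
    one or two steps.  They are linear combinations of RTT relations, except
    for the relation between two entries e, g of the first row of E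
    ([row_EE]), for which one has to show first that e(u) and g(u) commute:
    this follows by setting v = u - 1 ([shift_lemma]).  A Serre relation
    expresses that certain commutators are antisymmetric in their upper
    indices, and this is a consequence of [row_EE] applied to T or to the
    inverse of a 3 x 3 corner ([corner_Serre]).  The relations of F are those
    of E for the transposed matrix over the opposite algebra.

    From D, E, F to T ([matrix_of_data]).  The coefficients of 1/u in T satisfy
    the relations of gl_n and act on T(u) by commutators as gl_n acts on
    n x n matrices.  Thus T is determined by D_1(u) and gl_n, since the matrix
    unit e_11 generates the module of matrices.  Conversely, by induction on n
    the families D_2.., E_2.., F_2.. come from a matrix of size n - 1; its
    coefficients of 1/u extend by E_1^(1), F_1^(1) and D_1^(1) to a
    representation of gl_n ([gl_extend]), and the orbit of D_1(u) under this
    representation is a matrix T ([orbit_equivariant]).  The failure of the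
    RTT relation for T is a gl_n-equivariant tensor, and it vanishes once four
    of its components do ([defect_zero]), which involve only D_1, D_2, E_1,
    F_1.  Finally T has the coordinates D, E, F ([coords_of_data]).

    So an RTT matrix exists over the algebra presented by the Drinfeld
    relations, which gives a morphism from the Yangian to this algebra; it
    inverts the evaluation at the Gauss coordinates ([drinfeld_inverse])
    because Gauss factorizations are unique.  Surjectivity is the remark that
    the entries of T are iterated commutators of the coefficients of D, E, F
    ([rtt_gen]). *)

(** * Linear identities over a noncommutative ring with central scalars *)

Definition central (R : nzRingType) (c : R) := forall x, c * x = x * c.

Inductive ncexpr :=
| NCvar of nat | NCcst of nat | NC0 | NC1 | NCopp of ncexpr
| NCadd of ncexpr & ncexpr | NCmul of ncexpr & ncexpr.

(** The central atoms of a monomial are kept apart from the others, as a sorted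
    multiset in front of a word. *)
Definition ncmon : Type := (seq nat * seq nat)%type.
Definition ncpoly : Type := seq (int * ncmon).

Definition ncpoly_mul (p q : ncpoly) : ncpoly :=
  flatten [seq [seq (s.1 * t.1, (sort leq (s.2.1 ++ t.2.1), s.2.2 ++ t.2.2))
               | t <- q] | s <- p].

Fixpoint ncnorm (e : ncexpr) : ncpoly :=
  match e with
  | NCvar i => [:: (1, ([::], [:: i]))]
  | NCcst i => [:: (1, ([:: i], [::]))]
  | NC0 => [::]
  | NC1 => [:: (1, ([::], [::]))]
  | NCopp e1 => [seq (- t.1, t.2) | t <- ncnorm e1]
  | NCadd e1 e2 => ncnorm e1 ++ ncnorm e2
  | NCmul e1 e2 => ncpoly_mul (ncnorm e1) (ncnorm e2)
  end.

Fixpoint ncpoly_ins (t : int * ncmon) (p : ncpoly) : ncpoly :=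
  if p is t' :: p' then
    if t.2 == t'.2 then (t.1 + t'.1, t'.2) :: p' else t' :: ncpoly_ins t p'
  else [:: t].

Definition ncpoly_eq0 (p : ncpoly) :=
  all (fun t : int * ncmon => t.1 == 0) (foldr ncpoly_ins [::] p).

Section NCEval.
Variables (R : nzRingType) (V : seq R) (C : seq {c : R | central c}).

Let cst i : R := if onth C i is Some c then sval c else 0.
Let word (f : nat -> R) (s : seq nat) : R := \prod_(i <- s) f i.

Fixpoint nceval (e : ncexpr) : R :=
  match e with
  | NCvar i => nth 0 V i
  | NCcst i => cst i
  | NC0 => 0
  | NC1 => 1
  | NCopp e1 => - nceval e1
  | NCadd e1 e2 => nceval e1 + nceval e2
  | NCmul e1 e2 => nceval e1 * nceval e2
  end.

Let mon (m : ncmon) : R := word cst m.1 * word (nth 0 V) m.2.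
Let peval (p : ncpoly) : R := \sum_(t <- p) mon t.2 *~ t.1.

Let cst_central i : central (cst i).
Proof.
rewrite /cst; case: onth => [[c cC] x //|x]; by rewrite mul0r mulr0.
Qed.

Let word_central s : central (word cst s).
Proof.
move=> x; rewrite /word; elim: s => [|i s IHs]; first by rewrite big_nil mul1r mulr1.
by rewrite big_cons -mulrA IHs mulrA cst_central -mulrA.
Qed.

Let word_perm s t : perm_eq s t -> word cst s = word cst t.
Proof.
elim: s t => [|i s IHs] t; first by rewrite perm_sym => /perm_nilP->.
move=> st; have i_t : i \in t by rewrite -(perm_mem st) mem_head.
have [t1 [t2 et]] : exists t1 t2, t = t1 ++ i :: t2.
  by case/splitPr: i_t => t1 t2; exists t1, t2.
have st' : perm_eq s (t1 ++ t2).
  by rewrite -(perm_cons i) (perm_trans st) // et perm_catC /= perm_cons perm_catC.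
rewrite et /word big_cons big_cat /= big_cons [LHS]/= -/(word cst s) (IHs _ st').
by rewrite /word big_cat /= !mulrA (cst_central i).
Qed.

Let mon_mul s t : mon (sort leq (s.1 ++ t.1), s.2 ++ t.2) = mon s * mon t.
Proof.
rewrite /mon /= (@word_perm _ (s.1 ++ t.1)) ?perm_sort //.
rewrite /word !big_cat /= -!/(word _ _) -!mulrA; congr (_ * _).
by rewrite mulrA word_central -!mulrA.
Qed.

Let peval_cat p q : peval (p ++ q) = peval p + peval q.
Proof. by rewrite /peval big_cat. Qed.

Let peval_mul p q : peval (ncpoly_mul p q) = peval p * peval q.
Proof.
rewrite /peval /ncpoly_mul big_flatten /= big_map mulr_suml.
apply: eq_bigr => s _; rewrite big_map mulr_sumr; apply: eq_bigr => t _ /=.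
by rewrite mon_mul mulrzAl mulrzAr mulrzA mulrzAC.
Qed.

Let ncnormP e : peval (ncnorm e) = nceval e.
Proof.
elim: e => [i|i|||e IHe|e1 IH1 e2 IH2|e1 IH1 e2 IH2] /=.
- by rewrite /peval big_seq1 /mon /word big_nil big_seq1 mul1r.
- by rewrite /peval big_seq1 /mon /word big_nil big_seq1 mulr1.
- by rewrite /peval big_nil.
- by rewrite /peval big_seq1 /mon /word !big_nil mulr1.
- by rewrite -IHe /peval big_map -sumrN; apply: eq_bigr => t _; rewrite mulrNz.
- by rewrite peval_cat IH1 IH2.
- by rewrite peval_mul IH1 IH2.
Qed.

Let ncpoly_insP t p : peval (ncpoly_ins t p) = mon t.2 *~ t.1 + peval p.
Proof.
elim: p => [|t' p IHp] /=; first by rewrite /peval big_seq1 big_nil addr0.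
rewrite /peval; case: eqP => [->|_]; rewrite !big_cons.
  by rewrite /= mulrzDr addrA.
by rewrite -/(peval _) IHp addrCA.
Qed.

(** Two expressions agree if their difference has the zero normal form: an
    identity that holds for formal noncommuting variables and central scalars
    is decided by computation. *)
Lemma ncpoly_eq0P e1 e2 :
  ncpoly_eq0 (ncnorm (NCadd e1 (NCopp e2))) -> nceval e1 = nceval e2.
Proof.
move=> e0; apply/eqP; rewrite -subr_eq0; apply/eqP.
rewrite -[_ - _]/(nceval (NCadd e1 (NCopp e2))) -ncnormP.
move: (ncnorm _) e0 => p; rewrite /ncpoly_eq0 => p0.
have -> : peval p = peval (foldr ncpoly_ins [::] p).
  elim: p {p0} => //= t p IHp; rewrite ncpoly_insP -IHp.
  by rewrite /peval big_cons.
rewrite /peval big1_seq // => t /= t_p.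
by rewrite (eqP (allP p0 t t_p)).
Qed.

End NCEval.

Ltac nc_find x l :=
  lazymatch l with
  | x :: _ => constr:(O)
  | _ :: ?l' => let k := nc_find x l' in constr:(S k)
  end.

Ltac nc_findc x l :=
  lazymatch l with
  | exist _ x _ :: _ => constr:(O)
  | _ :: ?l' => let k := nc_findc x l' in constr:(S k)
  end.

(* An atom is central if a hypothesis says so; it then goes to the environment
   C together with that hypothesis, and to V otherwise. *)
Ltac nc_env e V C :=
  lazymatch e with
  | @GRing.add _ ?x ?y =>
    lazymatch nc_env x V C with (?V', ?C') => nc_env y V' C' end
  | @GRing.mul _ ?x ?y =>
    lazymatch nc_env x V C with (?V', ?C') => nc_env y V' C' end
  | @GRing.opp _ ?x => nc_env x V C
  | @GRing.zero _ => constr:((V, C))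
  | @GRing.one _ => constr:((V, C))
  | ?x =>
    match goal with
    | cx : central x |- _ =>
      match constr:(O) with
      | _ => let k := nc_findc x C in constr:((V, C))
      | _ => constr:((V, exist (fun c => central c) x cx :: C))
      end
    | _ =>
      match constr:(O) with
      | _ => let k := nc_find x V in constr:((V, C))
      | _ => let V' := eval cbv [cat] in (V ++ [:: x]) in constr:((V', C))
      end
    end
  end.

Ltac nc_reify e V C :=
  lazymatch e with
  | @GRing.add _ ?x ?y =>
    let a := nc_reify x V C in let b := nc_reify y V C in constr:(NCadd a b)
  | @GRing.mul _ ?x ?y =>
    let a := nc_reify x V C in let b := nc_reify y V C in constr:(NCmul a b)
  | @GRing.opp _ ?x => let a := nc_reify x V C in constr:(NCopp a)
  | @GRing.zero _ => constr:(NC0)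
  | @GRing.one _ => constr:(NC1)
  | ?x =>
    match constr:(O) with
    | _ => let k := nc_findc x C in constr:(NCcst k)
    | _ => let k := nc_find x V in constr:(NCvar k)
    end
  end.

Ltac ncring :=
  lazymatch goal with
  | |- @eq ?T ?x ?y =>
    let VC := nc_env x (@nil T) (@nil {c : T | central c}) in
    lazymatch VC with (?V, ?C) =>
    lazymatch nc_env y V C with (?V1, ?C1) =>
      let a := nc_reify x V1 C1 in
      let b := nc_reify y V1 C1 in
      refine (@ncpoly_eq0P _ V1 C1 a b _); vm_compute; exact: isT
    end end
  end.

Section LinComb.
Variable R : nzRingType.
Implicit Types x y l r p q : R.

(** An equation x = y follows from equations l_i = r_i in a noncommutative ring
    when x - y is the sum of the p_i (l_i - r_i) q_i; the coefficients p_i and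
    q_i form a certificate whose verification is a ring identity. *)
Lemma lc_rel p l r q : l = r -> p * (l - r) * q = 0.
Proof. by move=> ->; rewrite subrr mulr0 mul0r. Qed.
Lemma lc_add x y : x = 0 -> y = 0 -> x + y = 0.
Proof. by move=> -> ->; rewrite addr0. Qed.
Lemma lc_eq w x y : w = 0 -> x - y = w -> x = y.
Proof. by move=> -> /eqP; rewrite subr_eq0 => /eqP. Qed.

End LinComb.

Notation "x +! y" := (lc_add x y) (at level 50, left associativity).

(** * Series in two spectral parameters *)

Section FpsConst.
Variable A : nzRingType.

Definition fpsC (a : A) : fps A := fun r => if r is 0 then a else 0.
Definition fpsX : fps A := fun r => (r == 1)%:R.

Lemma fpsCM_l a (f : fps A) r : (fpsC a * f) r = a * f r.
Proof.
rewrite fpsME big_ord_recl subn0 /= big1 ?addr0 // => i _.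
by rewrite mul0r.
Qed.

Lemma fpsCM_r a (f : fps A) r : (f * fpsC a) r = f r * a.
Proof.
rewrite fpsME big_ord_recr subnn /= big1 ?add0r // => i _.
have := ltn_ord i; rewrite /fpsC; case E: (r - i)%N => [|k] /= lt_ir; first by lia.
by rewrite mulr0.
Qed.

Fact fpsC_zmod : zmod_morphism fpsC.
Proof. by move=> a b; apply/fpsP => -[|r] //; rewrite fpsBE /= subr0. Qed.
Fact fpsC_monoid : monoid_morphism fpsC.
Proof.
split=> [|a b]; first by apply/fpsP => -[|r].
by apply/fpsP => r; rewrite fpsCM_l; case: r => //= r; rewrite mulr0.
Qed.
HB.instance Definition _ := GRing.isZmodMorphism.Build A (fps A) fpsC fpsC_zmod.
HB.instance Definition _ := GRing.isMonoidMorphism.Build A (fps A) fpsC fpsC_monoid.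

Lemma fpsXM (f : fps A) r : (fpsX * f) r = if r is s.+1 then f s else 0.
Proof.
rewrite fpsME big_ord_recl /= mul0r add0r; case: r => [|r].
  by rewrite big_ord0.
rewrite big_ord_recl /= mul1r big1 ?addr0 ?subSS ?subn0 // => i _.
by rewrite mul0r.
Qed.

Lemma fpsX_central : central fpsX.
Proof.
move=> f; apply/fpsP => r; rewrite fpsXM; symmetry.
rewrite fpsME; case: r => [|r]; first by rewrite big_ord_recl big_ord0 mulr0 addr0.
rewrite big_ord_recr big_ord_recr /= subnn mulr0 addr0 subSnn mulr1.
rewrite big1 ?add0r // => i _; have := ltn_ord i.
by rewrite /fpsX; case: eqP => [|_ _]; [lia|rewrite mulr0].
Qed.

Lemma fpsC_central a : central a -> central (fpsC a).
Proof. by move=> aC f; apply/fpsP => r; rewrite fpsCM_l fpsCM_r aC. Qed.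

Lemma fps_reg0 (w f : fps A) :
  (forall a, w 0 * a = 0 -> a = 0) -> w * f = 0 -> f = 0.
Proof.
move=> w0 wf; apply/fpsP => r; elim/ltn_ind: r => r IHr.
apply: w0; have /fpsP/(_ r) := wf; rewrite fpsME big_ord_recl subn0 big1 ?addr0 //.
by move=> i _; rewrite IHr ?mulr0 //= /bump; have := ltn_ord i; lia.
Qed.

End FpsConst.

Section FpsMap.
Variables (A B : nzRingType) (phi : {rmorphism A -> B}).

Definition fps_map (f : fps A) : fps B := fun r => phi (f r).

Fact fps_map_zmod : zmod_morphism fps_map.
Proof. by move=> f g; apply/fpsP => r; rewrite /fps_map fpsBE rmorphB. Qed.
Fact fps_map_monoid : monoid_morphism fps_map.
Proof.
split=> [|f g]; apply/fpsP => r; rewrite /fps_map.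
  by rewrite !fps1E rmorph_nat.
by rewrite !fpsME rmorph_sum; apply: eq_bigr => i _; rewrite rmorphM.
Qed.
HB.instance Definition _ := GRing.isZmodMorphism.Build (fps A) (fps B) fps_map fps_map_zmod.
HB.instance Definition _ := GRing.isMonoidMorphism.Build (fps A) (fps B) fps_map fps_map_monoid.
End FpsMap.

Section TwoVariables.
Variable A : nzRingType.

(** In A[[1/u]][[1/v]] the outer index is the power of 1/v and the inner one
    that of 1/u. *)
Definition fps2 := fps (fps A).
HB.instance Definition _ := GRing.NzRing.on fps2.

(** These are f(u) and f(v). *)
Definition lu (f : fps A) : fps2 := fpsC f.
Definition lv (f : fps A) : fps2 := fps_map (@fpsC A) f.
HB.instance Definition _ := GRing.RMorphism.copy lu (@fpsC (fps A)).
HB.instance Definition _ := GRing.RMorphism.copy lv (fps_map (@fpsC A)).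

(** With x = 1/u and y = 1/v these are y - x and x y, so u - v = zz / dd.  They
    are locked to keep the calculations below from unfolding them. *)
Definition zz : fps2 := locked (@fpsX (fps A) - fpsC (@fpsX A)).
Definition dd : fps2 := locked (@fpsX (fps A) * fpsC (@fpsX A)).

Lemma zz_central : central zz.
Proof.
move=> f; rewrite /zz -lock mulrBl mulrBr fpsX_central.
by rewrite (fpsC_central (@fpsX_central A)).
Qed.

Lemma dd_central : central dd.
Proof.
move=> f; rewrite /dd -lock -mulrA (fpsC_central (@fpsX_central A)).
by rewrite mulrA fpsX_central -mulrA.
Qed.

Lemma zzE (W : fps2) s r : (zz * W) s r =
  (if s is s'.+1 then W s' r else 0) - (if r is r'.+1 then W s r' else 0).
Proof.
by rewrite /zz -lock mulrBl fpsBE fpsBE fpsXM fpsCM_l fpsXM; case: s.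
Qed.

Lemma ddE (W : fps2) s r : (dd * W) s r =
  (if s is s'.+1 then if r is r'.+1 then W s' r' else 0 else 0).
Proof.
by rewrite /dd -lock -mulrA fpsXM; case: s => // s; rewrite fpsCM_l fpsXM.
Qed.

Lemma lumul_lv f g s r : (lu f * lv g) s r = f r * g s.
Proof. by rewrite /lu /lv fpsCM_l fpsCM_r. Qed.
Lemma lvmul_lu f g s r : (lv g * lu f) s r = g s * f r.
Proof. by rewrite /lu /lv fpsCM_r fpsCM_l. Qed.
Lemma luE f s r : (lu f) s r = f r *+ (s == 0).
Proof. by case: s. Qed.
Lemma lvE f s r : (lv f) s r = f s *+ (r == 0).
Proof. by case: r. Qed.

Definition swap (W : fps2) : fps2 := fun s r => W r s.

Fact swap_zmod : zmod_morphism swap.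
Proof. by move=> f g; apply/fpsP => s; apply/fpsP => r. Qed.
Fact swap_monoid : monoid_morphism swap.
Proof.
split=> [|f g]; apply/fpsP => s; apply/fpsP => r.
  by case: s; case: r.
rewrite /swap !fpsME !fps_sumE.
under eq_bigr => i _ do rewrite fpsME.
rewrite exchange_big /=; apply: eq_bigr => i _.
by rewrite fpsME.
Qed.
HB.instance Definition _ := GRing.isZmodMorphism.Build fps2 fps2 swap swap_zmod.
HB.instance Definition _ := GRing.isMonoidMorphism.Build fps2 fps2 swap swap_monoid.

Lemma swap_lu f : swap (lu f) = lv f.
Proof. by apply/fpsP => s; apply/fpsP => r; rewrite /swap luE lvE. Qed.
Lemma swap_lv f : swap (lv f) = lu f.
Proof. by apply/fpsP => s; apply/fpsP => r; rewrite /swap luE lvE. Qed.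
Lemma swap_zz : swap zz = - zz.
Proof. by apply/fpsP => -[|[|s]]; apply/fpsP => -[|[|r]]; rewrite /swap /zz -lock !fpsNE !fpsBE ?opprB //=. Qed.
Lemma swap_dd : swap dd = dd.
Proof.
apply/fpsP => s; apply/fpsP => r; rewrite /swap -[dd]mulr1 !ddE.
by case: s => [|[|s]]; case: r => [|[|r]].
Qed.

Let X : fps A := fpsX A.
Let X_reg (f : fps A) : X * f = 0 -> f = 0.
Proof. by move/fpsP=> Xf; apply/fpsP => r; have := Xf r.+1; rewrite fpsXM. Qed.

Let NX_reg (f : fps A) : - X * f = 0 -> f = 0.
Proof. by move=> Xf; apply: X_reg; apply: oppr_inj; rewrite oppr0 -mulNr. Qed.

Lemma zz_reg (W : fps2) : zz * W = 0 -> W = 0.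
Proof.
apply: fps_reg0 => f; rewrite /zz -lock fpsBE /= sub0r; exact: NX_reg.
Qed.

Let zzd_const (e : bool) : (zz + (-1) ^+ e * dd) 0 = - X.
Proof.
have d0 : dd 0 = 0 by apply/fpsP => r; rewrite -[dd]mulr1 ddE.
have z0 : zz 0 = - X by rewrite /zz -lock fpsBE /= sub0r.
by case: e; rewrite /= ?expr1 ?expr0 ?mulN1r ?mul1r fpsDE ?fpsNE d0 z0 ?oppr0 addr0.
Qed.

Lemma zzd_reg (e : bool) (W : fps2) : (zz + (-1) ^+ e * dd) * W = 0 -> W = 0.
Proof. by apply: fps_reg0 => f; rewrite zzd_const; exact: NX_reg. Qed.

(** Relations between coefficients come from relations
    (u - v) [f(u), g(v)] = W between series in this way.  For the converse,
    [comm_of_coef], the boundary terms have to vanish. *)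
Lemma coef_comm (f g : fps A) (W : fps2) :
  zz * [lie lu f, lv g] = dd * W ->
  forall r s, [lie f r.+1, g s] - [lie f r, g s.+1] = W s r.
Proof.
move=> /fpsP zW r s; have /fpsP/(_ r.+1) := zW s.+1; rewrite zzE ddE => <-.
by rewrite !fpsBE !lumul_lv !lvmul_lu.
Qed.

Lemma comm_of_coef (f g : fps A) (W : fps2) :
  (forall s, [lie f 0, g s] = 0) -> (forall r, [lie f r, g 0] = 0) ->
  (forall r s, [lie f r.+1, g s] - [lie f r, g s.+1] = W s r) ->
  zz * [lie lu f, lv g] = dd * W.
Proof.
move=> f0 g0 fg; apply/fpsP => s; apply/fpsP => r; rewrite zzE ddE.
case: s => [|s]; case: r => [|r]; rewrite ?fpsBE ?lumul_lv ?lvmul_lu ?f0 ?g0 ?subrr ?subr0 //.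
Qed.

Lemma comm2_coef (f g : fps A) :
  lu f * lv g = lv g * lu f <-> (forall r s, f r * g s = g s * f r).
Proof.
split=> [/fpsP fg r s|fg].
  by have /fpsP/(_ r) := fg s; rewrite lumul_lv lvmul_lu.
by apply/fpsP => s; apply/fpsP => r; rewrite lumul_lv lvmul_lu.
Qed.

(** As zz +/- dd = dd (u - v +/- 1) vanishes for v = u +/- 1, this substitution
    turns the hypothesis into n = 0.  Substituting is not defined for arbitrary
    Q; instead, the coefficients Q_k of y^k satisfy x Q_(k+1) = (1 +/- x) Q_k
    for k >= 2, so that Q_3, a unit multiple of n, is divisible by every power
    of x. *)
Lemma shift_lemma (e : bool) (Q : fps2) (n : fps A) :
  (zz + (-1) ^+ e * dd) * Q = dd * dd * lu n -> n = 0.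
Proof.
pose al : fps A := 1 + (-1) ^+ e * X.
have alE f r : (al * f) r = f r + (-1) ^+ e * (if r is s.+1 then f s else 0).
  rewrite /al mulrDl mul1r -mulrA fpsDE; congr (_ + _).
  by case: (e); rewrite /= ?expr1 ?expr0 ?mulN1r ?mul1r ?fpsNE fpsXM.
have QE s : ((zz + (-1) ^+ e * dd) * Q) s =
    al * (if s is s'.+1 then Q s' else 0) - X * Q s.
  apply/fpsP => r; rewrite mulrDl -mulrA !fpsDE zzE fpsNE fpsXM alE.
  by case: (e); rewrite /= ?expr1 ?expr0 ?mulN1r ?mul1r ?fpsNE ddE;
    case: s => [|s]; case: r => [|r];
    rewrite ?fps0E ?oppr0 ?subr0 ?addr0 ?add0r // addrAC.
move=> /fpsP Qn.
have nE s : (dd * dd * lu n) s = (if s == 2 then X * X * n else 0).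
  apply/fpsP => r; rewrite -mulrA !ddE; case: s => [|[|[|s]]]; case: r => [|[|r]] //=;
    rewrite ?ddE ?luE ?mulr1n ?mulr0n //= -?mulrA ?fpsXM //.
have rec s : al * (if s is s'.+1 then Q s' else 0) - X * Q s
             = if s == 2 then X * X * n else 0 by rewrite -QE Qn nE.
have Q0 : Q 0 = 0.
  by apply: NX_reg; have := rec 0; rewrite mulr0 sub0r mulNr.
have Q1 : Q 1 = 0.
  by apply: NX_reg; have := rec 1; rewrite /= Q0 mulr0 sub0r mulNr.
have Q2 : Q 2 = - (X * n).
  apply/eqP; rewrite -addr_eq0; apply/eqP/X_reg.
  have := rec 2; rewrite /= Q1 mulr0 sub0r mulrDr mulrA => <-.
  by rewrite addrN.
have Qk k : X * Q k.+3 = al * Q k.+2.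
  by have /eqP := rec k.+3; rewrite /= subr_eq0 => /eqP.
have Q3 : Q 3 = - (al * n).
  apply/eqP; rewrite -addr_eq0; apply/eqP/X_reg.
  have XC : X * al = al * X by exact: fpsX_central.
  by rewrite mulrDr Qk Q2 mulrN (mulrA X) XC -mulrA addNr.
have low r : forall j, Q j.+3 r = 0.
  elim: r => [|r IHr] j; have /fpsP := Qk j.+1.
    by move/(_ 0); rewrite fpsXM alE mulr0 addr0.
  by move/(_ r.+1); rewrite fpsXM alE !IHr mulr0 addr0.
have aln : al * n = 0.
  by apply: oppr_inj; rewrite oppr0 -Q3; apply/fpsP => r; exact: low.
by apply: fps_reg0 aln => a; have := alE 1 0; rewrite mulr1 mulr0 addr0 => ->; rewrite mul1r.
Qed.

End TwoVariables.

(** * The RTT relation for a matrix in block form *)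

(** In this section the primed letters are the series in v and the others those
    in u.  The matrix is written as T_00 = a, T_0j = a e_j, T_i0 = f_i a,
    T_ij = t_ij + f_i a e_j, where t is the Schur complement.  Each lemma solves
    one of its RTT relations for a commutator of the new variables.  The
    cancellations need c, or c - d, to be regular. *)
Section BlockAlgebra.
Variables (R : nzRingType) (c d : R).
Hypotheses (cC : central c) (dC : central d).
Hypothesis c_reg : forall x, c * x = 0 -> x = 0.

Let c_inj x y : c * x = c * y -> x = y.
Proof. by move/eqP; rewrite -subr_eq0 -mulrBr => /eqP/c_reg/eqP; rewrite subr_eq0 => /eqP. Qed.

Let lcancel (a ai x y : R) : ai * a = 1 -> a * x = a * y -> x = y.
Proof. by move=> aiK /(congr1 ( *%R ai)); rewrite !mulrA aiK !mul1r. Qed.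
Let rcancel (a ai x y : R) : a * ai = 1 -> x * a = y * a -> x = y.
Proof. by move=> aiK /(congr1 ( *%R^~ ai)); rewrite -!mulrA aiK !mulr1. Qed.

Lemma block_DD a a' : (forall x, (c - d) * x = 0 -> x = 0) ->
  c * [lie a, a'] = d * (a * a' - a' * a) -> a * a' = a' * a.
Proof.
move=> reg H; apply/eqP; rewrite -subr_eq0; apply/eqP/reg.
apply: (lc_eq (lc_rel 1 1 H)); ncring.
Qed.

Lemma block_DE a a' ai' e e' : ai' * a' = 1 -> a * a' = a' * a ->
  c * [lie a, a' * e'] = d * (a * (a' * e') - a' * (a * e)) ->
  c * [lie a, e'] = d * (a * (e' - e)).
Proof.
move=> aiK H1 H; apply: (lcancel aiK).
apply: (lc_eq ((lc_rel 1 1 H)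
  +! (lc_rel (d - c) e' H1))); ncring.
Qed.

Lemma block_DF a a' ai' f f' : a' * ai' = 1 -> a * a' = a' * a ->
  c * [lie a, f' * a'] = d * (f * a * a' - f' * a' * a) ->
  c * [lie a, f'] = d * ((f - f') * a).
Proof.
move=> aiK H1 H; apply: (rcancel aiK).
apply: (lc_eq ((lc_rel 1 1 H)
  +! (lc_rel ((d - c) * f') 1 H1))); ncring.
Qed.

Lemma block_DT a a' e e' f f' t' : a * a' = a' * a ->
  c * [lie a, e'] = d * (a * (e' - e)) ->
  c * [lie a, f'] = d * ((f - f') * a) ->
  c * [lie a, t' + f' * a' * e'] = d * (f * a * (a' * e') - f' * a' * (a * e)) ->
  a * t' = t' * a.
Proof.
move=> H1 R2 R3 H; apply: c_inj.
apply: (lc_eq ((lc_rel 1 1 H)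
  +! (lc_rel (- 1) (a' * e') R3)
  +! (lc_rel (- (f' * a')) 1 R2)
  +! (lc_rel ((d - c) * f') e' H1))); ncring.
Qed.

Lemma block_EF a a' ai ai' e e' f f' t t' :
  ai * a = 1 -> a * ai = 1 -> ai' * a' = 1 -> a' * ai' = 1 -> a * a' = a' * a ->
  - c * [lie a', e] = d * (a' * (e - e')) ->
  c * [lie a, f'] = d * ((f - f') * a) ->
  - c * [lie a', f] = d * ((f' - f) * a') ->
  a' * t = t * a' -> a' * t' = t' * a' ->
  c * [lie a * e, f' * a'] = d * (a' * (t + f * a * e) - a * (t' + f' * a' * e')) ->
  c * [lie e, f'] = d * (ai * t - ai' * t').
Proof.
move=> K1 K2 K3 K4 H1 R2s R3 R3s R4 R4' H; apply: (lcancel K1); apply: (rcancel K4).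
(* Moving f past a in opposite variables gives the same result; this removes
   the terms that are quadratic in f and e. *)
have K : (a' * f - f * a') * a = (a * f' - f' * a) * a'.
  apply: c_inj; apply: (lc_eq ((lc_rel (- 1) a R3s)
  +! (lc_rel (- 1) a' R3)
  +! (lc_rel (- d * (f - f')) 1 H1))); ncring.
apply: (lc_eq ((lc_rel 1 1 H)
  +! (lc_rel (- (a * f')) 1 R2s)
  +! (lc_rel (- 1) (a' * e) R3)
  +! (lc_rel (- (c * f')) e H1)
  +! (lc_rel d e K)
  +! (lc_rel (- (d * f)) e H1)
  +! (lc_rel (- d) (t * a') K2)
  +! (lc_rel (d * a) t' K3)
  +! (lc_rel d 1 R4)
  +! (lc_rel (- (d * a * ai')) 1 R4'))).
ncring.
Qed.

Lemma block_TE a a' ai ai' e e' g g' f f' t q q' :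
  ai * a = 1 -> ai' * a' = 1 -> a' * ai' = 1 ->
  a' * t = t * a' -> a * q = q * a -> a' * q = q * a' ->
  - c * [lie a', f] = d * ((f' - f) * a') ->
  - c * [lie g', f] = d * (ai' * q' - ai * q) ->
  c * [lie a * e, a' * g'] = d * (a' * g' * (a * e) - a * g * (a' * e')) ->
  c * [lie t + f * a * e, a' * g'] =
    d * ((q' + f' * a' * g') * (a * e) - (q + f * a * g) * (a' * e')) ->
  c * [lie t, g'] = d * (q * (e - e')).
Proof.
move=> K1 K3 K4 R4t R4q R4q' R3s R5s H0 H; apply: (lcancel K3).
apply: (lc_eq ((lc_rel 1 1 H)
  +! (lc_rel (- f) 1 H0)
  +! (lc_rel c g' R4t)
  +! (lc_rel (- 1) (g' * a * e) R3s)
  +! (lc_rel (- a') (a * e) R5s)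
  +! (lc_rel (- d) (q' * a * e) K4)
  +! (lc_rel (- (d * a' * ai)) e R4q)
  +! (lc_rel (d * a') (q * e) K1)
  +! (lc_rel d e' R4q'))).
ncring.
Qed.

(** Here p is the corner of the Schur complement and E its first row entry, so
    p E is the next entry of the Schur complement; e and g are entries of the
    first row of the original matrix. *)
Lemma block_EE_next p pi e e' E g g' : pi * p = 1 ->
  c * [lie p, e'] = d * (p * (e - e')) ->
  c * [lie p * E, e'] = d * (p * (g - g')) ->
  c * [lie E, e'] = d * ((g - g') - (e - e') * E).
Proof.
move=> K Ra Rb; apply: (lcancel K).
apply: (lc_eq ((lc_rel 1 1 Rb)
  +! (lc_rel (- 1) E Ra))); ncring.
Qed.

Lemma block_FE p pi e e' f : p * pi = 1 ->
  c * [lie p, e'] = d * (p * (e - e')) ->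
  c * [lie f * p, e'] = d * (f * p * (e - e')) -> f * e' = e' * f.
Proof.
move=> K Ra Rb; apply: c_inj; apply: (rcancel K).
apply: (lc_eq ((lc_rel 1 1 Rb)
  +! (lc_rel (- f) 1 Ra))); ncring.
Qed.

(** The entries t - t1 p^-1 s1 of the second Schur complement do not see the
    first two indices, and commute with the entry e that joins these. *)
Lemma block_schur p pi e e' g g' t1 s1 t : pi * p = 1 -> p * pi = 1 ->
  c * [lie p, e'] = d * (p * (e - e')) ->
  c * [lie t1, e'] = d * (t1 * (e - e')) ->
  c * [lie s1, e'] = d * (p * (g - g')) ->
  c * [lie t, e'] = d * (t1 * (g - g')) ->
  (t - t1 * pi * s1) * e' = e' * (t - t1 * pi * s1).
Proof.
move=> K1 K2 Rp Rt1 Rs1 Rt; apply: c_inj.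
have Rpi : c * [lie pi, e'] = - (d * (e - e') * pi).
  apply: (lcancel K1); apply: (rcancel K2).
  apply: (lc_eq (lc_rel (- 1) 1 Rp +! lc_rel c (e' * p) K2
    +! lc_rel (d * p * (e - e') - c * p * e') 1 K1)).
  ncring.
apply: (lc_eq (lc_rel 1 1 Rt +! lc_rel (- 1) (pi * s1) Rt1
  +! lc_rel (- t1) s1 Rpi +! lc_rel (- (t1 * pi)) 1 Rs1
  +! lc_rel (- (d * t1)) (g - g') K1)).
ncring.
Qed.

(** For the entries e, g of one row, elimination of a leaves error terms that
    contain [e(u), g(u)]. *)
Lemma block_EE a a' ai ai' e e' g g' :
  ai * a = 1 -> ai' * a' = 1 -> a * a' = a' * a ->
  c * [lie a, e'] = d * (a * (e' - e)) ->
  c * [lie a, g'] = d * (a * (g' - g)) ->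
  - c * [lie a', e] = d * (a' * (e - e')) ->
  c * [lie a * e, a' * g'] = d * (a * e * (a' * g') - a' * e' * (a * g)) ->
  (c - d) * (c * [lie e, g'] - d * (e - e') * (g - g') + d * [lie e, g])
  = - (d * d * [lie e, g]).
Proof.
move=> K1 K2 H1 Re Rg Rs H; apply: (lcancel K2); apply: (lcancel K1).
apply: (lc_eq ((lc_rel c 1 H)
  +! (lc_rel (- ((c - d) * a)) g' Rs)
  +! (lc_rel (- (c * a')) e Rg)
  +! (lc_rel (d * a') g Re)
  +! (lc_rel 1 (- c * (c * g' + d * (g - g')) * e + d * (c * e' + d * (e - e')) * g) H1))).
ncring.
Qed.

End BlockAlgebra.

(** * The RTT relation for the inverse matrix *)

Section Inverse.
Variables (R : nzRingType) (c d : R) (n : nat).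
Hypotheses (cC : central c) (dC : central d).
Variables T T' S S' : 'I_n -> 'I_n -> R.
Hypotheses (TS : forall i j, \sum_p T i p * S p j = (i == j)%:R)
  (ST : forall i j, \sum_p S i p * T p j = (i == j)%:R)
  (TS' : forall i j, \sum_p T' i p * S' p j = (i == j)%:R)
  (ST' : forall i j, \sum_p S' i p * T' p j = (i == j)%:R).
Hypothesis rttT : forall i j h k, c * [lie T i j, T' h k] =
  d * (T h j * T' i k - T' h j * T i k).

Let sumD (F : 'I_n -> R) (i : 'I_n) : \sum_p (i == p)%:R * F p = F i.
Proof.
rewrite (bigD1 i) //= eqxx mul1r big1 ?addr0 // => p /negPf ne_pi.
by rewrite eq_sym ne_pi mul0r.
Qed.
Let sumDr (F : 'I_n -> R) (i : 'I_n) : \sum_p F p * (p == i)%:R = F i.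
Proof.
rewrite (bigD1 i) //= eqxx mulr1 big1 ?addr0 // => p /negPf ne_pi.
by rewrite ne_pi mulr0.
Qed.

(* The derivation [x, _] maps an inverse matrix X' to - X' [x, X] X'. *)
Let commS (X X' : 'I_n -> 'I_n -> R) (x : R) h k :
    (forall i j, \sum_p X i p * X' p j = (i == j)%:R) ->
    (forall i j, \sum_p X' i p * X p j = (i == j)%:R) ->
  [lie x, X' h k] = - \sum_p \sum_q X' h p * [lie x, X p q] * X' q k.
Proof.
move=> XX' X'X.
have E1 : \sum_p \sum_q X' h p * (x * X p q) * X' q k = X' h k * x.
  transitivity (\sum_p X' h p * x * (p == k)%:R).
    apply: eq_bigr => p _; rewrite -XX' mulr_sumr; apply: eq_bigr => q _.
    by rewrite !mulrA.
  by rewrite (sumDr (fun p => X' h p * x)).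
have E2 : \sum_p \sum_q X' h p * (X p q * x) * X' q k = x * X' h k.
  rewrite exchange_big /=; transitivity (\sum_q (h == q)%:R * (x * X' q k)).
    apply: eq_bigr => q _; rewrite -X'X mulr_suml; apply: eq_bigr => p _.
    by rewrite !mulrA.
  by rewrite sumD.
rewrite -E1 -E2 -sumrB -sumrN; apply: eq_bigr => p _.
rewrite -sumrB -sumrN; apply: eq_bigr => q _.
by rewrite mulrBr mulrBl opprB.
Qed.

Let centralM (z a x b : R) : central z -> z * (a * x * b) = a * (z * x) * b.
Proof. by move=> zC; rewrite !mulrA zC. Qed.

Lemma rtt_TS i j h k : c * [lie T i j, S' h k] =
  d * ((h == j)%:R * (\sum_q T i q * S' q k) - (\sum_p S' h p * T p j) * (i == k)%:R).
Proof.
pose W p q := T p j * T' i q - T' p j * T i q.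
transitivity (- (d * \sum_p \sum_q S' h p * W p q * S' q k)).
  rewrite (commS _ _ _ TS' ST') mulrN; congr (- _); rewrite !mulr_sumr.
  apply: eq_bigr => p _; rewrite !mulr_sumr; apply: eq_bigr => q _.
  by rewrite !centralM // rttT.
have -> : \sum_p \sum_q S' h p * W p q * S' q k =
   \sum_p \sum_q (S' h p * T p j) * (T' i q * S' q k)
   - \sum_q \sum_p (S' h p * T' p j) * (T i q * S' q k).
  rewrite [X in _ - X]exchange_big -sumrB; apply: eq_bigr => p _.
  rewrite -sumrB; apply: eq_bigr => q _.
  by rewrite /W mulrBr mulrBl !mulrA.
rewrite -mulrN opprB; congr (_ * (_ - _)).
  rewrite mulr_sumr; apply: eq_bigr => q _.
  by rewrite -mulr_suml ST'.
rewrite mulr_suml; apply: eq_bigr => p _.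
by rewrite -mulr_sumr TS'.
Qed.

(** The rule for the bracket with an inverse matrix is applied to both T and T'.
    The products on the right-hand side of the relation change places, and the
    sign that results is absorbed by c. *)
Lemma rtt_SS i j h k : - c * [lie S i j, S' h k] =
  d * (S' i k * S h j - S i k * S' h j).
Proof.
rewrite mulNr -mulrN opprB.
have -> : [lie S' h k, S i j] = \sum_p \sum_q S i p * [lie T p q, S' h k] * S q j.
  rewrite (commS _ _ _ TS ST).
  rewrite -sumrN; apply: eq_bigr => p _; rewrite -sumrN; apply: eq_bigr => q _.
  by rewrite -mulNr -mulrN opprB.
pose P p := \sum_m T p m * S' m k; pose Q q := \sum_m S' h m * T m q.
transitivity (d * \sum_p \sum_q
    S i p * ((h == q)%:R * P p - Q q * (p == k)%:R) * S q j).
  rewrite !mulr_sumr; apply: eq_bigr => p _.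
  rewrite !mulr_sumr; apply: eq_bigr => q _.
  by rewrite !centralM // rtt_TS.
congr (_ * _).
have -> : S' i k = \sum_p S i p * P p.
  transitivity (\sum_m (i == m)%:R * S' m k); first by rewrite sumD.
  under eq_bigr => m _ do rewrite -ST mulr_suml.
  rewrite exchange_big; apply: eq_bigr => p _; rewrite mulr_sumr.
  by apply: eq_bigr => m _; rewrite mulrA.
have -> : S' h j = \sum_q Q q * S q j.
  transitivity (\sum_m S' h m * (m == j)%:R); first by rewrite sumDr.
  under eq_bigr => m _ do rewrite -TS mulr_sumr.
  rewrite exchange_big; apply: eq_bigr => p _; rewrite mulr_suml.
  by apply: eq_bigr => m _; rewrite mulrA.
rewrite mulr_suml mulr_sumr.
rewrite -(sumDr (fun p => \sum_q S i p * (Q q * S q j)) k).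
under [X in _ - X]eq_bigr => p _ do rewrite mulr_suml.
rewrite -sumrB; apply: eq_bigr => p _.
rewrite -(sumD (fun q => S i p * P p * S q j) h) -sumrB; apply: eq_bigr => q _.
rewrite mulrBr mulrBl; congr (_ - _); last first.
  by case: eqP => _; rewrite !(mulr1, mulr0, mul0r) ?mulrA.
by case: eqP => _; rewrite !(mul1r, mulr0, mul0r).
Qed.

End Inverse.

(** * RTT matrices and their Schur complements *)

Notation o0 n := (lshift n (ord0 : 'I_1)).
Notation rs := (rshift 1).

Ltac swap_in H :=
  let H' := fresh "H" in
  have H' := congr1 (@swap _) H;
  rewrite !(rmorphB, rmorphD, rmorphM, rmorphN) /= ?(swap_lu, swap_lv, swap_zz, swap_dd) in H'; move: H' => {H}.

Section RTT.
Variable A : nzRingType.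
Implicit Types (c : fps2 A) (n : nat).
Local Notation z := (zz A).
Local Notation d := (dd A).

(** The scalar c is z, or -z for the inverse matrix. *)
Definition rtt c n (T : 'M[fps A]_n) := forall i j h k,
  c * [lie lu (T i j), lv (T h k)] =
  d * (lu (T h j) * lv (T i k) - lv (T h j) * lu (T i k)).

Definition unital n (T : 'M[fps A]_n) := forall i j, T i j 0 = (i == j)%:R.

(** Exchanging both u, v and the two entries gives the other usual form of the
    relation. *)
Lemma rtt_primary c n (T : 'M[fps A]_n) : swap c = - c -> rtt c T ->
  forall i j h k, c * [lie lu (T i j), lv (T h k)] =
    d * (lv (T i k) * lu (T h j) - lu (T i k) * lv (T h j)).
Proof.
move=> cs rT i j h k; have := congr1 (@swap A) (rT h k i j).
rewrite !(rmorphB, rmorphM) /= !(swap_lu, swap_lv, swap_dd) cs => <-.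
by rewrite mulNr -mulrN opprB.
Qed.

Lemma primary_rtt c n (T : 'M[fps A]_n) : swap c = - c ->
  (forall i j h k, c * [lie lu (T i j), lv (T h k)] =
    d * (lv (T i k) * lu (T h j) - lu (T i k) * lv (T h j))) -> rtt c T.
Proof.
move=> cs rT i j h k; have := congr1 (@swap A) (rT h k i j).
rewrite !(rmorphB, rmorphM) /= !(swap_lu, swap_lv, swap_dd) cs => <-.
by rewrite mulNr -mulrN opprB.
Qed.

Lemma rtt_inv c n (T S : 'M[fps A]_n) : central c -> swap c = - c ->
  T *m S = 1%:M -> S *m T = 1%:M -> rtt c T -> rtt (- c) S.
Proof.
move=> cC cs TS ST rT.
have mulE (phi : {rmorphism fps A -> fps2 A}) (X Y : 'M_n) : X *m Y = 1%:M ->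
    forall i j, \sum_p phi (X i p) * phi (Y p j) = (i == j)%:R.
  move=> XY i j; have /matrixP/(_ i j) := XY; rewrite !mxE => /(congr1 phi).
  by rewrite rmorph_sum rmorph_nat => <-; apply: eq_bigr => p _; rewrite rmorphM.
apply: primary_rtt => [|i j h k]; first by rewrite rmorphN /= cs.
by apply: (rtt_SS cC (@dd_central A) (mulE _ _ _ TS) (mulE _ _ _ ST)
  (mulE (@lv A) _ _ TS) (mulE (@lv A) _ _ ST)).
Qed.

Lemma rtt_sub c m n (f : 'I_m -> 'I_n) (T : 'M[fps A]_n) :
  rtt c T -> rtt c (mxsub f f T).
Proof. by move=> rT i j h k; rewrite !mxE. Qed.

Lemma schur_entry n (T : 'M[fps A]_(1 + n)) i j : Defs.schur T i j =
  T (rs i) (rs j) - T (rs i) (o0 n) * (T (o0 n) (o0 n))^-1 * T (o0 n) (rs j).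
Proof.
rewrite /Defs.schur /Defs.gauss_pivotV /Defs.gauss_pivot !mxE big_ord1 !mxE big_ord1 !mxE.
by rewrite eqxx mulr1n.
Qed.

Lemma unital_schur n (T : 'M[fps A]_(1 + n)) : unital T -> unital (Defs.schur T).
Proof. exact: schur0. Qed.

(** Block inversion.  It makes the inverse of the Schur complement a submatrix of
    the inverse of T. *)
Lemma inverse_step n (T : 'M[fps A]_(1 + n)) (S : 'M[fps A]_n) : unital T ->
  Defs.schur T *m S = 1%:M -> S *m Defs.schur T = 1%:M ->
  exists U : 'M[fps A]_(1 + n), [/\ T *m U = 1%:M, U *m T = 1%:M & drsubmx U = S].
Proof.
move=> T0 TS ST; pose a := Defs.gauss_pivot T; pose ai := Defs.gauss_pivotV T.
have a_unit : a 0 0 \is a GRing.unit by apply: fps_unit1; rewrite !mxE T0 eqxx.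
have aiK : ai *m a = 1%:M by rewrite [a]mx11_scalar -scalar_mxM mulVr.
have aKi : a *m ai = 1%:M by rewrite [a in LHS]mx11_scalar -scalar_mxM divrr.
pose e := ai *m ursubmx T; pose f := dlsubmx T *m ai.
have bE : ursubmx T = a *m e by rewrite /e mulmxA aKi mul1mx.
have cE : dlsubmx T = f *m a by rewrite /f -mulmxA aiK mulmx1.
have drE : drsubmx T = Defs.schur T + f *m a *m e.
  by rewrite -cE /e mulmxA /Defs.schur subrK.
have TE : T = block_mx a (a *m e) (f *m a) (Defs.schur T + f *m a *m e).
  by rewrite -[LHS]submxK bE cE drE.
move: (Defs.schur T) TS ST TE {bE cE drE}; clearbody a ai e f => s sS Ss ->.
exists (block_mx (ai + e *m S *m f) (- (e *m S)) (- (S *m f)) S); split.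
- rewrite mulmx_block scalar_mx_block; congr block_mx.
  + by rewrite mulmxDr aKi mulmxN !mulmxA addrK.
  + by rewrite mulmxN !mulmxA addNr.
  + rewrite mulmxDr mulmxN -(mulmxA f) aKi mulmx1 mulmxDl !mulmxA sS mul1mx.
    by rewrite opprD addrACA addrN add0r addrN.
  + by rewrite mulmxN mulmxDl sS !mulmxA addrC addrK.
- rewrite mulmx_block scalar_mx_block; congr block_mx.
  + by rewrite mulmxDl aiK mulNmx -!mulmxA addrK.
  + rewrite mulmxDl mulNmx (mulmxA ai) aiK mul1mx mulmxDr -!mulmxA Ss mulmx1.
    by rewrite opprD addrACA addrN add0r addrN.
  + by rewrite mulNmx -!mulmxA addNr.
  + by rewrite mulNmx mulmxDr Ss -!mulmxA addrC addrK.
- by rewrite block_mxKdr.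
Qed.

Lemma inverse_exists n (T : 'M[fps A]_n) : unital T ->
  exists S : 'M[fps A]_n, T *m S = 1%:M /\ S *m T = 1%:M.
Proof.
elim: n T => [|n IHn] T T0; first by exists 0; split; apply/matrixP => -[].
have [S [TS ST]] := IHn _ (unital_schur T0).
by have [U []] := @inverse_step n T S T0 TS ST; exists U.
Qed.

(** The Schur complement is obtained by inverting, passing to a submatrix, and
    inverting again. *)
Lemma rtt_schur n (T : 'M[fps A]_(1 + n)) :
  unital T -> rtt z T -> rtt z (Defs.schur T).
Proof.
move=> T0 rT; have [S [TS ST]] := inverse_exists (unital_schur T0).
have [U [TU UT US]] := inverse_step T0 TS ST.
have zC := @zz_central A.
have NzC : central (- z) by move=> x; rewrite mulNr mulrN zC.
have zs : swap z = - z by exact: swap_zz.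
have rS : rtt (- z) S.
  have := rtt_sub (@rshift 1 n) (rtt_inv zC zs TU UT rT).
  congr rtt; rewrite -US; apply/matrixP => i j; rewrite !mxE //.
by rewrite -[z]opprK; apply: rtt_inv ST TS rS; rewrite // rmorphN /= zs.
Qed.

End RTT.

(** * The relations between the entries of one row *)

Section RowRelation.
Variable A : nzRingType.
Local Notation z := (zz A).
Local Notation d := (dd A).

(** Both y - x and x - y satisfy these; the second is needed for the inverse of
    an RTT matrix. *)
Record spectral (c : fps2 A) : Prop := Spectral {
  spectral_central : central c;
  spectral_swap : swap c = - c;
  spectral_reg : forall W, c * W = 0 -> W = 0;
  spectral_regB : forall W, (c - d) * W = 0 -> W = 0;
  spectral_shift : forall W n, (c - d) * W = d * d * lu n -> n = 0 }.

Lemma spectral_zz : spectral z.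
Proof.
split=> [||||W n]; [exact: zz_central|exact: swap_zz|exact: zz_reg| |].
  by move=> W; have := @zzd_reg A true W; rewrite expr1 mulN1r.
by have := @shift_lemma A true W n; rewrite expr1 mulN1r.
Qed.

Lemma spectral_Nzz : spectral (- z).
Proof.
split=> [||W|W|W n].
- by move=> x; rewrite mulNr mulrN zz_central.
- by rewrite rmorphN /= swap_zz.
- by rewrite mulNr => /eqP; rewrite oppr_eq0 => /eqP/zz_reg.
- have := @zzd_reg A false W; rewrite expr0 mul1r => reg.
  by rewrite -opprD mulNr => /eqP; rewrite oppr_eq0 => /eqP/reg.
- have := @shift_lemma A false (- W) n; rewrite expr0 mul1r => sh.
  by rewrite -opprD mulNr -mulrN => /sh.
Qed.

Lemma lu_unit (a : fps A) : a \is a GRing.unit ->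
  lu a^-1 * lu a = 1 /\ lu a * lu a^-1 = 1.
Proof. by move=> aU; rewrite -!rmorphM mulVr // divrr // rmorph1. Qed.
Lemma lv_unit (a : fps A) : a \is a GRing.unit ->
  lv a^-1 * lv a = 1 /\ lv a * lv a^-1 = 1.
Proof. by move=> aU; rewrite -!rmorphM mulVr // divrr // rmorph1. Qed.

Section Row.
Variables (c : fps2 A) (a e g : fps A).
Hypothesis cS : spectral c.
Hypothesis a_unit : a \is a GRing.unit.
Hypothesis aa : c * [lie lu a, lv a] = d * (lu a * lv a - lv a * lu a).
Hypothesis ae : c * [lie lu a, lv (a * e)] = d * (lu a * lv (a * e) - lv a * lu (a * e)).
Hypothesis ag : c * [lie lu a, lv (a * g)] = d * (lu a * lv (a * g) - lv a * lu (a * g)).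
Hypothesis eg : c * [lie lu (a * e), lv (a * g)] =
  d * (lu (a * e) * lv (a * g) - lv (a * e) * lu (a * g)).

Let cC : central c. Proof. by case: cS. Qed.
Let c_reg : forall x, c * x = 0 -> x = 0. Proof. by case: cS. Qed.
Let cs : swap c = - c. Proof. by case: cS. Qed.
Let dC : central d. Proof. exact: dd_central. Qed.
Let ui := (lu_unit a_unit).
Let vi := (lv_unit a_unit).

Lemma row_DD : lu a * lv a = lv a * lu a.
Proof. by apply: (block_DD cC dC) aa; case: cS. Qed.

Lemma row_DE : c * [lie lu a, lv e] = d * (lu a * (lv e - lu e)).
Proof.
apply: (block_DE cC dC vi.1 row_DD); move: ae; rewrite !rmorphM => -> //.
Qed.

Lemma row_DE' : c * [lie lu a, lv g] = d * (lu a * (lv g - lu g)).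
Proof.
apply: (block_DE cC dC vi.1 row_DD); move: ag; rewrite !rmorphM => -> //.
Qed.

(** Let Z be the difference of the two sides.  Eliminating a from the RTT
    relations gives (c - d) (Z + d N) = - d^2 N with N = [e(u), g(u)].  Therefore
    N = 0 by [spectral_shift], and then Z = 0 because c - d is regular. *)
Lemma row_EE : c * [lie lu e, lv g] = d * ((lu e - lv e) * (lu g - lv g)).
Proof.
have DE_s : - c * [lie lv a, lu e] = d * (lv a * (lu e - lv e)).
  have := congr1 (@swap A) row_DE; rewrite !(rmorphB, rmorphM) /=.
  by rewrite !(swap_lu, swap_lv) swap_dd cs.
have H := block_EE cC dC ui.1 vi.1 row_DD row_DE row_DE' DE_s.
move: eg; rewrite !rmorphM => /H {H}.
set Z := c * _ - _ => EZ.
have N0 : - [lie e, g] = 0.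
  apply: (spectral_shift cS).
  by rewrite rmorphN rmorphB !rmorphM mulrN; exact: EZ.
have lN0 : [lie lu e, lu g] = 0 by rewrite -!rmorphM -rmorphB -[[lie e, g]]opprK N0 oppr0 rmorph0.
have : Z = 0.
  apply: (spectral_regB cS); move: EZ; rewrite lN0 !mulr0 addr0 oppr0; exact.
by rewrite /Z => /eqP; rewrite subr_eq0 -mulrA => /eqP.
Qed.

(** The right-hand side of [row_EE] is symmetric in u and v while c is
    antisymmetric, so [e(u), g(v)] is antisymmetric. *)
Lemma row_Serre r s : [lie e r, g s] + [lie e s, g r] = 0.
Proof.
have EE_s := congr1 (@swap A) row_EE.
rewrite !(rmorphB, rmorphM) /= !(swap_lu, swap_lv) swap_dd cs in EE_s.
have E0 : [lie lu e, lv g] + [lie lv e, lu g] = 0.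
  apply: c_reg; rewrite mulrDr row_EE.
  have -> : c * [lie lv e, lu g] = - (d * ((lv e - lu e) * (lv g - lu g))).
    by rewrite -EE_s mulNr opprK.
  by rewrite -!(opprB (lu _) (lv _)) mulrNN addrN.
have /fpsP/(_ s)/fpsP/(_ r) := E0.
by rewrite !fpsDE !fpsNE !lumul_lv !lvmul_lu.
Qed.

End Row.
End RowRelation.

(** * Gauss coordinates *)

Lemma ord_rs_ind n (P : 'I_(1 + n) -> Prop) :
  P (o0 n) -> (forall k, P (rs k)) -> forall i, P i.
Proof.
move=> P0 PS i; case: (split_ordP i) => k -> //.
by rewrite [k]ord1; move: P0; congr P; apply: val_inj.
Qed.

Section Coords.
Variable A : nzRingType.

Lemma rtt_coefP n (T : 'M[fps A]_n) : unital T ->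
  rtt (zz A) T <-> (forall i j h k r s,
    [lie T i j r.+1, T h k s] - [lie T i j r, T h k s.+1]
    = T h j r * T i k s - T h j s * T i k r).
Proof.
move=> T0; split=> rT i j h k.
  move=> r s; rewrite (coef_comm (rT i j h k)).
  by rewrite fpsBE fpsBE lumul_lv lvmul_lu.
apply: comm_of_coef => [s|r|r s].
- by rewrite T0 mulr_natl mulr_natr subrr.
- by rewrite T0 mulr_natl mulr_natr subrr.
- by rewrite rT fpsBE fpsBE lumul_lv lvmul_lu.
Qed.

(** In the factorization T = F D E, these are the diagonal entries of D and the
    entries of E and F next to the diagonal, read off from successive Schur
    complements.  They are indexed by nat, so that passing to the Schur
    complement is composition with S. *)
Fixpoint coords n : 'M[fps A]_n ->
    (nat -> fps A) -> (nat -> fps A) -> (nat -> fps A) -> Prop :=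
  match n with
  | 0 => fun _ _ _ _ => True
  | m.+1 => fun (T : 'M_(1 + m)) D E F =>
    [/\ T (o0 m) (o0 m) = D 0%N,
        forall k : 'I_m, k = 0%N :> nat ->
          T (o0 m) (rs k) = D 0%N * E 0%N /\ T (rs k) (o0 m) = F 0%N * D 0%N
      & coords (Defs.schur T) (D \o S) (E \o S) (F \o S)]
  end.

Lemma coordsS n (T : 'M[fps A]_(1 + n)) D E F : coords T D E F <->
  [/\ T (o0 n) (o0 n) = D 0%N,
        forall k : 'I_n, k = 0%N :> nat ->
          T (o0 n) (rs k) = D 0%N * E 0%N /\ T (rs k) (o0 n) = F 0%N * D 0%N
      & coords (Defs.schur T) (D \o S) (E \o S) (F \o S)].
Proof. by []. Qed.

Lemma coords_unital n (T : 'M[fps A]_n) D E F : unital T -> coords T D E F ->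
  [/\ forall i, (i < n)%N -> D i 0 = 1, forall i, (i.+1 < n)%N -> E i 0 = 0
    & forall i, (i.+1 < n)%N -> F i 0 = 0].
Proof.
elim: n T D E F => [|n IHn] T D E F T0; first by split.
move=> /coordsS[D0 EF0 /(IHn _ _ _ _ (unital_schur T0))[IHD IHE IHF]].
have D00 : D 0%N 0 = 1 by rewrite -D0 T0 eqxx.
split=> -[|i] lt_in; [exact: D00 | exact: IHD | | exact: IHE | | exact: IHF].
- have [/(congr1 (fun f : fps A => f 0)) + _] := EF0 (@Ordinal n 0 lt_in) erefl.
  by rewrite fpsM0E D00 mul1r T0.
- have [_ /(congr1 (fun f : fps A => f 0))] := EF0 (@Ordinal n 0 lt_in) erefl.
  by rewrite fpsM0E D00 mulr1 T0.
Qed.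

Lemma fps_comm (x : A) (f : fps A) :
  GRing.comm (fpsC x) f <-> forall r, x * f r = f r * x.
Proof.
by split=> [/fpsP xf r|xf]; last apply/fpsP => r; move: (xf r);
  rewrite ?fpsCM_l ?fpsCM_r.
Qed.

Lemma comm_schur n (T : 'M[fps A]_(1 + n)) (x : A) :
  (forall i j, GRing.comm (fpsC x) (T i j)) ->
  forall i j, GRing.comm (fpsC x) (Defs.schur T i j).
Proof.
by move=> xT i j; rewrite schur_entry; apply: commrB => //; do 2![apply: commrM => //]; apply: commrV.
Qed.

Lemma coords_comm n (T : 'M[fps A]_n) D E F (x : A) : unital T ->
  coords T D E F -> (forall i j, GRing.comm (fpsC x) (T i j)) ->
  [/\ forall i, (i < n)%N -> GRing.comm (fpsC x) (D i),
      forall i, (i.+1 < n)%N -> GRing.comm (fpsC x) (E i)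
    & forall i, (i.+1 < n)%N -> GRing.comm (fpsC x) (F i)].
Proof.
elim: n T D E F => [|n IHn] T D E F T0; first by split.
move=> /coordsS[D0 EF0 TT] xT.
have [IHD IHE IHF] := IHn _ _ _ _ (unital_schur T0) TT (comm_schur xT).
have D0U : D 0%N \is a GRing.unit by apply: fps_unit1; rewrite -D0 T0 eqxx.
split=> -[|i] lt_in; [by rewrite -D0|exact: IHD| |exact: IHE| |exact: IHF].
- have [TE _] := EF0 (@Ordinal n 0 lt_in) erefl.
  by rewrite -(mulKr D0U (E 0%N)) -TE -D0; apply: commrM => //; apply: commrV.
- have [_ TF] := EF0 (@Ordinal n 0 lt_in) erefl.
  by rewrite -(mulrK D0U (F 0%N)) -TF -D0; apply: commrM => //; apply: commrV.
Qed.

Lemma fps_commute (f g : fps A) :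
  (forall r s, f r * g s = g s * f r) -> f * g = g * f.
Proof.
move=> fg; apply/fpsP => r; rewrite !fpsME (reindex_inj rev_ord_inj) /=.
apply: eq_bigr => i _; rewrite /= subSS subKn ?fg //.
by have := ltn_ord i; lia.
Qed.

End Coords.

(** * The opposite algebra *)

Section Opposite.
Variable A : nzRingType.
Local Notation Ac := (A^c : nzRingType).

Lemma fps_opM (f g : fps A) : (f : fps Ac) * (g : fps Ac) = g * f.
Proof.
apply/fpsP => r; rewrite !fpsME (reindex_inj rev_ord_inj) /=.
apply: eq_bigr => i _; rewrite /= subSS subKn //.
by have := ltn_ord i; lia.
Qed.

Lemma fps_opV (f : fps A) : f 0 = 1 -> (f : fps Ac)^-1 = f^-1.
Proof.
move=> f0; have fU : f \is a GRing.unit by exact: fps_unit1.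
have fU' : (f : fps Ac) \is a GRing.unit by exact: fps_unit1.
apply: (mulrI fU'); rewrite divrr // fps_opM mulVr //.
Qed.

(** Transposition over the opposite algebra reverses products of matrices,
    preserves the RTT relation, and exchanges E and F.  Every statement on E
    thus has a counterpart on F. *)
Definition opmx n (T : 'M[fps A]_n) : 'M[fps Ac]_n := \matrix_(i, j) (T j i : fps Ac).

Lemma opmx_unital n (T : 'M[fps A]_n) : unital T -> unital (opmx T).
Proof. by move=> T0 i j; rewrite mxE T0 eq_sym. Qed.

Lemma opmx_rtt n (T : 'M[fps A]_n) : unital T -> rtt (zz A) T ->
  rtt (zz Ac) (opmx T).
Proof.
move=> T0 /(rtt_coefP T0) rT; apply/(rtt_coefP (opmx_unital T0)) => i j h k r s.
rewrite !mxE -[RHS]/(T k i s * T j h r - T k i r * T j h s) -[RHS]opprB -rT.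
rewrite [RHS]opprD opprK; congr (_ + _); first by rewrite opprB.
exact: opprB.
Qed.

Lemma opmx_schur n (T : 'M[fps A]_(1 + n)) : unital T ->
  Defs.schur (opmx T) = opmx (Defs.schur T).
Proof.
move=> T0; apply/matrixP => i j; rewrite schur_entry [RHS]mxE schur_entry !mxE.
congr (_ - _); rewrite fps_opV; last by rewrite T0 eqxx.
by rewrite !fps_opM mulrA.
Qed.

Lemma opmx_coords n (T : 'M[fps A]_n) D E F : unital T ->
  coords T D E F -> coords (opmx T) (D : nat -> fps Ac) F E.
Proof.
elim: n T D E F => [|n IHn] T D E F T0 //.
move=> /coordsS[D0 EF0 TT]; apply/coordsS; split; rewrite ?mxE //.
  move=> k k0; rewrite !mxE !fps_opM; have [-> ->] := EF0 k k0; by split.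
by rewrite opmx_schur //; apply: IHn => //; exact: unital_schur.
Qed.

End Opposite.

(** * The first two steps of the Gauss factorization *)

Section Step.
Variables (A : nzRingType) (n : nat) (T : 'M[fps A]_(1 + n)).
Hypotheses (T0 : unital T) (rT : rtt (zz A) T).
Local Notation z := (zz A).
Local Notation d := (dd A).
Local Notation o := (o0 n).
Local Notation t := (Defs.schur T).

(** These are a, e_j and f_i of the block form; e and f are locked because they
    occur in large ring identities. *)
Definition pivot := T o o.
Definition gaussE j := locked ((T o o)^-1 * T o (rs j)).
Definition gaussF i := locked (T (rs i) o * (T o o)^-1).
Local Notation a := pivot.
Local Notation e := gaussE.
Local Notation f := gaussF.

Let zC := @zz_central A.
Let dC := @dd_central A.
Let zreg := @zz_reg A.

Let a_unit : a \is a GRing.unit.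
Proof. by apply: fps_unit1; rewrite /pivot T0 eqxx. Qed.
Let ui := (lu_unit a_unit).
Let vi := (lv_unit a_unit).

Lemma rowTE j : T o (rs j) = a * e j. Proof. by rewrite /gaussE -lock mulVKr. Qed.
Lemma colTE i : T (rs i) o = f i * a. Proof. by rewrite /gaussF -lock divrK. Qed.
Lemma lowTE i j : T (rs i) (rs j) = t i j + f i * a * e j.
Proof. by rewrite schur_entry /gaussF /gaussE -!lock divrK // mulrA subrK. Qed.

Let rT' := rtt_primary (@swap_zz A) rT.

Lemma step_DD : lu a * lv a = lv a * lu a.
Proof. by apply: (row_DD (spectral_zz A)) (rT o o o o). Qed.

Lemma step_DE j : z * [lie lu a, lv (e j)] = d * (lu a * (lv (e j) - lu (e j))).
Proof.
by apply: (row_DE (spectral_zz A) a_unit (rT o o o o)); have := rT o o o (rs j); rewrite rowTE.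
Qed.

Lemma step_DF i : z * [lie lu a, lv (f i)] = d * ((lu (f i) - lv (f i)) * lu a).
Proof.
apply: (block_DF zC dC vi.2 step_DD).
by have := rT o o (rs i) o; rewrite colTE !rmorphM => ->.
Qed.

Lemma step_DE_swap j :
  - z * [lie lv a, lu (e j)] = d * (lv a * (lu (e j) - lv (e j))).
Proof. by have H := step_DE j; swap_in H. Qed.

Lemma step_DF_swap i :
  - z * [lie lv a, lu (f i)] = d * ((lv (f i) - lu (f i)) * lv a).
Proof. by have H := step_DF i; swap_in H. Qed.

Lemma step_DT i j : lu a * lv (t i j) = lv (t i j) * lu a.
Proof.
apply: (block_DT zC dC zreg step_DD (step_DE j) (step_DF i)).
have := rT o o (rs i) (rs j).
by rewrite lowTE colTE rowTE !(rmorphD, rmorphM).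
Qed.

Lemma step_DT_swap i j : lv a * lu (t i j) = lu (t i j) * lv a.
Proof. by have H := step_DT i j; swap_in H. Qed.

Lemma step_DT_comm i j : a * t i j = t i j * a.
Proof. by apply: fps_commute; apply/comm2_coef/step_DT. Qed.

Lemma step_DT_u i j : lu a * lu (t i j) = lu (t i j) * lu a.
Proof. by rewrite -!rmorphM step_DT_comm. Qed.

Lemma step_DT_v i j : lv a * lv (t i j) = lv (t i j) * lv a.
Proof. by rewrite -!rmorphM step_DT_comm. Qed.

Lemma step_EF j i : z * [lie lu (e j), lv (f i)] =
  d * (lu (a^-1 * t i j) - lv (a^-1 * t i j)).
Proof.
rewrite !rmorphM.
apply: (block_EF zC dC zreg ui.1 ui.2 vi.1 vi.2 step_DD (step_DE_swap j)
  (step_DF i) (step_DF_swap i) (step_DT_swap i j) (step_DT_v i j)).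
by have := rT' o (rs j) (rs i) o; rewrite rowTE colTE lowTE !(rmorphD, rmorphM).
Qed.

Lemma step_EF_swap k i : - z * [lie lv (e k), lu (f i)] =
  d * (lv (a^-1 * t i k) - lu (a^-1 * t i k)).
Proof. by have H := step_EF k i; swap_in H; rewrite !rmorphM. Qed.

Lemma step_TE i j k : z * [lie lu (t i j), lv (e k)] =
  d * (lu (t i k) * (lu (e j) - lv (e j))).
Proof.
have H := step_EF_swap k i; rewrite !rmorphM in H.
apply: (block_TE (g := lu (e k)) zC dC ui.1 vi.1 vi.2 (step_DT_swap i j) (step_DT_u i k)
   (step_DT_swap i k) (step_DF_swap i) H).
  by have := rT' o (rs j) o (rs k); rewrite !rowTE !(rmorphD, rmorphM).
by have := rT' (rs i) (rs j) o (rs k); rewrite !rowTE !lowTE !(rmorphD, rmorphM).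
Qed.

Lemma step_EE j k : z * [lie lu (e j), lv (e k)] =
  d * ((lu (e j) - lv (e j)) * (lu (e k) - lv (e k))).
Proof.
apply: (row_EE (spectral_zz A) a_unit (rT o o o o)); rewrite -!rowTE //; exact: rT.
Qed.

Lemma step_Serre j k r s : [lie e j r, e k s] + [lie e j s, e k r] = 0.
Proof.
apply: (row_Serre (spectral_zz A) a_unit (rT o o o o)); rewrite -!rowTE //; exact: rT.
Qed.

End Step.

Section SecondStep.
Variables (A : nzRingType) (m : nat) (T : 'M[fps A]_(1 + (1 + m))).
Hypotheses (T0 : unital T) (rT : rtt (zz A) T).
Local Notation z := (zz A).
Local Notation d := (dd A).
Local Notation t := (Defs.schur T).
Local Notation e := (gaussE T).
Local Notation o := (o0 m).
Local Notation p := (pivot t).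

Let zC := @zz_central A.
Let dC := @dd_central A.
Let zreg := @zz_reg A.
Let t0 := unital_schur T0.
Let p_unit : p \is a GRing.unit.
Proof. by apply: fps_unit1; rewrite /pivot t0 eqxx. Qed.
Let ui := (lu_unit p_unit).

Lemma step2_EE_next k : z * [lie lu (gaussE t k), lv (e o)] =
  d * ((lu (e (rs k)) - lv (e (rs k))) - (lu (e o) - lv (e o)) * lu (gaussE t k)).
Proof.
apply: (block_EE_next zC dC ui.1 (step_TE T0 rT o o o)).
by have := step_TE T0 rT o (rs k) o; rewrite rowTE // rmorphM.
Qed.

(** In gl_n, a positive simple root vector commutes with the negative root
    vectors in which this root does not occur. *)
Lemma step2_FE k r s : gaussF t k r * e o s = e o s * gaussF t k r.
Proof.
move: r s; apply/comm2_coef.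
apply: (block_FE zC dC zreg ui.2 (step_TE T0 rT o o o)).
by have := step_TE T0 rT (rs k) o o; rewrite colTE // rmorphM.
Qed.

Lemma step2_TE i j r s : Defs.schur t i j r * e o s = e o s * Defs.schur t i j r.
Proof.
move: r s; apply/comm2_coef; rewrite schur_entry rmorphB !rmorphM.
exact: (block_schur zC dC zreg ui.1 ui.2 (step_TE T0 rT o o o)
  (step_TE T0 rT (rs i) o o) (step_TE T0 rT o (rs j) o) (step_TE T0 rT (rs i) (rs j) o)).
Qed.

End SecondStep.

(** * A Serre relation from the inverse matrix *)

Section Corner.
Variables (A : nzRingType) (T : 'M[fps A]_(1 + (1 + 1))).
Hypotheses (T0 : unital T) (rT : rtt (zz A) T).
Local Notation t := (Defs.schur T).
Local Notation e := (gaussE T).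
Let i0 : 'I_(1 + (1 + 1)) := o0 (1 + 1).
Let i1 : 'I_(1 + (1 + 1)) := rs (o0 1).
Let i2 : 'I_(1 + (1 + 1)) := rs (rs ord0).
Local Notation E1 := (gaussE t ord0).
Local Notation Ac := (A^c : nzRingType).

(** The last column of T^-1 is (- h, - E1, 1) times a unit b, where b is its
    last entry.  In the opposite algebra it becomes a row of an RTT matrix for
    -z, and [row_Serre] applies to the entries - E1 and - h. *)
Lemma corner_Serre r s :
  let h := e (rs ord0) - e (o0 1) * E1 in
  [lie E1 r, h s] + [lie E1 s, h r] = 0.
Proof.
move=> h; have [S [TS ST]] := inverse_exists T0.
have rS := rtt_inv (@zz_central A) (@swap_zz A) TS ST rT.
have sum3 (F : 'I_(1 + (1 + 1)) -> fps A) : \sum_i F i = F i0 + F i1 + F i2.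
  rewrite big_ord_recl big_ord_recl big_ord1 addrA.
  by congr (F _ + F _ + F _); apply: val_inj.
have TSE i : T i i0 * S i0 i2 + T i i1 * S i1 i2 + T i i2 * S i2 i2 = (i == i2)%:R.
  by rewrite -(sum3 (fun p => T i p * S p i2)); have /matrixP/(_ i i2) := TS; rewrite !mxE.
pose a := pivot T; have aU : a \is a GRing.unit by apply: fps_unit1; rewrite /a /pivot T0 eqxx.
pose p := pivot t.
have pU : p \is a GRing.unit.
  by apply: fps_unit1; rewrite /p /pivot (unital_schur T0) eqxx.
pose b := S i2 i2.
have Scol0 i : S i i2 0 = (i == i2)%:R.
  have /(congr1 (fun f : fps A => f 0)) := TSE i.
  rewrite !fpsDE !fpsM0E !T0 => E; transitivity (((i == i2)%:R : fps A) 0); last first.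
    by case: eqP.
  rewrite -E; have : i = i0 \/ i = i1 \/ i = i2.
    case: i {E} => [[|[|[|i]]]] Hi //; [left|right; left|right; right]; exact: val_inj.
  by case=> [|[]] ->; rewrite /= !(mul1r, mul0r, addr0, add0r).
have b0 : b 0 = 1 by rewrite /b Scol0 eqxx.
have S0 : S i0 i2 + e (o0 1) * S i1 i2 + e (rs ord0) * b = 0.
  apply: (mulrI aU); rewrite mulr0 !mulrDr !mulrA -!rowTE // TSE //.
have t0 := unital_schur T0.
have tE : t (o0 1) (o0 1) = p by [].
have tE1 : t (o0 1) (rs ord0) = p * E1 by rewrite rowTE.
have S1 : S i1 i2 = - E1 * b.
  have H1 : gaussF T (o0 1) * a * S i0 i2
      + (p + gaussF T (o0 1) * a * e (o0 1)) * S i1 i2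
      + (p * E1 + gaussF T (o0 1) * a * e (rs ord0)) * b = 0.
    have := TSE i1; rewrite (colTE T0 (o0 1)) (lowTE T0 (o0 1) (o0 1)).
    by rewrite (lowTE T0 (o0 1) (rs ord0)) tE tE1.
  apply: (mulrI pU).
  by apply: (lc_eq (lc_rel 1 1 H1 +! lc_rel (- (gaussF T (o0 1) * a)) 1 S0)); ncring.
have S0' : S i0 i2 = - h * b.
  by apply: (lc_eq (lc_rel 1 1 S0 +! lc_rel (- e (o0 1)) 1 S1)); rewrite /h; ncring.
have bU : (b : fps Ac) \is a GRing.unit by exact: fps_unit1.
have col i j : (- zz Ac) * [lie lu (S i i2 : fps Ac), lv (S j i2 : fps Ac)] =
  dd Ac * (lu (S i i2 : fps Ac) * lv (S j i2 : fps Ac)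
           - lv (S i i2 : fps Ac) * lu (S j i2 : fps Ac)).
  have H : zz A * [lie lu (S i i2), lv (S j i2)] =
      dd A * (lv (S j i2) * lu (S i i2) - lu (S j i2) * lv (S i i2)).
    apply: oppr_inj; by rewrite -mulNr rS -[RHS]mulrN opprB.
  have HC := coef_comm H.
  have H2 : zz Ac * [lie lu (S i i2 : fps Ac), lv (S j i2 : fps Ac)] =
    dd Ac * (lv (S i i2 : fps Ac) * lu (S j i2 : fps Ac)
           - lu (S i i2 : fps Ac) * lv (S j i2 : fps Ac)).
    apply: comm_of_coef => [q|q|q1 q2].
    - by rewrite Scol0 mulr_natl mulr_natr subrr.
    - by rewrite Scol0 mulr_natl mulr_natr subrr.
    - rewrite fpsBE fpsBE lumul_lv lvmul_lu.
      have := HC q1 q2; rewrite fpsBE fpsBE lumul_lv lvmul_lu => E.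
      rewrite -[RHS]/(S j i2 q1 * S i i2 q2 - S j i2 q2 * S i i2 q1).
      rewrite -[RHS]opprB -E [RHS]opprD opprK; congr (_ + _); first by rewrite opprB.
      exact: opprB.
  by rewrite mulNr H2 -mulrN opprB.
have := @row_Serre Ac (- zz Ac) b (- E1) (- h) (spectral_Nzz Ac) bU (col _ _).
rewrite !fps_opM -S1 -S0' => /(_ (col _ _) (col _ _) (col _ _) s r).
rewrite !fpsNE !mulrNN => H; rewrite -[RHS]oppr0 -H opprD addrC.
by congr (_ + _); rewrite opprB.
Qed.

End Corner.

(** * From difference relations to sums, and the Serre relations *)

Section Telescope.
Variable A : nzRingType.
Implicit Types D E F G x X : nat -> A.

(** Comparing coefficients in (u - v) [f(u), g(v)] gives relations between
    [f_(r+1), g_s] and [f_r, g_(s+1)].  The next three lemmas sum them up,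
    starting from the smallest r. *)
Lemma sum_DE (k : A) D E : central k -> D 0%N = 1 ->
  (forall r s, (0 < s)%N -> [lie D r.+1, E s] - [lie D r, E s.+1] = k * (D r * E s)) ->
  forall r s, (0 < s)%N ->
    [lie D r, E s] = k * \sum_(t < r) D t * E (r + s - 1 - t)%N.
Proof.
move=> kC D0 DE; elim=> [|r IHr] s s0.
  by rewrite D0 mul1r mulr1 subrr big_ord0 mulr0.
move/eqP: (DE r s s0); rewrite subr_eq => /eqP->; rewrite IHr // big_ord_recr /=.
rewrite mulrDr addrC; congr (_ * _ + _ * (_ * E _)); last by lia.
by apply: eq_bigr => i _; congr (_ * E _); have := ltn_ord i; lia.
Qed.

Lemma sum_EE E : E 0%N = 0 ->
  (forall s, (0 < s)%N -> [lie E 1%N, E s] = \sum_(1 <= t < s) E t * E (s - t)%N) ->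
  (forall r s, (0 < r)%N -> (0 < s)%N ->
    [lie E r.+1, E s] - [lie E r, E s.+1] = - (E r * E s + E s * E r)) ->
  forall r s, (0 < r)%N -> (0 < s)%N ->
    [lie E r, E s] = \sum_(1 <= t < s) E t * E (r + s - 1 - t)%N
                   - \sum_(1 <= t < r) E t * E (r + s - 1 - t)%N.
Proof.
move=> E0 E1 EE; elim=> // -[|r] IHr s _ s0.
  rewrite E1 // [X in _ - X]big_geq // subr0.
  by apply: eq_big_nat => t _; congr (_ * E _); lia.
move/eqP: (EE r.+1 s isT s0); rewrite subr_eq => /eqP->; rewrite IHr //.
have recr (f : nat -> A) m : (0 < m)%N ->
  \sum_(1 <= t < m.+1) f t = \sum_(1 <= t < m) f t + f m.
  by move=> m0; rewrite big_nat_recr.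
rewrite (recr _ s) // [in RHS](recr _ r.+1) //.
have eqs m : \sum_(1 <= t < m) E t * E (r.+1 + s.+1 - 1 - t)%N
    = \sum_(1 <= t < m) E t * E (r.+2 + s - 1 - t)%N.
  by apply: eq_big_nat => t _; congr (_ * E _); lia.
rewrite !eqs.
have -> : (r.+1 + s.+1 - 1 - s = r.+1)%N by lia.
have -> : (r.+2 + s - 1 - r.+1 = s)%N by lia.
set Sr := \sum_(1 <= t < r.+1) _; rewrite -[X in _ = _ - (X + _)]/Sr.
ncring.
Qed.

Lemma sum_EF E F G : 
  (forall s, (0 < s)%N -> [lie E 1%N, F s] = G s) ->
  (forall r s, (0 < r)%N -> (0 < s)%N -> [lie E r.+1, F s] - [lie E r, F s.+1] = 0) ->
  forall r s, (0 < r)%N -> (0 < s)%N -> [lie E r, F s] = G (r + s).-1.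
Proof.
move=> EF1 EF; elim=> // -[|r] IHr s _ s0; first by rewrite EF1.
move/eqP: (EF r.+1 s isT s0); rewrite subr_eq0 => /eqP->; rewrite IHr //.
by rewrite addnS.
Qed.

Hypothesis two_reg : forall x : A, x + x = 0 -> x = 0.

Definition serre (a b c : A) := [lie a, [lie b, c]] + [lie b, [lie a, c]].

(** Induction on the upper index t of X.  The relation xX expresses
    [x_r, X_(t+1)] by [x_(r+1), X_t] and x_r X_t, so that twice the Serre
    expression for (r, s; t + 1) is a combination of those for (r + 1, s; t),
    (r, s + 1; t) and (r, s; t), up to a multiple of the relation xx.  In this
    lemma X follows x, and in [serre_down] it precedes x. *)
Lemma serre_up (x X : nat -> A) :
  (forall r s, (0 < r)%N -> (0 < s)%N ->
    [lie x r.+1, x s] - [lie x r, x s.+1] = - (x r * x s + x s * x r)) ->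
  (forall r s, (0 < r)%N -> (0 < s)%N ->
    [lie x r, X s.+1] - [lie x r.+1, X s] = - (x r * X s)) ->
  (forall r s, (0 < r)%N -> (0 < s)%N -> serre (x r) (x s) (X 1%N) = 0) ->
  forall r s t, (0 < r)%N -> (0 < s)%N -> (0 < t)%N -> serre (x r) (x s) (X t) = 0.
Proof.
move=> xx xX S1 r s t; elim: t r s => // -[_|t IHt] r s r0 s0 _; first exact: S1.
have Sr := IHt r.+1 s isT s0 isT; have Ss := IHt r s.+1 r0 isT isT.
have Srs := IHt r s r0 s0 isT.
have R1 := xX r t.+1 r0 isT; have R2 := xX s t.+1 s0 isT.
have R3 := xx r s r0 s0; rewrite /serre in Sr Ss Srs *.
apply: two_reg.
apply: (lc_eq (lc_rel 1 1 Sr +! lc_rel 1 1 Ss +! lc_rel (- 1) 1 Srs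
  +! lc_rel (x r + x r) 1 R2 +! lc_rel (- (1 + 1)) (x r) R2
  +! lc_rel (x s + x s) 1 R1 +! lc_rel (- (1 + 1)) (x s) R1
  +! lc_rel (- 1) (X t.+1) R3 +! lc_rel (X t.+1) 1 R3)).
ncring.
Qed.

Lemma serre_down (x X : nat -> A) :
  (forall r s, (0 < r)%N -> (0 < s)%N ->
    [lie x r.+1, x s] - [lie x r, x s.+1] = - (x r * x s + x s * x r)) ->
  (forall r s, (0 < r)%N -> (0 < s)%N ->
    [lie x r, X s.+1] - [lie x r.+1, X s] = - (X s * x r)) ->
  (forall r s, (0 < r)%N -> (0 < s)%N -> serre (x r) (x s) (X 1%N) = 0) ->
  forall r s t, (0 < r)%N -> (0 < s)%N -> (0 < t)%N -> serre (x r) (x s) (X t) = 0.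
Proof.
move=> xx xX S1 r s t; elim: t r s => // -[_|t IHt] r s r0 s0 _; first exact: S1.
have Sr := IHt r.+1 s isT s0 isT; have Ss := IHt r s.+1 r0 isT isT.
have Srs := IHt r s r0 s0 isT.
have R1 := xX r t.+1 r0 isT; have R2 := xX s t.+1 s0 isT.
have R3 := xx r s r0 s0; rewrite /serre in Sr Ss Srs *.
apply: two_reg.
apply: (lc_eq (lc_rel 1 1 Sr +! lc_rel 1 1 Ss +! lc_rel 1 1 Srs
  +! lc_rel (x r + x r) 1 R2 +! lc_rel (- (1 + 1)) (x r) R2
  +! lc_rel (x s + x s) 1 R1 +! lc_rel (- (1 + 1)) (x s) R1
  +! lc_rel (- 1) (X t.+1) R3 +! lc_rel (X t.+1) 1 R3)).
ncring.
Qed.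

End Telescope.

Section SecondStepSerre.
Variables (A : nzRingType) (m : nat) (T : 'M[fps A]_(1 + (1 + m))).
Hypotheses (T0 : unital T) (rT : rtt (zz A) T).

(** Only the rows and columns 0, 1 and k + 2 of T matter, and they form a 3 x 3
    RTT matrix. *)
Lemma step2_Serre_down (k : 'I_m) r s :
  let E1 := gaussE (Defs.schur T) k in
  let h := gaussE T (rs k) - gaussE T (o0 m) * E1 in
  [lie E1 r, h s] + [lie E1 s, h r] = 0.
Proof.
pose w (i : 'I_(1 + (1 + 1))) : 'I_(1 + (1 + m)) :=
  if val i is p.+1 then if p is _.+1 then rs (rs k) else rs (o0 m) else o0 (1 + m).
have w_inj i j : (w i == w j) = (i == j).
  by rewrite -!val_eqE /w; case: i => [[|[|[|i]]] Hi] //; case: j => [[|[|[|j]]] Hj]; rewrite //= eqxx.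
have T30 : unital (mxsub w w T) by move=> i j; rewrite mxE T0 w_inj.
have eE j : gaussE (mxsub w w T) j = gaussE T (if val j == 0 then o0 m else rs k).
  rewrite /gaussE -!lock !mxE; congr (_ * T _ _).
  by case: j => [[|[|j]] Hj].
have E1E : gaussE (Defs.schur (mxsub w w T)) ord0 = gaussE (Defs.schur T) k.
  by rewrite /gaussE -!lock !schur_entry !mxE.
by have := corner_Serre T30 (rtt_sub w rT) r s; rewrite !eE E1E.
Qed.

End SecondStepSerre.

(** * The coordinates of an RTT matrix satisfy the Drinfeld relations *)

(** The relations that involve D and E only.  Those for D and F are the same
    relations over the opposite algebra, see [Drel]. *)
Record Erel (A : nzRingType) (n : nat) (D E : nat -> fps A) : Prop := MkErel {
  relDD : forall i j r s, (i < n)%N -> (j < n)%N -> [lie D i r, D j s] = 0;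
  relDE : forall i j r s, (i < n)%N -> (j.+1 < n)%N -> (0 < s)%N ->
    [lie D i r, E j s] = ((i == j)%:R - (i == j.+1)%:R) *
      \sum_(t < r) D i t * E j (r + s - 1 - t)%N;
  relEE : forall i r s, (i.+1 < n)%N -> (0 < r)%N -> (0 < s)%N ->
    [lie E i r, E i s] = \sum_(1 <= t < s) E i t * E i (r + s - 1 - t)%N
                       - \sum_(1 <= t < r) E i t * E i (r + s - 1 - t)%N;
  relEE_next : forall i r s, (i.+2 < n)%N -> (0 < r)%N -> (0 < s)%N ->
    [lie E i r, E i.+1 s.+1] - [lie E i r.+1, E i.+1 s] = - (E i r * E i.+1 s);
  relEE_far : forall i j r s, (i.+1 < j)%N -> (j.+1 < n)%N ->
    (0 < r)%N -> (0 < s)%N -> [lie E i r, E j s] = 0;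
  relSerre_up : forall i r s t, (i.+2 < n)%N ->
    (0 < r)%N -> (0 < s)%N -> (0 < t)%N -> serre (E i r) (E i s) (E i.+1 t) = 0;
  relSerre_down : forall i r s t, (i.+2 < n)%N ->
    (0 < r)%N -> (0 < s)%N -> (0 < t)%N -> serre (E i.+1 r) (E i.+1 s) (E i t) = 0
}.

Definition EFrel (A : nzRingType) (n : nat) (D E F : nat -> fps A) : Prop :=
  forall i j r s, (i.+1 < n)%N -> (j.+1 < n)%N -> (0 < r)%N -> (0 < s)%N ->
    [lie E i r, F j s] = (i == j)%:R *
      \sum_(t < r + s) (- (D i)^-1) t * D i.+1 (r + s - 1 - t)%N.

Lemma central1 (R : nzRingType) : central (1 : R).
Proof. by move=> x; rewrite mul1r mulr1. Qed.
Lemma centralN1 (R : nzRingType) : central (- 1 : R).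
Proof. by move=> x; rewrite mulN1r mulrN1. Qed.

Section Forward.
Variable A : nzRingType.
Hypothesis two_reg : forall x : A, x + x = 0 -> x = 0.

Lemma pivot_coords n (T : 'M[fps A]_(1 + n)) D E F : coords T D E F -> pivot T = D 0%N.
Proof. by case/coordsS. Qed.

Lemma gaussE_coords n (T : 'M[fps A]_(1 + n)) D E F (k : 'I_n) : unital T ->
  coords T D E F -> k = 0%N :> nat -> gaussE T k = E 0%N.
Proof.
move=> T0 /coordsS[D0 EF _] k0; rewrite /gaussE -lock D0; have [-> _] := EF k k0.
by rewrite mulKr // fps_unit1 // -D0 T0 eqxx.
Qed.

Lemma gaussF_coords n (T : 'M[fps A]_(1 + n)) D E F (k : 'I_n) : unital T ->
  coords T D E F -> k = 0%N :> nat -> gaussF T k = F 0%N.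
Proof.
move=> T0 /coordsS[D0 EF _] k0; rewrite /gaussF -lock D0; have [_ ->] := EF k k0.
by rewrite mulrK // fps_unit1 // -D0 T0 eqxx.
Qed.

(** The coordinates D_i, E_i (i >= 2) and F_i (i >= 2) belong to the second
    Schur complement, which commutes with E_0 by [step2_TE]; F_1 is covered by
    [step2_FE]. *)
Lemma E0_comm n (T : 'M[fps A]_(1 + (1 + n))) D E F s : unital T ->
  rtt (zz A) T -> coords T D E F ->
  let x := fpsC (E 0%N s) in
  [/\ forall i, (i.+2 < n.+2)%N -> GRing.comm x (D i.+2),
      forall i, (i.+3 < n.+2)%N -> GRing.comm x (E i.+2)
    & forall i, (i.+2 < n.+2)%N -> GRing.comm x (F i.+1)].
Proof.
move=> T0 rT cT x; have E0 := gaussE_coords T0 cT (erefl : o0 n = 0%N :> nat).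
have [_ _ ct] := (coordsS _ _ _ _).1 cT; have t0 := unital_schur T0.
have [_ _ ctt] := (coordsS _ _ _ _).1 ct; have tt0 := unital_schur t0.
have xt i j : GRing.comm x (Defs.schur (Defs.schur T) i j).
  by apply/fps_comm => r; rewrite -E0 -step2_TE.
have [cD cE cF] := coords_comm tt0 ctt xt.
split=> // -[|i] lt_in; last exact: cF.
have F1 := gaussF_coords t0 ct (erefl : Ordinal (lt_in : (0 < n)%N) = 0%N :> nat).
by apply/fps_comm => r; rewrite -E0 -[F 1%N]F1 step2_FE.
Qed.

Lemma D0_comm n (T : 'M[fps A]_(1 + n)) D E F s : unital T ->
  rtt (zz A) T -> coords T D E F ->
  let x := fpsC (D 0%N s) in
  [/\ forall i, (i.+1 < n.+1)%N -> GRing.comm x (D i.+1),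
      forall i, (i.+2 < n.+1)%N -> GRing.comm x (E i.+1)
    & forall i, (i.+2 < n.+1)%N -> GRing.comm x (F i.+1)].
Proof.
move=> T0 rT cT x; have [D0 _ ct] := (coordsS _ _ _ _).1 cT.
apply: (coords_comm (unital_schur T0) ct) => i j; apply/fps_comm => r.
by rewrite -D0; have /comm2_coef -> := step_DT T0 rT i j.
Qed.

Lemma comm_lie (x y : A) : x * y = y * x -> [lie x, y] = 0.
Proof. by move=> ->; rewrite subrr. Qed.

Lemma coef_quad (e g : fps A) s r : ((lu e - lv e) * (lu g - lv g)) s r =
  (e * g) r *+ (s == 0) - e r * g s - e s * g r + (e * g) s *+ (r == 0).
Proof.
rewrite mulrBl !mulrBr -!rmorphM /= !fpsBE lumul_lv lvmul_lu luE lvE opprB.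
by rewrite addrA addrAC.
Qed.

(** The series g is the entry (0, 2) of the factor E of T, and - h is that of
    its inverse.  Since g_s = [E_0^(s), E_1^(1)] and - h_s = [E_1^(s), E_0^(1)],
    the last two clauses are the Serre relations for t = 1. *)
Lemma EE_next_coef m (T : 'M[fps A]_(1 + (1 + m))) D E F : unital T ->
  rtt (zz A) T -> coords T D E F -> (0 < m)%N -> exists g : fps A,
  [/\ forall r s, [lie E 1%N r.+1, E 0%N s] - [lie E 1%N r, E 0%N s.+1] =
        g r *+ (s == 0) - g s *+ (r == 0) - (E 0%N * E 1%N) r *+ (s == 0) + E 0%N s * E 1%N r,
      forall r s, [lie E 0%N r, g s] + [lie E 0%N s, g r] = 0
    & let h := g - E 0%N * E 1%N in forall r s, [lie E 1%N r, h s] + [lie E 1%N s, h r] = 0].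
Proof.
move=> T0 rT cT m0; pose k := Ordinal m0; exists (gaussE T (rs k)).
have E0 := gaussE_coords T0 cT (erefl : o0 m = 0%N :> nat).
have [_ _ ct] := (coordsS _ _ _ _).1 cT; have t0 := unital_schur T0.
have E1 := gaussE_coords t0 ct (erefl : k = 0%N :> nat).
split=> [r s|r s|/= r s].
- have := coef_comm (step2_EE_next T0 rT k) r s; rewrite E0 E1 /= => ->.
  rewrite mulrBl -rmorphM /= !fpsBE !luE !lvE lvmul_lu opprB addrA.
  by rewrite addrAC.
- by rewrite -E0; exact: step_Serre.
- by have := step2_Serre_down T0 rT k r s; rewrite E0 E1.
Qed.

Lemma EE_diff n (T : 'M[fps A]_(1 + n)) D E F : unital T ->
  rtt (zz A) T -> coords T D E F -> (0 < n)%N ->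
  forall r s, [lie E 0%N r.+1, E 0%N s] - [lie E 0%N r, E 0%N s.+1] =
    (E 0%N * E 0%N) r *+ (s == 0) - E 0%N r * E 0%N s - E 0%N s * E 0%N r
    + (E 0%N * E 0%N) s *+ (r == 0).
Proof.
move=> T0 rT cT n0 r s.
have := coef_comm (step_EE T0 rT (Ordinal n0) (Ordinal n0)) r s.
by rewrite (gaussE_coords T0 cT) // => ->; rewrite coef_quad.
Qed.

(** By induction on the size, the relations between coordinates of index at
    least 1 hold in the Schur complement.  Those that involve the index 0 come
    from the first step, or from the first two. *)
Theorem rtt_Erel n (T : 'M[fps A]_n) D E F : unital T -> rtt (zz A) T ->
  coords T D E F -> Erel n D E.
Proof.
elim: n T D E F => [|n IHn] T D E F T0 rT cT; first by split.
have [D0 EF0 ct] := (coordsS _ _ _ _).1 cT; have t0 := unital_schur T0.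
have [rDD rDE rEE rEEn rEEf rSu rSd] := IHn _ _ _ _ t0 (rtt_schur T0 rT) ct.
have [DU _ _] := coords_unital T0 cT; have [_ EU _] := coords_unital T0 cT.
have cD s := D0_comm s T0 rT cT.
have eE0 (k : 'I_n) := gaussE_coords (k := k) T0 cT.
split.
- move=> [|i] [|j] r s lt_in lt_jn; last exact: (rDD i j).
  + have /comm2_coef DD := step_DD rT.
    by apply: comm_lie; rewrite -D0; exact: DD.
  + by have [cDD _ _] := cD r; apply: comm_lie; have /fps_comm := cDD j lt_jn.
  + by have [cDD _ _] := cD s; apply: comm_lie; have /fps_comm-> := cDD i lt_in.
- move=> [|i] [|j] r s lt_in lt_jn s0; last exact: (rDE i j).
  + rewrite eqxx subr0; apply: sum_DE => //; [exact: central1|exact: DU|move=> {}r {}s {}s0].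
    have := coef_comm (step_DE T0 rT (Ordinal (lt_jn : (0 < n)%N))) r s.
    rewrite eE0 // [pivot T]D0 => ->; rewrite mulrBr fpsBE fpsBE lumul_lv.
    rewrite -rmorphM /= luE; case: s s0 => // s _.
    by rewrite mulr0n subr0 mul1r.
  + have [_ cDE _] := cD r; rewrite subrr mul0r; apply: comm_lie.
    by have /fps_comm-> := cDE j lt_jn.
  + have [m en] : exists m, n = m.+1 by case: (n) lt_jn => // m; exists m.
    subst n; have [cDE _ _] := E0_comm s T0 rT cT.
    case: i lt_in => [|i] lt_in; last first.
      rewrite subrr mul0r; apply: comm_lie.
      by have /fps_comm-> := cDE i lt_in.
    rewrite sub0r; apply: sum_DE => //; [exact: centralN1|exact: DU|move=> q1 q2 q0].
    have := coef_comm (step_TE T0 rT (o0 m) (o0 m) (o0 m)) q1 q2.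
    rewrite eE0 // -/(pivot _) (pivot_coords ct) => ->.
    rewrite mulrBr fpsBE fpsBE lumul_lv.
    rewrite -rmorphM /= luE; case: q2 q0 => // q2 _.
    by rewrite mulr0n sub0r mulN1r.
- move=> [|i] r s lt_in r0 s0; last exact: (rEE i).
  have E0 := EU 0 lt_in.
  have EE := EE_diff T0 rT cT lt_in.
  apply: sum_EE => // [{}s {}s0|{}r {}s {}r0 {}s0].
    have := EE 0%N s; rewrite E0 !mul0r !mulr0 !subr0 => ->.
    case: s s0 => // s _; rewrite mulr0n add0r mulr1n fpsME.
    rewrite big_ord_recl big_ord_recr /= E0 mul0r add0r subnn E0 mulr0 addr0.
    by rewrite big_add1 /= big_mkord; apply: eq_bigr.
  rewrite EE; case: r r0 => // r _; case: s s0 => // s _.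
  by rewrite !mulr0n addr0 sub0r opprD.
- move=> [|i] r s lt_in r0 s0; last exact: (rEEn i).
  have [m en] : exists m, n = m.+1 by case: (n) lt_in => // m; exists m.
  subst n; have [g [gE _ _]] := EE_next_coef T0 rT cT lt_in.
  have := gE s r; case: r r0 => // r _; case: s s0 => // s _.
  rewrite !mulr0n !subr0 add0r => H.
  by apply: (lc_eq (lc_rel (- 1) 1 H)); ncring.
- move=> [|i] [|j] r s lt_ij lt_jn r0 s0 //; last exact: (rEEf i j).
  have [m en] : exists m, n = m.+1 by case: (n) lt_jn => // m; exists m.
  subst n; case: j lt_ij lt_jn => // j _ lt_jn.
  have [_ cEE _] := E0_comm r T0 rT cT; apply: comm_lie.
  by have /fps_comm-> := cEE j lt_jn.
- move=> [|i] r s t lt_in; last exact: (rSu i).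
  have [m en] : exists m, n = m.+1 by case: (n) lt_in => // m; exists m.
  subst n; have [g [gE gS _]] := EE_next_coef T0 rT cT lt_in.
  have [_ E1U _] := coords_unital t0 ct; have E10 : E 1%N 0 = 0 := E1U 0 lt_in.
  move: r s t; apply: serre_up => // {}r {}s r0 s0.
  + rewrite (EE_diff T0 rT cT) //; case: r r0 => // r _; case: s s0 => // s _.
    by rewrite !mulr0n addr0 sub0r opprD.
  + have := gE s r; case: r r0 => // r _; case: s s0 => // s _.
    rewrite !mulr0n !subr0 add0r => H.
    by apply: (lc_eq (lc_rel (- 1) 1 H)); ncring.
  + have gg q : (0 < q)%N -> [lie E 0%N q, E 1%N 1%N] = g q.
      move=> q0; have := gE 0%N q; case: q q0 => // q _.
      rewrite !mulr0n mulr1n E10 !mulr0 mul0r !subr0 addr0 sub0r => H.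
      by rewrite -opprB H opprK.
    by rewrite /serre !gg.
- move=> [|i] r s t lt_in; last exact: (rSd i).
  have [m en] : exists m, n = m.+1 by case: (n) lt_in => // m; exists m.
  subst n; have [g [gE _ gS]] := EE_next_coef T0 rT cT lt_in.
  have E00 : E 0%N 0 = 0 by exact: EU.
  move: r s t; apply: serre_down => // {}r {}s r0 s0.
  + rewrite (EE_diff t0 (rtt_schur T0 rT) ct) //; case: r r0 => // r _; case: s s0 => // s _.
    by rewrite !mulr0n addr0 sub0r opprD.
  + have := gE r s; case: r r0 => // r _; case: s s0 => // s _.
    rewrite !mulr0n !subr0 add0r => H.
    by apply: (lc_eq (lc_rel (- 1) 1 H)); ncring.
  + have gg q : (0 < q)%N -> [lie E 1%N q, E 0%N 1%N] = - (g - E 0%N * E 1%N) q.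
      move=> q0; have := gE q 0%N; case: q q0 => // q _.
      rewrite !mulr0n !mulr1n E00 !(mulr0, mul0r, subr0, addr0) => H.
      by rewrite fpsBE; apply: (lc_eq (lc_rel (- 1) 1 H)); ncring.
    rewrite /serre !gg // !mulrN !mulNr -!opprD.
    by have := gS r s; rewrite /= => ->; rewrite oppr0.
Qed.

End Forward.

Section ForwardEF.
Variable A : nzRingType.
Local Notation Ac := (A^c : nzRingType).

Lemma F0_comm n (T : 'M[fps A]_(1 + (1 + n))) D E F s : unital T ->
  rtt (zz A) T -> coords T D E F ->
  forall i r, (i.+2 < n.+2)%N -> F 0%N s * E i.+1 r = E i.+1 r * F 0%N s.
Proof.
move=> T0 rT cT i r lt_in.
have [_ _ cE] := E0_comm s (opmx_unital T0) (opmx_rtt T0 rT) (opmx_coords T0 cT).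
by have /fps_comm/(_ r) := cE i lt_in.
Qed.

Theorem rtt_EFrel n (T : 'M[fps A]_n) D E F : unital T -> rtt (zz A) T ->
  coords T D E F -> EFrel n D E F.
Proof.
elim: n T D E F => [|n IHn] T D E F T0 rT cT //.
have [D0 EF0 ct] := (coordsS _ _ _ _).1 cT; have t0 := unital_schur T0.
move=> [|i] [|j] r s lt_in lt_jn r0 s0; last exact: (IHn _ _ _ _ t0 (rtt_schur T0 rT) ct i j).
- have [m en] : exists m, n = m.+1 by case: (n) lt_in => // m; exists m.
  subst n; pose k := o0 m.
  have [_ EU FU] := coords_unital T0 cT.
  have E00 : E 0%N 0%N = 0 := EU 0%N lt_in; have F00 : F 0%N 0%N = 0 := FU 0%N lt_in.
  pose G := - (D 0%N)^-1 * D 1%N.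
  have EF q1 q2 : [lie E 0%N q1.+1, F 0%N q2] - [lie E 0%N q1, F 0%N q2.+1] =
      G q2 *+ (q1 == 0)%N - G q1 *+ (q2 == 0)%N.
    have := coef_comm (step_EF T0 rT k k) q1 q2.
    rewrite (gaussE_coords T0 cT) // (gaussF_coords T0 cT) // => ->.
    rewrite (pivot_coords cT) -[Defs.schur T k k]/(pivot (Defs.schur T)).
    rewrite (pivot_coords ct) fpsBE fpsBE luE lvE /G !mulNr !fpsNE !mulNrn opprK addrC //.
  rewrite mul1r (@sum_EF A (E 0%N) (F 0%N) G) //.
  + rewrite /G fpsME prednK; last by rewrite addn_gt0 r0.
    by apply: eq_bigr => q _; congr (_ * D _ _); lia.
  + by move=> {}s {}s0; have := EF 0%N s; rewrite E00 mul0r mulr0 !subr0; case: s s0 => // s _; rewrite !mulr0n mulr1n subr0.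
  + by move=> {}r {}s {}r0 {}s0; rewrite EF; case: r r0 => // r _; case: s s0 => // s _; rewrite !mulr0n subr0.
- have [m en] : exists m, n = m.+1 by case: (n) lt_jn => // m; exists m.
  subst n; rewrite mul0r; apply: comm_lie.
  by have [_ _ cEF] := E0_comm r T0 rT cT; have /fps_comm := cEF j lt_jn.
- have [m en] : exists m, n = m.+1 by case: (n) lt_in => // m; exists m.
  by subst n; rewrite mul0r; apply: comm_lie; rewrite (F0_comm s T0 rT cT).
Qed.

Record Drel (n : nat) (D E F : nat -> fps A) : Prop := MkDrel {
  DrelE : Erel n D E;
  DrelF : Erel (A := Ac) n D F;
  DrelEF : EFrel n D E F }.

Theorem rtt_Drel n (T : 'M[fps A]_n) D E F : (forall x : A, x + x = 0 -> x = 0) ->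
  unital T -> rtt (zz A) T -> coords T D E F -> Drel n D E F.
Proof.
move=> two T0 rT cT; split; [exact: rtt_Erel cT| |exact: rtt_EFrel cT].
exact: (@rtt_Erel Ac two n _ _ _ _ (opmx_unital T0) (opmx_rtt T0 rT) (opmx_coords T0 cT)).
Qed.

End ForwardEF.

(** * Representations of gl_n from few relations *)

Section GlAction.
Variables (A : nzRingType) (I : eqType).
Implicit Types (P : pred I) (x T : I -> I -> A) (a b c : A).

Lemma lie_jacobi a b c : [lie [lie a, b], c] = [lie [lie a, c], b] + [lie a, [lie b, c]].
Proof. ncring. Qed.

Lemma lie_jacobi_r a b c : [lie c, [lie a, b]] = [lie [lie c, a], b] + [lie a, [lie c, b]].
Proof. ncring. Qed.

Lemma lie_opp a b : [lie a, b] = - [lie b, a].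
Proof. by rewrite opprB. Qed.

Lemma lie_natl (n : nat) a b : [lie n%:R * a, b] = n%:R * [lie a, b].
Proof. by rewrite mulrBr !mulr_natl mulrnAl mulrnAr. Qed.

Lemma lie_natr (n : nat) a b : [lie a, n%:R * b] = n%:R * [lie a, b].
Proof. by rewrite mulrBr !mulr_natl mulrnAl mulrnAr. Qed.

Lemma lie_subl a b c : [lie a - b, c] = [lie a, c] - [lie b, c].
Proof. ncring. Qed.

Lemma lie_subr a b c : [lie a, b - c] = [lie a, b] - [lie a, c].
Proof. ncring. Qed.

Lemma lie_oppr a b : [lie a, - b] = - [lie a, b].
Proof. ncring. Qed.

Lemma lie_addl a b c : [lie a + b, c] = [lie a, c] + [lie b, c].
Proof. ncring. Qed.

(** The x_ij with i, j in P satisfy the relations of the matrix units. *)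
Definition gl_on P x := forall i j h k, P i -> P j -> P h -> P k ->
  [lie x i j, x h k] = (h == j)%:R * x i k - (i == k)%:R * x h j.

(** B transforms under the x_hl as v_j (x) v_k, where the v_j form a vector
    module. *)
Definition bil_on P x (B : I -> I -> A) := forall j k h l, P j -> P k -> P h -> P l ->
  [lie B j k, x h l] = (h == j)%:R * B l k + (h == k)%:R * B j l.

(** The tensor square is generated by v_v (x) v_w for any two distinct indices,
    and its symmetric part by v_w (x) v_w. *)
Lemma bil_zero P x B v w : bil_on P x B -> P v -> P w -> v != w -> B v w = 0 ->
  forall j k, P j -> P k -> B j k = 0.
Proof.
move=> bB Pv Pw ne_vw Bvw.
have Bw j : P j -> B j w = 0.
  move=> Pj; have := bB v w v j Pv Pw Pv Pj.
  by rewrite Bvw !mul0r mulr0 subr0 eqxx mul1r (negPf ne_vw) mul0r addr0.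
move=> j k Pj Pk; have := bB j w w k Pj Pw Pw Pk.
by rewrite !Bw // !mul0r mulr0 subr0 eqxx mul1r mulr0 add0r.
Qed.

Hypothesis two_reg : forall x : A, x + x = 0 -> x = 0.

Lemma bil_sym_zero P x B w : bil_on P x B -> P w ->
  (forall j k, P j -> P k -> B j k = B k j) -> B w w = 0 ->
  forall j k, P j -> P k -> B j k = 0.
Proof.
move=> bB Pw sB Bw.
have Bwl l : P l -> B w l = 0.
  move=> Pl; apply: two_reg; have := bB w w w l Pw Pw Pw Pl.
  by rewrite Bw mul0r mulr0 subrr eqxx !mul1r (sB l w).
move=> j k Pj Pk; have := bB w k w j Pw Pk Pw Pj.
by rewrite Bwl // mul0r mulr0 subrr eqxx mul1r Bwl // mulr0 addr0.
Qed.

(** If v_i1 is killed by all x_hk with h <> i1, its images v_j = [v_i1, x_(i1 j)]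
    span a vector module as soon as [v_j, x_(i1 k)] vanishes for j, k <> i1.
    This family is symmetric and transforms as a bilinear one under the
    x_hk with h, k <> i1, so one Serre relation suffices. *)
Lemma vector_action P x (v : I -> A) i1 : P i1 -> gl_on P x ->
  (forall j, P j -> v j = [lie v i1, x i1 j]) ->
  (forall h k, P h -> P k -> h != i1 -> [lie v i1, x h k] = 0) ->
  (forall j, P j -> j = i1) \/
  (exists w, [/\ P w, w != i1 & [lie [lie v i1, x i1 w], x i1 w] = 0]) ->
  forall j h k, P j -> P h -> P k -> [lie v j, x h k] = (h == j)%:R * v k.
Proof.
move=> P1 gx vE v1 Serre.
have vne j h k : P j -> P h -> P k -> h != i1 -> [lie v j, x h k] = (h == j)%:R * v k.
  move=> Pj Ph Pk h1; rewrite (vE j Pj) lie_jacobi v1 // mul0r mulr0 subrr add0r.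
  by rewrite gx // lie_subr !lie_natr (v1 h j) // -vE // mulr0 subr0.
have v1k j k : P j -> P k -> [lie v j, x i1 k] =
    [lie v k, x i1 j] + (i1 == j)%:R * v k - (i1 == k)%:R * v j.
  move=> Pj Pk; rewrite {1 2}(vE j Pj) lie_jacobi -(vE k Pk).
  by rewrite gx // lie_subr !lie_natr -(vE k Pk) -(vE j Pj) addrA.
have S0 j k : P j -> P k -> j != i1 -> k != i1 -> [lie v j, x i1 k] = 0.
  move=> Pj Pk j1 k1; case: Serre => [only|[w [Pw w1 Sw]]].
    by rewrite (only j Pj) eqxx in j1.
  pose P' i := P i && (i != i1); pose B j k := [lie v j, x i1 k].
  have Bbil : bil_on P' x B.
    move=> p q h l /andP[Pp p1] /andP[Pq q1] /andP[Ph h1] /andP[Pl l1].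
    rewrite /B lie_jacobi vne // lie_natl gx // lie_subr !lie_natr.
    by rewrite [i1 == l]eq_sym (negPf l1) mul0r subr0.
  apply: (bil_sym_zero Bbil (w := w)); rewrite /P' /B ?Pw ?w1 ?Pj ?Pk //.
    move=> p q /andP[Pp p1] /andP[Pq q1]; rewrite v1k //.
    by rewrite ![i1 == _]eq_sym (negPf p1) (negPf q1) !mul0r addr0 subr0.
  by rewrite {1 2}(vE w Pw).
move=> j h k Pj Ph Pk; have [->|] := eqVneq h i1; last exact: vne.
have [<-|j1] := eqVneq i1 j; first by rewrite mul1r -vE.
have [->|k1] := eqVneq k i1; last by rewrite mul0r S0 // eq_sym.
rewrite v1k // eqxx (negPf j1) -(vE j Pj) !mul0r addr0 mul1r subrr //.
Qed.

End GlAction.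

Section GlExtend.
Variables (I : eqType) (o i1 : I).
Hypothesis i1o : i1 != o.
Let P : pred I := fun i => i != o.
Let P1 : P i1 := i1o.

(** The row x_(o j) of positive root vectors is generated by the simple one
    x_(o i1).  The conditions involving w are the Serre relations of x_(o i1)
    and x_(i1 w), where w is the index next to i1. *)
Definition gl_row (A : nzRingType) (x : I -> I -> A) : Prop :=
  [/\ forall j, P j -> x o j = [lie x o i1, x i1 j],
      forall h k, P h -> P k -> h != i1 -> [lie x o i1, x h k] = 0,
      [lie x o i1, x o o] = - x o i1
    & (forall j, P j -> j = i1) \/
      (exists w, [/\ P w, w != i1, [lie [lie x o i1, x i1 w], x i1 w] = 0
                   & [lie x o i1, [lie x o i1, x i1 w]] = 0])].

Section Row.
Variables (A : nzRingType) (x : I -> I -> A).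
Hypothesis two_reg : forall a : A, a + a = 0 -> a = 0.
Hypothesis gx : gl_on P x.
Hypothesis xoo : forall h k, P h -> P k -> [lie x o o, x h k] = 0.
Hypothesis rx : gl_row x.

Lemma gl_row_action j h k : P j -> P h -> P k ->
  [lie x o j, x h k] = (h == j)%:R * x o k.
Proof.
case: rx => xE x1 _ S; apply: (vector_action two_reg P1 gx xE x1) => //.
by case: S => [|[w [Pw w1 S1 S2]]]; [left|right; exists w].
Qed.

Lemma gl_row_comm j k : P j -> P k -> [lie x o j, x o k] = 0.
Proof.
case: rx => xE x1 _ [only|[w [Pw w1 S1 S2]]] Pj Pk.
  by rewrite (only j Pj) (only k Pk) subrr.
have bB : bil_on P x (fun j k => [lie x o j, x o k]).
  move=> {Pj}j {Pk}k h l Pj Pk Ph Pl.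
  rewrite /= lie_jacobi (gl_row_action Pj Ph Pl) (gl_row_action Pk Ph Pl).
  by rewrite lie_natl lie_natr.
apply: (bil_zero bB P1 Pw) => //; first by rewrite eq_sym.
by rewrite (xE w Pw).
Qed.

Lemma gl_row_weight j : P j -> [lie x o j, x o o] = - x o j.
Proof.
case: rx => xE x1 xo _ Pj; rewrite (xE j Pj) lie_jacobi xo.
rewrite (lie_opp (x i1 j)) xoo // oppr0 mulr0 mul0r subrr addr0.
by rewrite mulNr mulrN -opprD.
Qed.

End Row.

Variables (A : nzRingType) (x : I -> I -> A).
Local Notation Ac := (A^c : nzRingType).
Hypothesis two_reg : forall a : A, a + a = 0 -> a = 0.
Hypothesis gx : gl_on P x.
Hypothesis xoo : forall h k, P h -> P k -> [lie x o o, x h k] = 0.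
Hypothesis rE : gl_row x.
Let y : I -> I -> Ac := fun i j => x j i.
Hypothesis rF : gl_row y.
Hypothesis x11 : [lie x o i1, x i1 o] = x o o - x i1 i1.

Let gy : gl_on P y.
Proof. by move=> i j h k Pi Pj Ph Pk; have := gx Pk Ph Pj Pi; rewrite !mulr_natl (eq_sym j) (eq_sym k). Qed.

Let yoo h k : P h -> P k -> [lie y o o, y h k] = 0.
Proof. by move=> Ph Pk; rewrite lie_opp [X in - X](xoo Pk Ph) oppr0. Qed.

Let FA j h k : P j -> P h -> P k -> [lie x k h, x j o] = (h == j)%:R * x k o.
Proof. by move=> Pj Ph Pk; have := gl_row_action (A := Ac) two_reg gy rF Pj Ph Pk; rewrite !mulr_natl. Qed.

Let FC j k : P j -> P k -> [lie x k o, x j o] = 0.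
Proof. exact: (gl_row_comm (A := Ac) two_reg gy rF). Qed.

Let FW j : P j -> [lie x o o, x j o] = - x j o.
Proof. exact: (gl_row_weight (A := Ac) yoo rF). Qed.

Let EA := gl_row_action two_reg gx rE.
Let EC := gl_row_comm two_reg gx rE.
Let EW := gl_row_weight xoo rE.

Let EF j h : P j -> P h -> [lie x o j, x h o] = (h == j)%:R * x o o - x h j.
Proof.
move=> Pj Ph; have [xE x1 xo _] := rE.
have yE k : P k -> x k o = [lie x k i1, x i1 o] by case: rF => yE _ _ _ Pk; exact: yE.
have E1h : [lie x o i1, x h o] = (h == i1)%:R * x o o - x h i1.
  rewrite (yE h Ph) lie_jacobi_r (EA P1 Ph P1) lie_natl x11 lie_subr.
  rewrite (lie_opp _ (x o o)) (xoo Ph P1) (gx Ph P1 P1 P1) eqxx mul1r oppr0 sub0r.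
  by rewrite opprB mulrBr addrA subrK.
rewrite (xE j Pj) lie_jacobi E1h (FA Ph Pj P1) lie_natr x11 lie_subl lie_natl.
rewrite (xoo P1 Pj) (gx Ph P1 P1 Pj) eqxx mul1r mulr0 sub0r opprB mulrBr.
by rewrite (eq_sym j) addrC addrA subrK.
Qed.

(** To the relations of the matrix units off the index o one adds the row and the
    column of o; the column is treated as a row over the opposite algebra.  All
    brackets between them follow from the one of x_(o i1) and x_(i1 o), since
    both sides are equivariant. *)
Lemma gl_extend : gl_on predT x.
Proof.
move=> i j h k _ _ _ _.
case: (eqVneq i o) => [->|Pi]; case: (eqVneq j o) => [->|Pj];
case: (eqVneq h o) => [->|Ph]; case: (eqVneq k o) => [->|Pk].
all: rewrite ?eqxx ?(negPf Pj) ?(negPf Pk) ?[o == _]eq_sym ?(negPf Pi)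
  ?(negPf Ph) ?(negPf Pj) ?(negPf Pk) ?mul1r ?mul0r ?subr0 ?sub0r ?subrr //.
- by rewrite lie_opp EW // opprK.
- exact: FW.
- exact: xoo.
- exact: EW.
- exact: EC.
- exact: EF.
- exact: EA.
- by rewrite lie_opp FW // opprK.
- by rewrite lie_opp EF // opprB.
- exact: FC.
- by rewrite lie_opp FA // [k == i]eq_sym.
- by rewrite lie_opp xoo // oppr0.
- by rewrite lie_opp EA // [k == i]eq_sym.
- by rewrite (eq_sym h); exact: FA.
- exact: gx.
Qed.

End GlExtend.

(** * The orbit of a vector fixed by the diagonal blocks gl_1 and gl_(n-1) *)

Section OrbitRow.
Variables (A : nzRingType) (I : eqType) (o : I) (x : I -> I -> A) (a : A).
Let P : pred I := fun i => i != o.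
Hypothesis two_reg : forall b : A, b + b = 0 -> b = 0.
Hypothesis gx : gl_on predT x.
Hypothesis aoo : [lie a, x o o] = 0.
Hypothesis aP : forall h k, P h -> P k -> [lie a, x h k] = 0.
Hypothesis Serre : (forall j, j = o) \/
  exists w, P w /\ [lie [lie a, x o w], x o w] = 0.

Let p j := [lie a, x o j].
Let gxT i j h k : [lie x i j, x h k] = (h == j)%:R * x i k - (i == k)%:R * x h j.
Proof. exact: gx. Qed.

Lemma orbit_rowA j h k : P j -> P h -> P k -> [lie p j, x h k] = (h == j)%:R * p k.
Proof.
move=> Pj Ph Pk; rewrite /p lie_jacobi aP // mul0r mulr0 subrr add0r.
by rewrite gxT [o == k]eq_sym (negPf Pk) mul0r subr0 lie_natr.
Qed.

(** In the module of matrices, the product of two raising operators x_(o j),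
    x_(o k) kills the matrix unit e_oo.  For the orbit of a these products form
    a symmetric bilinear family, and one component decides. *)
Lemma orbit_row_comm j k : P j -> P k -> [lie p j, x o k] = 0.
Proof.
case: Serre => [no|[w [Pw S1]]] Pj Pk; first by rewrite /P (no j) eqxx in Pj.
have bB : bil_on P x (fun j k => [lie p j, x o k]).
  move=> {Pj}j {Pk}k h l Pj Pk Ph Pl.
  rewrite /= lie_jacobi orbit_rowA // gxT lie_natl [o == l]eq_sym (negPf Pl) mul0r subr0.
  by rewrite lie_natr.
apply: (bil_sym_zero two_reg bB Pw) => // {Pj}j {Pk}k Pj Pk.
rewrite /p lie_jacobi gxT ![o == _]eq_sym (negPf Pj) (negPf Pk) !mul0r.
by rewrite subrr mulr0 mul0r subrr addr0.
Qed.

Lemma orbit_row_weight j : P j -> [lie p j, x o o] = - p j.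
Proof.
move=> Pj; rewrite /p lie_jacobi aoo mul0r mulr0 subrr add0r gxT eqxx mul1r.
by rewrite [o == j]eq_sym (negPf Pj) mul0r sub0r mulrN mulNr -opprD.
Qed.

End OrbitRow.

Section Orbit.
Variables (A : nzRingType) (I : eqType) (o : I) (x : I -> I -> A) (a : A).
Local Notation Ac := (A^c : nzRingType).
Let P : pred I := fun i => i != o.
Hypothesis two_reg : forall b : A, b + b = 0 -> b = 0.
Hypothesis gx : gl_on predT x.
Hypothesis aoo : [lie a, x o o] = 0.
Hypothesis aP : forall h k, P h -> P k -> [lie a, x h k] = 0.
Hypothesis Serre : (forall j, j = o) \/ exists w, [/\ P w,
  [lie [lie a, x o w], x o w] = 0 & [lie x w o, [lie x w o, a]] = 0].

(** The x_hk act on the T_ij by commutators as on n x n matrices. *)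
Definition equivariant (T : I -> I -> A) := forall i j h k,
  [lie T i j, x h k] = (h == j)%:R * T i k - (i == k)%:R * T h j.

(** The entries of an equivariant matrix T with T_oo = a, computed from a. *)
Definition gl_orbit (i j : I) : A :=
  if i == o then if j == o then a else [lie a, x o j]
  else if j == o then [lie x i o, a]
  else (i == j)%:R * a - [lie [lie a, x o j], x i o].

Let p j := [lie a, x o j].
Let q h := [lie x h o, a].
Let gxT i j h k : [lie x i j, x h k] = (h == j)%:R * x i k - (i == k)%:R * x h j.
Proof. exact: gx. Qed.
Let y : I -> I -> Ac := fun i j => x j i.

Let gy : gl_on predT y.
Proof. by move=> i j h k _ _ _ _; have := gxT k h j i; rewrite !mulr_natl (eq_sym j) (eq_sym k). Qed.

Let ayoo : [lie (a : Ac), y o o] = 0.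
Proof. by rewrite lie_opp [X in - X]aoo oppr0. Qed.
Let ayP h k : P h -> P k -> [lie (a : Ac), y h k] = 0.
Proof. by move=> Ph Pk; rewrite lie_opp [X in - X](aP Pk Ph) oppr0. Qed.

Let SP : (forall j, j = o) \/ exists w, P w /\ [lie [lie a, x o w], x o w] = 0.
Proof. by case: Serre => [|[w [Pw S1 S2]]]; [left|right; exists w]. Qed.
Let SQ : (forall j, j = o) \/ exists w, P w /\ [lie [lie (a : Ac), y o w], y o w] = 0.
Proof. by case: Serre => [|[w [Pw S1 S2]]]; [left|right; exists w]. Qed.

Let pA := orbit_rowA gx aP.
Let pC := orbit_row_comm two_reg gx aP SP.
Let pW := orbit_row_weight gx aoo.

Let qA j h k : P j -> P h -> P k -> [lie q j, x h k] = - ((j == k)%:R * q h).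
Proof.
move=> Pj Ph Pk; rewrite lie_opp.
rewrite [X in - X](orbit_rowA (A := Ac) gy ayP Pj Pk Ph) (eq_sym j).
by rewrite !mulr_natl.
Qed.
Let qC j k : P j -> P k -> [lie q j, x k o] = 0.
Proof.
move=> Pj Pk; rewrite lie_opp.
by rewrite [X in - X](orbit_row_comm (A := Ac) two_reg gy ayP SQ Pj Pk) oppr0.
Qed.
Let qW j : P j -> [lie q j, x o o] = q j.
Proof.
move=> Pj; rewrite lie_opp.
by rewrite [X in - X](orbit_row_weight (A := Ac) gy ayoo Pj) opprK.
Qed.

Let qp i k : P i -> P k -> [lie q i, x o k] = - [lie p k, x i o].
Proof.
move=> Pi Pk; rewrite /q lie_jacobi gxT eqxx mul1r lie_subl lie_natl.
rewrite (lie_opp _ a) (lie_opp (x o o) a) aoo aP // !oppr0 mulr0 subrr add0r.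
exact: lie_opp.
Qed.

Let t i j := (i == j)%:R * a - [lie p j, x i o].
Let tE i j : P i -> P j -> t i j = (i == j)%:R * a + [lie q i, x o j].
Proof. by move=> Pi Pj; rewrite qp. Qed.

Lemma orbit_equivariant : equivariant gl_orbit.
Proof.
have o_sym : forall j, P j -> (o == j) = false by move=> j Pj; rewrite eq_sym (negPf Pj).
move=> i j h k; rewrite /gl_orbit.
case: (eqVneq i o) => [->|Pi]; case: (eqVneq j o) => [->|Pj];
case: (eqVneq h o) => [->|Ph]; case: (eqVneq k o) => [->|Pk].
all: rewrite ?eqxx ?(negPf Pj) ?(negPf Pk) ?(o_sym _ Pi) ?(o_sym _ Pj) ?(o_sym _ Ph) ?(o_sym _ Pk) ?(negPf Pi)
  ?(negPf Ph) ?mul1r ?mul0r ?subr0 ?sub0r ?subrr //.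
- by rewrite lie_opp.
- exact: aP.
- exact: pW.
- exact: pC.
- by rewrite subKr.
- exact: pA.
- exact: qW.
- by rewrite -/(q i) qp // addrAC subrr add0r.
- exact: qC.
- exact: qA.
- rewrite lie_subl lie_natl aoo mulr0 sub0r lie_jacobi pW // gxT eqxx mul1r.
  by rewrite (negPf Pi) mul0r subr0 mulNr mulrN -opprD addNr oppr0.
- rewrite lie_subl lie_natl lie_jacobi pC // gxT eqxx mul1r mul0r mulr0 subrr add0r.
  rewrite lie_subr lie_natr pA // pW // mulrN opprK opprD addrA subrr add0r //.
- rewrite -/(t i j) tE // lie_addl lie_natl lie_jacobi qC // mul0r mulr0 subrr add0r.
  rewrite gxT eqxx mul1r lie_subr lie_natr qW // qA // opprK (lie_opp a).
  by rewrite -/(q h) -/(q i) mulrN addrC addrK.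
- rewrite lie_subl lie_natl aP // mulr0 sub0r lie_jacobi pA // lie_natl.
  rewrite gxT (negPf Ph) mul0r sub0r lie_oppr lie_natr.
  by case: (h == j); case: (i == k); rewrite /= ?mulr1n ?mulr0n; ncring.
Qed.

End Orbit.

(** * The RTT relation from four entries *)

Section Defect.
Variables (A : nzRingType) (I : eqType) (x : I -> I -> A) (T : I -> I -> nat -> A).
Hypothesis Tx : forall r, equivariant x (fun i j => T i j r).

Definition defect i j h k r s : A :=
  [lie T i j r.+1, T h k s] - [lie T i j r, T h k s.+1]
  - (T h j r * T i k s - T h j s * T i k r).

Lemma natr_central n : central (n%:R : A).
Proof. by move=> y; rewrite mulr_natl mulr_natr. Qed.

(** The bracket with x_lm is a derivation, and the RTT relation is invariant under
    conjugation by GL_n. *)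
Lemma defect_action i j h k r s l m :
  [lie defect i j h k r s, x l m] =
    (l == j)%:R * defect i m h k r s - (i == m)%:R * defect l j h k r s
  + (l == k)%:R * defect i j h m r s - (h == m)%:R * defect i j l k r s.
Proof.
have a1 := Tx r.+1 i j l m; have a2 := Tx r i j l m.
have b1 := Tx s h k l m; have b2 := Tx s.+1 h k l m.
have c1 := Tx r h j l m; have c2 := Tx s h j l m.
have e1 := Tx s i k l m; have e2 := Tx r i k l m.
have z1 := natr_central (l == j); have z2 := natr_central (i == m).
have z3 := natr_central (l == k); have z4 := natr_central (h == m).
rewrite /= in a1 a2 b1 b2 c1 c2 e1 e2.
rewrite /defect.
apply: (lc_eq (lc_rel 1 (T h k s) a1 +! lc_rel (T i j r.+1) 1 b1
  +! lc_rel (- T h k s) 1 a1 +! lc_rel (- 1) (T i j r.+1) b1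
  +! lc_rel (- 1) (T h k s.+1) a2 +! lc_rel (- T i j r) 1 b2
  +! lc_rel (T h k s.+1) 1 a2 +! lc_rel 1 (T i j r) b2
  +! lc_rel (- 1) (T i k s) c1 +! lc_rel (- T h j r) 1 e1
  +! lc_rel 1 (T i k r) c2 +! lc_rel (T h j s) 1 e2)).
ncring.
Qed.

(** All components of an equivariant tensor arise from those in which the four
    indices are (o, o; h, k) with h, k in {o, w}, by moving one index at a time
    to a new value. *)
Lemma defect_zero o r s :
  defect o o o o r s = 0 -> (forall i, i = o) \/ (exists w, [/\ w != o,
    defect o o o w r s = 0, defect o o w o r s = 0 & defect o o w w r s = 0]) ->
  forall i j h k, defect i j h k r s = 0.
Proof.
move=> Q0 Qw.
have neo i : i != o -> (o == i) = false by rewrite eq_sym => /negPf.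
pose simp := (mul0r, mulr0, mul1r, addr0, add0r, subr0, sub0r, subrr, oppr0, eqxx).
have Nz (b : A) : 0 = - b -> b = 0 by move/esym/eqP; rewrite oppr_eq0 => /eqP.
have Qoo h k : defect o o h k r s = 0.
  case: Qw => [only|[w [wo Q1 Q2 Q3]]]; first by rewrite (only h) (only k).
  have Qow k' : k' != o -> defect o o w k' r s = 0.
    move=> k'o; have := defect_action o o w w r s w k'.
    by rewrite Q3 (negPf wo) (neo _ k'o) !simp => <-.
  have [->|ho] := eqVneq h o; have [->|ko] := eqVneq k o => //.
  - have := defect_action o o o w r s w k.
    by rewrite Q1 (negPf wo) (neo _ ko) !simp => <-.
  - have := defect_action o o w o r s h w.
    by rewrite Q2 (negPf ho) (neo _ wo) !simp => /Nz.
  - have := defect_action o o w k r s h w.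
    by rewrite Qow // Q3 (negPf ho) (neo _ wo) !simp => /Nz.
have Qoj j h k : defect o j h k r s = 0.
  have [->|jo] := eqVneq j o; first exact: Qoo.
  have := defect_action o o h k r s o j.
  by rewrite !Qoo (neo _ jo) !simp => <-.
move=> i j h k; have [->|io] := eqVneq i o; first exact: Qoj.
have := defect_action o j h k r s i o.
by rewrite !Qoj !simp => /Nz.
Qed.

End Defect.

(** * RTT matrices as gl_n-modules *)

Section ZeroModes.
Variable A : nzRingType.

(** These are the RTT relations with s = 0, since the constant term of T is 1.
    Among them, those with r = 1 are the relations of gl_n. *)
Lemma rtt_equivariant n (T : 'M[fps A]_n) : unital T -> rtt (zz A) T ->
  forall r, equivariant (fun i j => T i j 1%N) (fun i j => T i j r).
Proof.
move=> T0 /(rtt_coefP T0) rT r i j h k; have := rT i j h k r 0%N.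
rewrite !T0 => H.
have z1 := natr_central (A := A) (h == j); have z2 := natr_central (A := A) (i == k).
have z3 := natr_central (A := A) (h == k).
by apply: (lc_eq (lc_rel (- 1) 1 H)); ncring.
Qed.

Lemma gl_zero_modes n (T : 'M[fps A]_n) (P : pred 'I_n) :
  unital T -> rtt (zz A) T -> gl_on P (fun i j => T i j 1%N).
Proof. by move=> T0 rT i j h k _ _ _ _; exact: rtt_equivariant. Qed.

(** Products of two off-diagonal entries start in degree 2. *)
Lemma schur1 n (T : 'M[fps A]_(1 + n)) i j : unital T ->
  Defs.schur T i j 1%N = T (rs i) (rs j) 1%N.
Proof.
move=> T0; rewrite schur_entry fpsBE !fpsME !big_ord_recl !big_ord0 /= /bump /= !addr0.
rewrite !fpsM0E !T0 /= !mul0r !mulr0 !addr0.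
by rewrite subr0.
Qed.

Lemma fpsM1E (f g : fps A) : (f * g) 1%N = f 0%N * g 1%N + f 1%N * g 0%N.
Proof. by rewrite fpsME !big_ord_recl big_ord0 addr0. Qed.

Lemma coords_row1 n (T : 'M[fps A]_(1 + n)) D E F (k : 'I_n) : unital T ->
  coords T D E F -> k = 0%N :> nat ->
  T (o0 n) (rs k) 1%N = E 0%N 1%N /\ T (rs k) (o0 n) 1%N = F 0%N 1%N.
Proof.
move=> T0 cT k0; have [DU EU FU] := coords_unital T0 cT.
have n0 : (0 < n)%N by case: (n) k {k0} => // -[].
have [_ /(_ k k0)[-> ->] _] := (coordsS _ _ _ _).1 cT.
by rewrite !fpsM1E DU ?EU ?FU // !(mul1r, mulr1, mul0r, mulr0, addr0, add0r).
Qed.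

Lemma coords_zero_modes n (T : 'M[fps A]_n) D E F : unital T -> coords T D E F ->
  forall i j : 'I_n, j = i.+1 :> nat -> T i j 1%N = E i 1%N /\ T j i 1%N = F i 1%N.
Proof.
elim: n T D E F => [|n IHn] T D E F T0 cT; first by case.
have [_ _ ct] := (coordsS _ _ _ _).1 cT.
elim/ord_rs_ind => [|i]; elim/ord_rs_ind => [|j] //= ij.
  by apply: (coords_row1 T0 cT); case: ij.
rewrite -!schur1 //; apply: (IHn _ _ _ _ (unital_schur T0) ct); by case: ij.
Qed.

Section Generation.
Variable P : A -> Prop.
Hypothesis PB : forall a b, P a -> P b -> P (a - b).
Hypothesis PM : forall a b, P a -> P b -> P (a * b).

Let PL a b : P a -> P b -> P [lie a, b].
Proof. by move=> Pa Pb; apply: PB; apply: PM. Qed.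

(** By induction the Schur complement lies in the subring generated by the
    coordinates, and its zero modes (the coefficients of 1/u) are those of T.
    The zero modes of the first row and column are brackets of E_0^(1) and
    F_0^(1) with these, and the entries of T are obtained from T_00 = D_0 by
    bracketing with zero modes. *)
Lemma rtt_gen n (T : 'M[fps A]_n) D E F : unital T -> rtt (zz A) T -> coords T D E F ->
  (forall i r, (i < n)%N -> P (D i r)) ->
  (forall i r, (i.+1 < n)%N -> P (E i r)) ->
  (forall i r, (i.+1 < n)%N -> P (F i r)) -> forall i j r, P (T i j r).
Proof.
elim: n T D E F => [|n IHn] T D E F T0 rT cT PD PE PF; first by case.
have [D0 _ ct] := (coordsS _ _ _ _).1 cT.
have Pt := IHn _ _ _ _ (unital_schur T0) (rtt_schur T0 rT) ct
  (fun i r => PD i.+1 r) (fun i r => PE i.+1 r) (fun i r => PF i.+1 r).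
have Tx := rtt_equivariant T0 rT; rewrite /equivariant in Tx.
have Poo r : P (T (o0 n) (o0 n) r) by rewrite D0; exact: PD.
have n0 (k : 'I_n) : (0 < n)%N by case: (n) k => // -[].
have Px k : P (T (o0 n) (rs k) 1%N) /\ P (T (rs k) (o0 n) 1%N).
  pose k0 := Ordinal (n0 k).
  have [E1 F1] := coords_row1 T0 cT (erefl : k0 = 0%N :> nat).
  have PE1 := PE 0%N 1%N (n0 k); have PF1 := PF 0%N 1%N (n0 k).
  have := Tx 1%N (o0 n) (rs k0) (rs k0) (rs k); have := Tx 1%N (rs k) (rs k0) (rs k0) (o0 n).
  rewrite eqxx !mul1r !mul0r !subr0 => <- <-; rewrite E1 F1 -!schur1 //.
  by split; apply: PL.
have PT k r : P (T (o0 n) (rs k) r) /\ P (T (rs k) (o0 n) r).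
  have := Tx r (o0 n) (o0 n) (o0 n) (rs k); have := Tx r (o0 n) (o0 n) (rs k) (o0 n).
  rewrite eqxx !mul1r !mul0r !subr0 sub0r => F1 <-; split.
    by apply: PL => //; case: (Px k).
  rewrite -[T _ _ r]opprK -F1 opprB; apply: PL => //; by case: (Px k).
elim/ord_rs_ind => [|i]; elim/ord_rs_ind => [|j] r //; [by case: (PT j r)|by case: (PT i r)|].
have := Tx r (o0 n) (rs j) (rs i) (o0 n); rewrite eqxx mul1r => H.
have -> : T (rs i) (rs j) r = (rs i == rs j)%:R * T (o0 n) (o0 n) r
    - [lie T (o0 n) (rs j) r, T (rs i) (o0 n) 1%N] by rewrite H subKr.
apply: PB; last by apply: PL; [case: (PT j r)|case: (Px i)].
by case: eqP => _; rewrite ?mul1r // mul0r -(subrr (T (o0 n) (o0 n) r)); apply: PB.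
Qed.

End Generation.

End ZeroModes.

(** * The RTT relations of the first two indices from the Drinfeld relations *)

Section HalfData.
Variables (A : nzRingType) (n : nat) (D E : nat -> fps A).
Hypotheses (rE : Erel n D E) (EU : forall i, (i.+1 < n)%N -> E i 0%N = 0).

Lemma Erel_DE1 i r : (i.+1 < n)%N -> [lie D i r, E i 1%N] = (D i * E i) r.
Proof.
move=> lt_in; rewrite (relDE rE) //; last exact: ltnW.
rewrite eqxx ltn_eqF // subr0 mul1r fpsME big_ord_recr /= subnn EU // mulr0 addr0.
by apply: eq_bigr => t _; congr (_ * E i _); have := ltn_ord t; lia.
Qed.

Lemma Erel_DE_diff i r s : (i.+1 < n)%N ->
  [lie D i r.+1, E i s] - [lie D i r, E i s.+1] = D i r * E i s - (D i * E i) r *+ (s == 0)%N.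
Proof.
move=> lt_in; case: s => [|s].
  by rewrite EU // !(mulr0, mul0r) subrr !sub0r mulr1n Erel_DE1.
rewrite !(relDE rE) //; try exact: ltnW.
rewrite eqxx ltn_eqF // subr0 !mul1r big_ord_recr /= mulr0n subr0 addrAC.
rewrite -sumrB big1 ?add0r => [|t _]; first by congr (_ * E i _); lia.
by rewrite (_ : (r.+1 + s.+1 - 1 - t = r + s.+2 - 1 - t)%N) ?subrr //; lia.
Qed.

Lemma Erel_EE1 i r : (i.+1 < n)%N -> [lie E i r, E i 1%N] = - (E i * E i) r.
Proof.
move=> lt_in; case: r => [|r]; first by rewrite fpsM0E EU // !(mulr0, mul0r) subrr oppr0.
rewrite (relEE rE) // big_geq // sub0r fpsME big_ord_recl big_ord_recr /= EU //.
rewrite mul0r add0r subnn EU // mulr0 addr0 big_add1 big_mkord; congr (- _).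
by apply: eq_bigr => t _; congr (_ * E i _); rewrite /bump /=; have := ltn_ord t; lia.
Qed.

(** The product D E is an off-diagonal entry of a matrix on which E^(1) acts as a
    raising operator.  With C the series constant E^(1), the brackets
    [D, C] = D E and [E, C] = - E^2 make the two terms of [D E, C] cancel. *)
Lemma Erel_DEE i r : (i.+1 < n)%N ->
  [lie [lie D i r, E i 1%N], E i 1%N] = 0.
Proof.
move=> lt_in; rewrite Erel_DE1 //.
pose C := fpsC (E i 1%N).
have DC : D i * C - C * D i = D i * E i.
  by apply/fpsP => q; rewrite fpsBE fpsCM_l fpsCM_r Erel_DE1.
have EC : E i * C - C * E i = - (E i * E i).
  by apply/fpsP => q; rewrite fpsBE fpsCM_l fpsCM_r Erel_EE1.
have : [lie D i * E i, C] = 0.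
  by apply: (lc_eq (lc_rel 1 (E i) DC +! lc_rel (D i) 1 EC)); ncring.
by move/fpsP/(_ r); rewrite fpsBE fpsCM_l fpsCM_r.
Qed.

Lemma ErelS : Erel n.-1 (D \o S) (E \o S).
Proof.
case: rE => DD DE EE En Ef Su Sd; split=> /=.
- by move=> i j r s lt1 lt2; apply: DD; lia.
- by move=> i j r s lt1 lt2 s0; apply: (DE i.+1 j.+1); lia.
- by move=> i r s lt1 r0 s0; apply: EE => //; lia.
- by move=> i r s lt1 r0 s0; apply: En => //; lia.
- by move=> i j r s lt1 lt2 r0 s0; apply: Ef => //; lia.
- by move=> i r s t lt1 r0 s0 t0; apply: Su => //; lia.
- by move=> i r s t lt1 r0 s0 t0; apply: Sd => //; lia.
Qed.

End HalfData.

(** The clauses of [Drel] leave the constant terms of the series open. *)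
Record Ddata (A : nzRingType) n (D E F : nat -> fps A) : Prop := MkDdata {
  Ddata_rel : Drel n D E F;
  Ddata_D : forall i, (i < n)%N -> D i 0%N = 1;
  Ddata_E : forall i, (i.+1 < n)%N -> E i 0%N = 0;
  Ddata_F : forall i, (i.+1 < n)%N -> F i 0%N = 0 }.

Section Data.
Variable A : nzRingType.
Local Notation Ac := (A^c : nzRingType).

Lemma DdataS n (D E F : nat -> fps A) : Ddata n.+1 D E F ->
  Ddata n (D \o S) (E \o S) (F \o S).
Proof.
move=> [[rE rF rEF] DU EU FU]; split; [split|..].
- exact: (ErelS rE).
- exact: (ErelS rF).
- by move=> i j r s lt1 lt2 r0 s0; rewrite /= rEF // eqSS.
- by move=> i lt; apply: DU.
- by move=> i lt; apply: EU.
- by move=> i lt; apply: FU.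
Qed.

Section FirstStep.
Variables (n : nat) (D E F : nat -> fps A).
Hypothesis data : Ddata n D E F.
Hypothesis n1 : (1 < n)%N.

Let rE := DrelE (Ddata_rel data).
Let rF := DrelF (Ddata_rel data).
Let EU := Ddata_E data.
Let FU := Ddata_F data.
Let n0 : (0 < n)%N. Proof. exact: ltnW. Qed.
Let DU : D 0%N \is a GRing.unit.
Proof. by apply: fps_unit1; rewrite (Ddata_D data). Qed.

Lemma Ddata_FD1 r : [lie F 0%N 1%N, D 0%N r] = (F 0%N * D 0%N) r.
Proof.
have := Erel_DE1 rF FU r n1; rewrite fps_opM => <- //.
Qed.

Lemma Ddata_EF1 : E 0%N * fpsC (F 0%N 1%N) - fpsC (F 0%N 1%N) * E 0%N =
  1 - (D 0%N)^-1 * D 1%N.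
Proof.
have D00 := Ddata_D data n0; have D10 := Ddata_D data n1.
have V0 : (D 0%N)^-1 0%N = 1.
  have := congr1 (fun f : fps A => f 0%N) (mulVr DU).
  by rewrite /= fpsM0E D00 mulr1.
apply/fpsP => -[|r]; rewrite !fpsBE fpsCM_l fpsCM_r.
  by rewrite EU // mul0r mulr0 fpsM0E V0 D10 mulr1 fps1E !subrr.
rewrite (DrelEF (Ddata_rel data)) // eqxx mul1r fps1E sub0r -fpsNE -mulNr fpsME.
rewrite addn1; apply: eq_bigr => t _; congr (_ * D _ _); lia.
Qed.

(** The right-hand side is the entry (1, 1) of F D E.  The left-hand side is that
    of the orbit of D_0 under gl_n. *)
Lemma Ddata_corner : D 0%N - (D 0%N * E 0%N * fpsC (F 0%N 1%N)
    - fpsC (F 0%N 1%N) * (D 0%N * E 0%N)) =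
  D 1%N + F 0%N * D 0%N * E 0%N.
Proof.
have FD : fpsC (F 0%N 1%N) * D 0%N - D 0%N * fpsC (F 0%N 1%N) = F 0%N * D 0%N.
  by apply/fpsP => r; rewrite fpsBE fpsCM_l fpsCM_r Ddata_FD1.
have DV := divrr DU.
apply: (lc_eq (lc_rel 1 (E 0%N) FD +! lc_rel (- D 0%N) 1 Ddata_EF1
  +! lc_rel 1 (D 1%N) DV)).
ncring.
Qed.

Let z := zz A.
Let d := dd A.
Let zC : central z. Proof. exact: zz_central. Qed.
Let dC : central d. Proof. exact: dd_central. Qed.
Let a := lu (D 0%N).
Let a' := lv (D 0%N).
Let e := lu (E 0%N).
Let e' := lv (E 0%N).
Let f := lu (F 0%N).
Let f' := lv (F 0%N).

(** The next lemmas end in [data_rtt_E], [data_rtt_F] and [data_rtt_T], which are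
    the RTT relations between the entry (0, 0) of F D E and its entries (0, 1),
    (1, 0) and (1, 1). *)
Lemma data_DD : a * a' = a' * a.
Proof. by apply/comm2_coef => r s; apply/eqP; rewrite -subr_eq0 (relDD rE). Qed.

Lemma data_DD1 : a * lv (D 1%N) = lv (D 1%N) * a.
Proof. by apply/comm2_coef => r s; apply/eqP; rewrite -subr_eq0 (relDD rE). Qed.

Lemma data_DE : z * [lie a, e'] = d * (a * (e' - e)).
Proof.
apply: comm_of_coef => [s|r|r s].
- by rewrite (Ddata_D data) // mul1r mulr1 subrr.
- by rewrite EU // mulr0 mul0r subrr.
- rewrite (Erel_DE_diff rE EU) // mulrBr fpsBE fpsBE lumul_lv.
  by rewrite -rmorphM /= luE.
Qed.

Lemma data_DF : z * [lie a, f'] = d * ((f - f') * a).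
Proof.
apply: comm_of_coef => [s|r|r s].
- by rewrite (Ddata_D data) // mul1r mulr1 subrr.
- by rewrite FU // mulr0 mul0r subrr.
- have := Erel_DE_diff rF FU r s n1; rewrite fps_opM => H.
  rewrite mulrBl fpsBE fpsBE lvmul_lu -rmorphM /= luE.
  apply: oppr_inj; rewrite [RHS]opprB; refine (etrans _ H).
  rewrite [LHS]opprD opprK; congr (_ + _); last by rewrite opprB.
  exact: opprB.
Qed.

Lemma data_rtt_E : z * [lie a, a' * e'] = d * (a * (a' * e') - a' * (a * e)).
Proof.
by apply: (lc_eq (lc_rel a' 1 data_DE +! lc_rel (z - d) e' data_DD)); ncring.
Qed.

Lemma data_rtt_F : z * [lie a, f' * a'] = d * (f * a * a' - f' * a' * a).
Proof.
by apply: (lc_eq (lc_rel 1 a' data_DF +! lc_rel ((z - d) * f') 1 data_DD)); ncring.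
Qed.

Lemma data_rtt_T : let t' := lv (D 1%N) + f' * a' * e' in
  z * [lie a, t'] = d * (f * a * (a' * e') - f' * a' * (a * e)).
Proof.
move=> t'; rewrite /t'.
apply: (lc_eq (lc_rel z 1 data_DD1 +! lc_rel 1 (a' * e') data_DF
  +! lc_rel (f' * a') 1 data_DE +! lc_rel ((z - d) * f') e' data_DD)).
ncring.
Qed.

End FirstStep.

Lemma D0_zero_mode n (D E F : nat -> fps A) i : Ddata n D E F -> (i.+1 < n)%N ->
  [lie E i 1%N, D i.+1 1%N] = E i 1%N /\ [lie D i.+1 1%N, F i 1%N] = F i 1%N.
Proof.
move=> data lt_in; have [[rE rF _] DU _ _] := data.
have ne : (i.+1 == i) = false by lia.
split; rewrite lie_opp.
  rewrite (relDE rE) // ne eqxx sub0r mulN1r opprK big_ord1 DU // mul1r.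
  by congr (E i _).
have := relDE rF 1%N lt_in lt_in (isT : 0 < 1)%N.
rewrite ne eqxx sub0r big_ord1 => H.
rewrite -[RHS]opprK; congr (- _); rewrite [LHS]H DU // !mulN1r mul1r.
by congr (- F i _).
Qed.

(** * An RTT matrix with given coordinates *)

(** An equivariant matrix is determined by its entry (0, 0) and the zero modes.
    The first row, the first column and the entry (1, 1) are brackets of D_0 with
    E_0^(1) and F_0^(1); this identifies D_0, E_0, F_0 and shows that the Schur
    complement starts with D_1. *)
Lemma coords_of_data n (T : 'M[fps A]_n) D E F : unital T -> rtt (zz A) T ->
  Ddata n D E F -> (forall i : 'I_n, i = 0%N :> nat -> T i i = D 0%N) ->
  (forall i j : 'I_n, j = i.+1 :> nat -> T i j 1%N = E i 1%N /\ T j i 1%N = F i 1%N) ->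
  coords T D E F.
Proof.
elim: n T D E F => [|n IHn] T D E F T0 rT data TD TEF //.
have D0 : T (o0 n) (o0 n) = D 0%N by exact: TD.
have rE := DrelE (Ddata_rel data); have rF := DrelF (Ddata_rel data).
have Tx := rtt_equivariant T0 rT; rewrite /equivariant in Tx.
have row (k : 'I_n) : k = 0%N :> nat ->
    T (o0 n) (rs k) = D 0%N * E 0%N /\ T (rs k) (o0 n) = F 0%N * D 0%N.
  move=> k0; have n0 : (0 < n)%N by case: (n) k {k0} => // -[].
  have [E1 F1] := TEF (o0 n) (rs k) (congr1 S k0).
  split; apply/fpsP => r.
    have := Tx r (o0 n) (o0 n) (o0 n) (rs k).
    rewrite eqxx mul1r mul0r subr0 => <-; rewrite E1 D0.
    exact: (Erel_DE1 rE (Ddata_E data)).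
  have := Tx r (o0 n) (o0 n) (rs k) (o0 n); rewrite eqxx mul1r mul0r sub0r => H.
  rewrite -[LHS]opprK -H opprB F1 D0; exact: (Ddata_FD1 data).
apply/coordsS; split=> //; apply: IHn (DdataS data) _ _.
- exact: unital_schur.
- exact: rtt_schur.
- move=> k k0; have n0 : (0 < n)%N by case: (n) k {k0} => // -[].
  have [TE TF] := row k k0; have [E1 F1] := TEF (o0 n) (rs k) (congr1 S k0).
  have T11 : T (rs k) (rs k) = D 1%N + F 0%N * D 0%N * E 0%N.
    rewrite -(Ddata_corner data n0); apply/fpsP => r.
    have := Tx r (o0 n) (rs k) (rs k) (o0 n); rewrite !eqxx !mul1r TE F1 => H.
    rewrite !fpsBE fpsCM_l fpsCM_r H D0 subKr //.
  have DU : D 0%N \is a GRing.unit by apply: fps_unit1; rewrite (Ddata_D data).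
  rewrite schur_entry T11 D0 TE TF mulrK // mulrA addrK //.
- move=> i j ij; rewrite !schur1 //; exact: (TEF (rs i) (rs j) (congr1 S ij)).
Qed.

End Data.

Lemma rs_neq0 n (i : 'I_(1 + n)) : i != o0 n -> exists k, i = rs k.
Proof. by elim/ord_rs_ind: i => [|k]; [rewrite eqxx|exists k]. Qed.

(** The two Serre relations of E_0^(1) and E_1^(1) are those of [gl_row], after
    division by 2. *)
Lemma gl_row_of_data (B : nzRingType) m (D E : nat -> fps B)
    (x : 'I_(1 + (1 + m)) -> 'I_(1 + (1 + m)) -> B) :
  (forall b : B, b + b = 0 -> b = 0) -> Erel m.+2 D E -> D 0%N 0%N = 1 ->
  let o := o0 (1 + m) in let i1 := rs (o0 m) in
  x o o = D 0%N 1%N -> x o i1 = E 0%N 1%N ->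
  (forall j, x o (rs j) = [lie E 0%N 1%N, x i1 (rs j)]) ->
  (forall h k, h != o0 m -> [lie E 0%N 1%N, x (rs h) (rs k)] = 0) ->
  (forall k : 'I_m, k = 0%N :> nat -> x i1 (rs (rs k)) = E 1%N 1%N) ->
  gl_row o i1 x.
Proof.
move=> two rE D00 o i1 xoo xo1 xoj xhk x1w; split; rewrite ?xo1.
- by move=> j jo; have [k ->] := rs_neq0 jo.
- move=> h k ho ko h1; move: h1; have [h' ->] := rs_neq0 ho; have [k' ->] := rs_neq0 ko => h1; apply: xhk.
  by apply: contraNneq h1 => ->.
- rewrite xoo lie_opp (relDE rE) // eqxx subr0 mul1r big_ord1 D00 mul1r.
  by congr (- E _ _).
- have [m0|m0] := posnP m.
    left=> j jo; have [k ->] := rs_neq0 jo; apply: val_inj => /=.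
    by have := ltn_ord k; lia.
  right; exists (rs (rs (Ordinal m0))); split => //; rewrite x1w //.
    apply: two; have lt1 : (0 < 1)%N by [].
    have := relSerre_down rE (i := 0%N) m0 lt1 lt1 lt1.
    by rewrite /serre => <-; congr (_ + _); ncring.
  apply: two; exact: (relSerre_up rE (i := 0%N)).
Qed.

(** The orbits of 1 and of x_oo are the matrices of constant terms and of zero
    modes. *)
Lemma orbit1 (A : nzRingType) (I : eqType) (o : I) (x : I -> I -> A) i j :
  gl_orbit o x 1 i j = (i == j)%:R.
Proof.
rewrite /gl_orbit !mul1r !mulr1 !subrr mul0r mulr0 subrr subr0.
case: (eqVneq i o) => [->|io]; case: (eqVneq j o) => [jo|jo] //.
by rewrite jo (negPf io).
Qed.

Lemma orbit_zero_mode (A : nzRingType) (I : eqType) (o : I) (x : I -> I -> A) i j :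
  gl_on predT x -> gl_orbit o x (x o o) i j = x i j.
Proof.
move=> gx; have g a b c d := @gx a b c d isT isT isT isT.
have neo k : k != o -> (o == k) = false by rewrite eq_sym => /negPf.
rewrite /gl_orbit; case: (eqVneq i o) => [->|io]; case: (eqVneq j o) => [->|jo] //.
- by rewrite g eqxx (neo _ jo) mul1r mul0r subr0.
- by rewrite g eqxx (negPf io) mul1r mul0r subr0.
- by rewrite !g eqxx (neo _ jo) mul1r mul0r subr0 g eqxx mul1r subKr.
Qed.

Section Existence.
Variable A : nzRingType.
Hypothesis two_reg : forall x : A, x + x = 0 -> x = 0.

Section Step.
Variables (m : nat) (D E F : nat -> fps A) (T' : 'M[fps A]_(1 + m)).
Hypothesis data : Ddata m.+2 D E F.
Hypotheses (T'0 : unital T') (rT' : rtt (zz A) T')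
  (cT' : coords T' (D \o S) (E \o S) (F \o S)).
Local Notation I := 'I_(1 + (1 + m)).
Local Notation Ac := (A^c : nzRingType).

Let o : I := o0 (1 + m).
Let i1 : I := rs (o0 m).
Let E1 := E 0%N 1%N.
Let F1 := F 0%N 1%N.
Let rE := DrelE (Ddata_rel data).
Let rF := DrelF (Ddata_rel data).
Let rEF := DrelEF (Ddata_rel data).

(** The zero modes of the matrix to be constructed.  As E_0^(1) and F_0^(1) must
    be the entries (0, 1) and (1, 0), the rest of the first row and column is
    given by their brackets with the zero modes of T'. *)
Definition ext_modes : 'M[A]_(1 + (1 + m)) :=
  block_mx (const_mx (D 0%N 1%N)) (\row_j [lie E1, T' (o0 m) j 1%N])
           (\col_i [lie T' i (o0 m) 1%N, F1]) (\matrix_(i, j) T' i j 1%N).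
Local Notation x := (fun i j => ext_modes i j).

Let xoo : ext_modes o o = D 0%N 1%N.
Proof. by rewrite block_mxEul mxE. Qed.
Let xoj j : ext_modes o (rs j) = [lie E1, T' (o0 m) j 1%N].
Proof. by rewrite block_mxEur mxE. Qed.
Let xio i : ext_modes (rs i) o = [lie T' i (o0 m) 1%N, F1].
Proof. by rewrite block_mxEdl mxE. Qed.
Let xij i j : ext_modes (rs i) (rs j) = T' i j 1%N.
Proof. by rewrite block_mxEdr mxE. Qed.

Let comm_T' (c : A) :
  (forall i r, (i < m.+1)%N -> c * D i.+1 r = D i.+1 r * c) ->
  (forall i r, (i.+1 < m.+1)%N -> c * E i.+1 r = E i.+1 r * c) ->
  (forall i r, (i.+1 < m.+1)%N -> c * F i.+1 r = F i.+1 r * c) ->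
  forall i j r, c * T' i j r = T' i j r * c.
Proof.
move=> cD cE cF; apply: (rtt_gen (P := fun b => c * b = b * c)) T'0 rT' cT' cD cE cF => a b ca cb.
  by rewrite mulrBr mulrBl ca cb.
by rewrite mulrA ca -mulrA cb mulrA.
Qed.

Let comm_T'' (c : A) :
  (forall i r, (i < m)%N -> c * D i.+2 r = D i.+2 r * c) ->
  (forall i r, (i.+1 < m)%N -> c * E i.+2 r = E i.+2 r * c) ->
  (forall i r, (i.+1 < m)%N -> c * F i.+2 r = F i.+2 r * c) ->
  forall i j, c * T' (rs i) (rs j) 1%N = T' (rs i) (rs j) 1%N * c.
Proof.
move=> cD cE cF i j; rewrite -schur1 //.
have [_ _ ct] := (coordsS _ _ _ _).1 cT'.
apply: (rtt_gen (P := fun b => c * b = b * c)) (unital_schur T'0) (rtt_schur T'0 rT') ct cD cE cF _ _ _ => a b ca cb.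
  by rewrite mulrBr mulrBl ca cb.
by rewrite mulrA ca -mulrA cb mulrA.
Qed.

Let lie0 (a b : A) : [lie a, b] = 0 -> a * b = b * a.
Proof. by move/eqP; rewrite subr_eq0 => /eqP. Qed.

Let D0T' r i j s : D 0%N r * T' i j s = T' i j s * D 0%N r.
Proof.
apply: comm_T' => {}i q lt_i; apply: lie0.
- exact: (relDD rE).
- by case: q => [|q]; rewrite ?(Ddata_E data) ?mulr0 ?mul0r ?subrr // (relDE rE) // subrr mul0r.
- rewrite lie_opp; case: q => [|q]; first by rewrite (Ddata_F data) ?mulr0 ?mul0r ?subrr ?oppr0.
  by rewrite [X in - X](relDE rF (i := 0%N) (j := i.+1)) // subrr mul0r oppr0.
Qed.

Let E1T'' i j : E1 * T' (rs i) (rs j) 1%N = T' (rs i) (rs j) 1%N * E1.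
Proof.
apply: comm_T'' => {}i q lt_i; apply: lie0.
- by rewrite lie_opp (relDE rE) // subrr mul0r oppr0.
- by case: q => [|q]; rewrite ?(Ddata_E data) ?mulr0 ?mul0r ?subrr // (relEE_far rE).
- by case: q => [|q]; rewrite ?(Ddata_F data) ?mulr0 ?mul0r ?subrr // rEF // mul0r.
Qed.

Let F1T'' i j : F1 * T' (rs i) (rs j) 1%N = T' (rs i) (rs j) 1%N * F1.
Proof.
apply: comm_T'' => {}i q lt_i; apply: lie0.
- by have := relDE rF (i := i.+2) (j := 0%N) q (s := 1%N) lt_i isT isT; rewrite subrr mul0r.
- rewrite lie_opp; case: q => [|q]; first by rewrite (Ddata_E data) ?mulr0 ?mul0r ?subrr ?oppr0.
  by rewrite rEF // mul0r oppr0.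
- rewrite lie_opp; case: q => [|q]; first by rewrite (Ddata_F data) ?mulr0 ?mul0r ?subrr ?oppr0.
  by rewrite [X in - X](relEE_far rF (i := 0%N) (j := i.+2)) // oppr0.
Qed.

Let gx' : gl_on predT (fun i j => T' i j 1%N).
Proof. exact: gl_zero_modes. Qed.

Let T'oo : T' (o0 m) (o0 m) 1%N = D 1%N 1%N.
Proof. by have [-> _ _] := (coordsS _ _ _ _).1 cT'. Qed.

Let xoi1 : ext_modes o i1 = E1.
Proof. by rewrite xoj T'oo; have [] := D0_zero_mode data (isT : (1 < m.+2)%N). Qed.
Let xi1o : ext_modes i1 o = F1.
Proof. by rewrite xio T'oo; have [] := D0_zero_mode data (isT : (1 < m.+2)%N). Qed.

Let first_modes (k : 'I_m) : k = 0%N :> nat ->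
  T' (o0 m) (rs k) 1%N = E 1%N 1%N /\ T' (rs k) (o0 m) 1%N = F 1%N 1%N.
Proof. exact: (coords_row1 T'0 cT'). Qed.

Let neo (i : 'I_(1 + m)) : rs i != o. Proof. by rewrite /o -val_eqE. Qed.

Let E1T' i j : i != o0 m -> E1 * T' i j 1%N = T' i j 1%N * E1.
Proof.
elim/ord_rs_ind: i => [|i]; first by rewrite eqxx.
elim/ord_rs_ind: j => [|j] _; last exact: E1T''.
have m0 : (0 < m)%N by case: (m) i => // -[].
have [_ Fk] := first_modes (erefl : Ordinal m0 = 0%N :> nat).
have := @gx' (rs i) (rs (Ordinal m0)) (rs (Ordinal m0)) (o0 m) isT isT isT isT.
rewrite eqxx mul1r mul0r subr0 => <-; rewrite Fk; apply: lie0.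
rewrite lie_jacobi_r E1T'' subrr mul0r mulr0 subrr add0r.
by rewrite rEF // !(mul0r, mulr0) subrr.
Qed.

Let F1T' i j : j != o0 m -> F1 * T' i j 1%N = T' i j 1%N * F1.
Proof.
elim/ord_rs_ind: j => [|j]; first by rewrite eqxx.
elim/ord_rs_ind: i => [|i] _; last exact: F1T''.
have m0 : (0 < m)%N by case: (m) j => // -[].
have [Ek _] := first_modes (erefl : Ordinal m0 = 0%N :> nat).
have := @gx' (o0 m) (rs (Ordinal m0)) (rs (Ordinal m0)) (rs j) isT isT isT isT.
rewrite eqxx mul1r mul0r subr0 => <-; rewrite Ek; apply: lie0.
rewrite lie_jacobi_r F1T'' subrr mulr0 mul0r subrr addr0.
by rewrite (lie_opp F1) rEF // mul0r oppr0 !(mul0r, mulr0) subrr.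
Qed.

Lemma ext_modes_gl : gl_on predT x.
Proof.
have data0 : (1 < m.+2)%N by [].
have D00 := Ddata_D data (isT : 0 < m.+2)%N; have D10 := Ddata_D data data0.
apply: (@gl_extend I o i1 (neo _) A x two_reg).
- move=> i j h k io jo ho ko; have [i' ->] := rs_neq0 io; have [j' ->] := rs_neq0 jo.
  have [h' ->] := rs_neq0 ho; have [k' ->] := rs_neq0 ko.
  by rewrite !xij; exact: gx'.
- by move=> h k ho ko; have [h' ->] := rs_neq0 ho; have [k' ->] := rs_neq0 ko; rewrite xoo xij D0T' subrr.
- apply: (gl_row_of_data two_reg rE) => //.
  + by move=> j; rewrite xoj xij.
  + by move=> h k h1; rewrite xij E1T' // subrr.
  + by move=> k k0; rewrite xij; case: (first_modes k0).
- apply: (@gl_row_of_data Ac m D F _ two_reg rF) => //.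
  + by move=> j; rewrite xio xij.
  + by move=> h k h1; rewrite xij; exact: (comm_lie (esym (F1T' k h1))).
  + by move=> k k0; rewrite xij; case: (first_modes k0).
- rewrite xoi1 xi1o xoo xij T'oo.
  have /fpsP/(_ 1%N) := Ddata_EF1 data data0; rewrite !fpsBE fpsCM_l fpsCM_r => ->.
  have DU : D 0%N \is a GRing.unit by apply: fps_unit1.
  have V0 : (D 0%N)^-1 0%N = 1.
    have := congr1 (fun f : fps A => f 0%N) (mulVr DU).
    by rewrite /= fpsM0E D00 mulr1.
  have := congr1 (fun f : fps A => f 1%N) (mulVr DU).
  rewrite /= !fpsM1E V0 D00 D10 !mul1r !mulr1 fps1E /= => /eqP.
  by rewrite addr_eq0 => /eqP->; rewrite sub0r opprD addrC.
Qed.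

Definition ext_matrix : 'M[fps A]_(1 + (1 + m)) :=
  \matrix_(i, j) ((fun r => gl_orbit o x (D 0%N r) i j) : fps A).

Let gx := ext_modes_gl.
Local Notation T := ext_matrix.

Lemma ext_matrixE i j r : T i j r = gl_orbit o x (D 0%N r) i j.
Proof. by rewrite mxE. Qed.

Lemma ext_equivariant r : equivariant x (fun i j => T i j r).
Proof.
move=> i j h k; rewrite !ext_matrixE; apply: (orbit_equivariant two_reg gx).
- by rewrite xoo (relDD rE).
- by move=> {}h {}k ho ko; have [h' ->] := rs_neq0 ho; have [k' ->] := rs_neq0 ko; rewrite xij D0T' subrr.
- right; exists i1; split; rewrite ?xoi1 ?xi1o.
  + exact: neo.
  + exact: (Erel_DEE rE (Ddata_E data)).
  + exact: (Erel_DEE rF (Ddata_F data)).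
Qed.

Lemma ext_unital : unital T.
Proof. by move=> i j; rewrite ext_matrixE (Ddata_D data) // orbit1. Qed.

Lemma ext_zero_modes i j : T i j 1%N = ext_modes i j.
Proof. by rewrite ext_matrixE -xoo orbit_zero_mode. Qed.

Let Too : T o o = D 0%N.
Proof. by apply/fpsP => r; rewrite ext_matrixE /gl_orbit eqxx. Qed.
Let To1 : T o i1 = D 0%N * E 0%N.
Proof.
apply/fpsP => r; rewrite ext_matrixE /gl_orbit eqxx (negPf (neo _)) xoi1.
exact: (Erel_DE1 rE (Ddata_E data)).
Qed.
Let T1o : T i1 o = F 0%N * D 0%N.
Proof.
apply/fpsP => r; rewrite ext_matrixE /gl_orbit eqxx (negPf (neo _)) xi1o.
exact: (Ddata_FD1 data).
Qed.
Let T11 : T i1 i1 = D 1%N + F 0%N * D 0%N * E 0%N.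
Proof.
rewrite -(Ddata_corner data isT); apply/fpsP => r.
have := ext_equivariant r o i1 i1 o; rewrite /= ?eqxx !mul1r xi1o To1 Too => H.
by rewrite !fpsBE fpsCM_l fpsCM_r H subKr.
Qed.

Lemma ext_rtt : rtt (zz A) T.
Proof.
apply/(rtt_coefP ext_unital) => i j h k r s; apply/eqP; rewrite -subr_eq0; apply/eqP.
have base h' k' (W := lu (T h' o) * lv (T o k') - lv (T h' o) * lu (T o k')) :
    zz A * [lie lu (T o o), lv (T h' k')] = dd A * W ->
    defect (fun i j r => T i j r) o o h' k' r s = 0.
  move=> /coef_comm/(_ r s); rewrite /defect => ->.
  by rewrite /W fpsBE fpsBE lumul_lv lvmul_lu subrr.
apply: (@defect_zero A I x (fun i j r => T i j r) ext_equivariant o r s).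
  by apply: base; rewrite !Too (data_DD data) // !subrr !mulr0.
right; exists i1; split; [exact: neo| | |]; apply: base; rewrite ?T11 ?To1 ?T1o ?Too.
- by have := data_rtt_E data (isT : 1 < m.+2)%N; rewrite !rmorphM.
- by have := data_rtt_F data (isT : 1 < m.+2)%N; rewrite !rmorphM.
- by have := data_rtt_T data (isT : 1 < m.+2)%N; rewrite !(rmorphD, rmorphM).
Qed.

Lemma ext_coords : coords T D E F.
Proof.
apply: (coords_of_data ext_unital ext_rtt data) => [i i0|].
  by rewrite -Too; congr (T _ _); apply: val_inj.
elim/ord_rs_ind => [|i]; elim/ord_rs_ind => [|j] //= ij; rewrite !ext_zero_modes.
  have -> : rs j = i1 by apply: val_inj; rewrite /= ij.
  by rewrite xoi1 xi1o.
rewrite !xij; apply: (coords_zero_modes T'0 cT'); by case: ij.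
Qed.

End Step.

(** Induction on n: T' is the matrix of the coordinates of index at least 1, and
    T is the orbit of D_0 under the extended zero modes. *)
Theorem matrix_of_data n D E F : Ddata n D E F ->
  exists T : 'M[fps A]_n, [/\ unital T, rtt (zz A) T & coords T D E F].
Proof.
elim: n D E F => [|[|m] IHn] D E F data.
- by exists 0; split=> //; case.
- have D00 := Ddata_D data (isT : 0 < 1)%N.
  exists (const_mx (D 0%N)); split.
  + by move=> i j; rewrite mxE D00 !ord1 eqxx.
  + move=> i j h k; rewrite !mxE.
    have /comm2_coef -> : forall r s, D 0%N r * D 0%N s = D 0%N s * D 0%N r.
      move=> r s; apply/eqP; rewrite -subr_eq0.
      by rewrite (relDD (DrelE (Ddata_rel data))).
    by rewrite !subrr !mulr0.
  + by apply/coordsS; split; rewrite ?mxE //; case.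
- have [T' [T'0 rT' cT']] := IHn _ _ _ (DdataS data).
  exists (ext_matrix D E F T'); split.
  + exact: (ext_unital T' data).
  + exact: (ext_rtt data T'0 rT' cT').
  + exact: (ext_coords data T'0 rT' cT').
Qed.

End Existence.

(** * Gauss factorizations and coordinates *)

Section GaussCoords.
Variable A : nzRingType.

Lemma gauss_coords n (T F D E : 'M[fps A]_n) (cD cE cF : nat -> fps A) : unital T ->
  gauss_factorization T F D E -> (forall i : 'I_n, cD i = D i i) ->
  (forall i j : 'I_n, j = i.+1 :> nat -> cE i = E i j /\ cF i = F j i) ->
  coords T cD cE cF.
Proof.
elim: n T F D E cD cE cF => [|n IHn] T F D E cD cE cF T0 //.
move=> /(gauss_step T0)[F' [D' [E' [gS -> -> ->]]]].
change (n.+1) with (1 + n)%N => eD eEF.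
have D0 : cD 0%N = T (o0 n) (o0 n).
  by rewrite -[cD 0%N]/(cD (o0 n : 'I_(1 + n))) eD block_mxEul !mxE.
have aU : T (o0 n) (o0 n) \is a GRing.unit by apply: fps_unit1; rewrite T0 eqxx.
apply/coordsS; split=> //.
  move=> k k0; have [] := eEF (o0 n) (rs k) (congr1 S k0).
  rewrite block_mxEur block_mxEdl !mxE !big_ord1 !mxE eqxx mulr1n => -> ->.
  by rewrite D0 mulVKr // divrK.
apply: IHn gS _ _; first exact: unital_schur.
  by move=> i; have := eD (rs i); rewrite block_mxEdr.
move=> i j ij; have [] := eEF (rs i) (rs j) (congr1 S ij).
by rewrite !block_mxEdr.
Qed.

Lemma coords_unique n (T : 'M[fps A]_n) D E F D2 E2 F2 : unital T ->
  coords T D E F -> coords T D2 E2 F2 ->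
  [/\ forall i, (i < n)%N -> D i = D2 i, forall i, (i.+1 < n)%N -> E i = E2 i
    & forall i, (i.+1 < n)%N -> F i = F2 i].
Proof.
elim: n T D E F D2 E2 F2 => [|n IHn] T D E F D2 E2 F2 T0; first by split.
move=> /coordsS[D0 EF /IHn h] /coordsS[D20 EF2 /(h _ _ _ (unital_schur T0))[hD hE hF]].
have DD : D 0%N = D2 0%N by rewrite -D0.
have DU : D 0%N \is a GRing.unit by apply: fps_unit1; rewrite -D0 T0 eqxx.
split=> -[|i] lt_in; [exact: DD|exact: hD| |exact: hE| |exact: hF].
  have [+ _] := EF (@Ordinal n 0 lt_in) erefl; have [-> _] := EF2 (@Ordinal n 0 lt_in) erefl.
  by rewrite -DD => /(mulrI DU).
have [_ +] := EF (@Ordinal n 0 lt_in) erefl; have [_ ->] := EF2 (@Ordinal n 0 lt_in) erefl.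
by rewrite -DD => /(mulIr DU).
Qed.

Lemma gauss_map (B : nzRingType) (phi : {rmorphism fps A -> fps B}) n (T F D E : 'M[fps A]_n) :
  gauss_factorization T F D E ->
  gauss_factorization (map_mx phi T) (map_mx phi F) (map_mx phi D) (map_mx phi E).
Proof.
move=> [-> [Ft F1] Dd [Et E1]]; split.
- by rewrite !map_mxM.
- split=> [|i]; last by rewrite mxE F1 rmorph1.
  by apply/is_trig_mxP => i j ij; rewrite mxE (is_trig_mxP Ft) // rmorph0.
- by apply/is_diag_mxP => i j ij; rewrite mxE (is_diag_mxP Dd) // rmorph0.
- split=> [|i]; last by rewrite mxE E1 rmorph1.
  apply/is_trig_mxP => i j ij; rewrite !mxE.
  by have := is_trig_mxP Et i j ij; rewrite mxE => ->; rewrite rmorph0.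
Qed.

End GaussCoords.

(** * The RTT relation of the Yangian *)

Section SumForm.
Variable A : nzRingType.
Implicit Types a b p q : nat -> A.

Definition rtt_sum a b r s := \sum_(t < minn r s)
  (a (r + s - 1 - t)%N * b t - a t * b (r + s - 1 - t)%N).

(** The bracket [T^(r), T^(s)] is a sum over t < min(r, s) in which r + s is
    constant, except for its range; the difference of neighbouring sums is a
    single term.  Together with the value 0 at r = 0 these differences
    determine the bracket, see [rtt_sum_unique]. *)
Lemma rtt_sum_diff a b r s :
  rtt_sum a b r.+1 s - rtt_sum a b r s.+1 = a s * b r - a r * b s.
Proof.
pose g t := a (r + s - t)%N * b t - a t * b (r + s - t)%N.
have E1 : rtt_sum a b r.+1 s = \sum_(t < minn r.+1 s) g t.
  by apply: eq_bigr => t _; rewrite /g; congr (a _ * _ - _ * b _); lia.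
have E2 : rtt_sum a b r s.+1 = \sum_(t < minn r s.+1) g t.
  by apply: eq_bigr => t _; rewrite /g; congr (a _ * _ - _ * b _); lia.
rewrite E1 E2; have [rs|sr|rs] := ltngtP r s.
- have -> : minn r.+1 s = r.+1 by apply/minn_idPl.
  have -> : minn r s.+1 = r by apply/minn_idPl; exact: leqW (ltnW rs).
  by rewrite big_ord_recr /= addrAC subrr add0r /g addKn.
- have -> : minn r.+1 s = s by apply/minn_idPr; exact: leqW (ltnW sr).
  have -> : minn r s.+1 = s.+1 by apply/minn_idPr.
  by rewrite big_ord_recr /= opprD addrA subrr sub0r /g addnK opprB.
- by rewrite rs (minn_idPr (leqnSn s)) (minn_idPl (leqnSn s)) !subrr.
Qed.

Lemma rtt_sum_unique a b p q :
  (forall s, [lie p 0%N, q s] = 0) ->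
  (forall r s, [lie p r.+1, q s] - [lie p r, q s.+1] = a s * b r - a r * b s) ->
  forall r s, [lie p r, q s] = rtt_sum a b r s.
Proof.
move=> pq0 pq; elim=> [|r IHr] s.
  by rewrite pq0 /rtt_sum min0n big_ord0.
move/eqP: (pq r s); rewrite subr_eq => /eqP->.
by rewrite -rtt_sum_diff IHr subrK.
Qed.

End SumForm.

Section YangianRTT.
Variables (K : comNzRingType) (n : nat).
Local Notation Y := (Yangian K n).

Lemma yangian_pi_fT (i j : 'I_n) r : yangian_pi (fT K i j r) = yangianT K i j r.
Proof. by case: r => //=; rewrite rmorph_nat. Qed.

Lemma yangian_mx_unital : unital (yangian_mx K n).
Proof. by move=> i j; rewrite mxE. Qed.

Lemma yangianT_lie (i j h k : 'I_n) r s :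
  [lie yangianT K i j r, yangianT K h k s]
  = rtt_sum (yangianT K i k) (yangianT K h j) r s.
Proof.
have /(ideal_gen_rel)/quot_piP := Yangian_rel K i j h k r s.
rewrite -/(yangian_pi _) -/(yangian_pi _) rmorphB !rmorphM /= !yangian_pi_fT => ->.
rewrite rmorph_sum; apply: eq_bigr => t _.
by rewrite rmorphB !rmorphM /= !yangian_pi_fT.
Qed.

Lemma yangian_mx_rtt : rtt (zz Y) (yangian_mx K n).
Proof.
apply/(rtt_coefP yangian_mx_unital) => i j h k r s; rewrite !mxE.
have := rtt_sum_diff (yangianT K h j) (yangianT K i k) s r.
rewrite -!yangianT_lie => <-.
by ncring.
Qed.

End YangianRTT.

(** * Morphisms out of the Yangian *)

Section Lift.
Variables (K : comNzRingType) (n : nat) (B : algType K).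
Local Notation Y := (Yangian K n).

Definition respects_rtt (x : Ygen n -> B) :=
  forall p q, yangian_rel p q -> feval x p = feval x q.

(** The universal property of the quotient, with an explicit underlying function
    that can carry the structure of an algebra morphism. *)
Definition yangian_lift (x : Ygen n -> B) of respects_rtt x := fun y : Y =>
  feval x (repr (y : quot_alg (@yangian_rel K n))).

Section LiftMorphism.
Variables (x : Ygen n -> B) (xR : respects_rtt x).

Lemma yangian_lift_pi p : yangian_lift xR (yangian_pi p) = feval x p.
Proof.
apply/eqP; rewrite -subr_eq0 -rmorphB; apply/eqP.
apply: (ideal_gen_ker (f := feval x) xR).
by apply/quot_piP; rewrite /yangian_pi /quot_pi reprK.
Qed.

Lemma yangian_pi_surj (y : Y) : exists p, y = yangian_pi p.
Proof. by have [p] := quot_pi_surj y; exists p. Qed.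

Fact yangian_lift_zmod : zmod_morphism (yangian_lift xR).
Proof.
move=> y z; have [p ->] := yangian_pi_surj y; have [q ->] := yangian_pi_surj z.
by rewrite -rmorphB !yangian_lift_pi rmorphB.
Qed.

Fact yangian_lift_monoid : monoid_morphism (yangian_lift xR).
Proof.
split=> [|y z].
  by have := yangian_lift_pi 1; rewrite !rmorph1.
have [p ->] := yangian_pi_surj y; have [q ->] := yangian_pi_surj z.
by rewrite -rmorphM !yangian_lift_pi rmorphM.
Qed.

Fact yangian_lift_scalable : scalable (yangian_lift xR).
Proof.
move=> k y; have [p ->] := yangian_pi_surj y.
by rewrite -linearZ !yangian_lift_pi linearZ.
Qed.

HB.instance Definition _ := GRing.isZmodMorphism.Build Y B (yangian_lift xR) yangian_lift_zmod.
HB.instance Definition _ := GRing.isMonoidMorphism.Build Y B (yangian_lift xR) yangian_lift_monoid.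
HB.instance Definition _ := GRing.isScalable.Build K Y B _ (yangian_lift xR) yangian_lift_scalable.

End LiftMorphism.

Definition mx_gens (T : 'M[fps B]_n) (g : Ygen n) : B := T g.1.1 g.1.2 g.2.+1.

Lemma feval_fT (T : 'M[fps B]_n) i j r : unital T -> feval (mx_gens T) (fT K i j r) = T i j r.
Proof.
move=> T0; case: r => [|r] /=; last exact: feval_gen.
by rewrite T0 rmorph_nat.
Qed.

Lemma rtt_respects (T : 'M[fps B]_n) : unital T -> rtt (zz B) T -> respects_rtt (mx_gens T).
Proof.
move=> T0 rT _ _ [i j h k r s].
pose ev : {rmorphism free_alg K (Ygen n) -> B} := feval (mx_gens T).
have evT a b q : ev (fT K a b q) = T a b q by exact: feval_fT.
rewrite -[feval _ _]/(ev _) -[in RHS]/(ev _) rmorphB !rmorphM !evT rmorph_sum.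
have /(rtt_coefP T0) rTc := rT.
rewrite (@rtt_sum_unique B (T i k) (T h j) (T i j) (T h k)) => [|q|q1 q2].
- by apply: eq_bigr => t _; rewrite rmorphB !rmorphM !evT.
- by rewrite T0 natr_central subrr.
- have := rTc h k i j q2 q1 => H.
  by apply: (lc_eq (lc_rel 1 1 H)); ncring.
Qed.

End Lift.

(** * The Drinfeld relations in an algebra *)

(** Extension of a family over an ordinal type to nat by a default value, as
    required for [coords]. *)
Definition fam (B : Type) (n : nat) (b : B) (f : 'I_n -> B) (i : nat) : B :=
  if insub i is Some j then f j else b.

Lemma fam_ord (B : Type) n (b : B) (f : 'I_n -> B) (i : 'I_n) : fam b f i = f i.
Proof. by rewrite /fam insubT // => lt_in; congr f; apply: val_inj. Qed.

Lemma op_serre (B : nzRingType) (a b c : B) : serre a b c = @serre (B^c) a b c.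
Proof.
rewrite -[RHS]/((c * b - b * c) * a - a * (c * b - b * c)
  + ((c * a - a * c) * b - b * (c * a - a * c))) /serre.
ncring.
Qed.

Section DrinfeldEval.
Variables (K : comNzRingType) (n : nat) (B : algType K).
Variables (D : nat -> fps B) (E F : nat -> fps B).
Variable x : Drinfeld_gen n -> B.
Hypothesis xD : forall i r, x (Dgen i r) = D i r.
Hypothesis xDt : forall i r, x (Dtgen i r) = (- (D i)^-1) r.
Hypothesis xE : forall i r, x (Egen i r) = E i r.+1.
Hypothesis xF : forall i r, x (Fgen i r) = F i r.+1.

Let ev : {rmorphism free_alg K (Drinfeld_gen n) -> B} := feval x.
Let evD i r : ev (fD K i r) = D i r. Proof. by rewrite -xD; exact: feval_gen. Qed.
Let evDt i r : ev (fDt K i r) = (- (D i)^-1) r. Proof. by rewrite -xDt; exact: feval_gen. Qed.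
Let evE (i : 'I_n.-1) r : (0 < r)%N -> ev (fE K i r) = E i r.
Proof. by case: r => // r _; rewrite -xE; exact: feval_gen. Qed.
Let evF (i : 'I_n.-1) r : (0 < r)%N -> ev (fF K i r) = F i r.
Proof. by case: r => // r _; rewrite -xF; exact: feval_gen. Qed.

Let lt_next (j : 'I_n.-1) : (j.+1 < n)%N. Proof. by have := ltn_ord j; lia. Qed.

(** Evaluated at the coefficients of D, E and F, the relations become the clauses
    of [Drel]; those for F are read over the opposite algebra, which reverses
    products and changes the sign of brackets. *)
Lemma Ddata_respects p q : Ddata n D E F -> Drinfeld_rel p q -> feval x p = feval x q.
Proof.
move=> [[rE rF rEF] DU EU FU] pq; rewrite -[feval x p]/(ev p) -[feval x q]/(ev q).
case: pq => {p q}.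
- by move=> i; rewrite evD DU // rmorph1.
- move=> i r; rewrite rmorph_sum rmorphN rmorph_nat.
  have dU : D i \is a GRing.unit by apply: fps_unit1; rewrite DU.
  transitivity ((D i * - (D i)^-1) r); last by rewrite mulrN divrr.
  by apply: eq_bigr => t _; rewrite rmorphM evD evDt.
- by move=> i j r s; rewrite rmorphB !rmorphM !evD rmorph0 (relDD rE).
- move=> i j r s r0 s0; rewrite rmorphB !rmorphM rmorph_nat rmorph_sum evE // evF //.
  rewrite rEF //; congr (_ * _); apply: eq_bigr => t _.
  by rewrite rmorphM evD evDt.
- move=> i j r s s0; rewrite !(rmorphB, rmorphM, rmorph_nat) rmorph_sum evD evE //.
  rewrite (relDE rE) // -!val_eqE /=; congr (_ * _); apply: eq_bigr => t _.
  by rewrite rmorphM evD evE //; have := ltn_ord t; lia.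
- move=> i j r s s0; rewrite !(rmorphB, rmorphM, rmorph_nat) rmorph_sum evD evF //.
  rewrite lie_opp [X in - X](relDE rF r (ltn_ord i) (lt_next j) s0).
  rewrite mulrBl !mulr_natl opprB [RHS]mulrBl !mulr_natl -!val_eqE /=.
  suff <- : \sum_(t < r) (D i t : B^c) * F j (r + s - 1 - t)%N =
    \sum_(t < r) ev (fF K j (r + s - 1 - t) * fD K i t) by [].
  by apply: eq_bigr => t _; rewrite rmorphM evD evF //; have := ltn_ord t; lia.
- move=> i r s r0 s0; rewrite !(rmorphB, rmorphM) !rmorph_sum !evE // (relEE rE) //.
  congr (_ - _); apply: eq_big_nat => t /andP[t1 tl]; rewrite rmorphM !evE //; lia.
- move=> i r s r0 s0; rewrite !(rmorphB, rmorphM) !rmorph_sum !evF //.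
  rewrite lie_opp [X in - X](relEE rF (lt_next i) r0 s0) opprB.
  congr (_ - _); apply: eq_big_nat => t /andP[t1 tl]; rewrite rmorphM !evF //; lia.
- move=> i j r s ij r0 s0; rewrite !(rmorphB, rmorphN, rmorphM) !evE // ij.
  by apply: (relEE_next rE) => //; rewrite -ij.
- move=> i j r s ij r0 s0; rewrite !(rmorphB, rmorphN, rmorphM) !evF // ij.
  have lt : (i.+2 < n)%N by rewrite -ij.
  rewrite (lie_opp (F i r.+1)) (lie_opp (F i r)) opprK addrC.
  exact: (relEE_next rF lt r0 s0).
- move=> i j r s ij r0 s0; rewrite !(rmorphB, rmorphM, rmorph0) !evE //.
  case/orP: ij => ij; first exact: (relEE_far rE).
  by rewrite lie_opp (relEE_far rE) // oppr0.
- move=> i j r s ij r0 s0; rewrite !(rmorphB, rmorphM, rmorph0) !evF //.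
  case/orP: ij => ij; last exact: (relEE_far rF).
  by rewrite lie_opp [X in - X](relEE_far rF) // oppr0.
- move=> i j r s t ij r0 s0 t0; rewrite !(rmorphB, rmorphD, rmorphN, rmorphM, rmorph0) !evE //.
  case: ij => ij; rewrite ij.
    have lt : (i.+2 < n)%N by rewrite -ij.
    exact: (relSerre_up rE lt r0 s0 t0).
  have lt : (j.+2 < n)%N by rewrite -ij.
  exact: (relSerre_down rE lt r0 s0 t0).
- move=> i j r s t ij r0 s0 t0; rewrite !(rmorphB, rmorphD, rmorphN, rmorphM, rmorph0) !evF //.
  case: ij => ij; rewrite ij.
    have lt : (i.+2 < n)%N by rewrite -ij.
    by rewrite -[RHS](relSerre_up rF lt r0 s0 t0) -op_serre.
  have lt : (j.+2 < n)%N by rewrite -ij.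
  by rewrite -[RHS](relSerre_down rF lt r0 s0 t0) -op_serre.
Qed.

End DrinfeldEval.

(** * The presentation of the Yangian *)

Local Open Scope complex_scope.

Section Families.
Variables (A : nzRingType) (n : nat) (F D E : 'M[fps A]_n).

Definition famD := fam 1 (fun i : 'I_n => D i i).
Definition famE := fam 0 (fun i : 'I_n.-1 => E (ord_this i) (ord_next i)).
Definition famF := fam 0 (fun i : 'I_n.-1 => F (ord_next i) (ord_this i)).

Lemma fam_coords T : unital T -> gauss_factorization T F D E -> coords T famD famE famF.
Proof.
move=> T0 gT; apply: (gauss_coords T0 gT) => [i|i j ij]; first by rewrite /famD fam_ord.
have lt : (i < n.-1)%N by have := ltn_ord j; lia.
pose k := Ordinal lt; have [ik jk] : ord_this k = i /\ ord_next k = j.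
  by split; apply: val_inj => //=; rewrite ij.
by rewrite /famE /famF -[nat_of_ord i]/(nat_of_ord k) !fam_ord ik jk.
Qed.

End Families.

Section Algebras.
Variables (R : realType) (n : nat).
Local Notation K := (R[i]).
Local Notation Y := (Yangian K n).

Lemma alg_two_reg (B : algType K) (b : B) : b + b = 0 -> b = 0.
Proof.
rewrite -mulr2n -scaler_nat => /eqP; rewrite scaler_eq0 Num.Theory.pnatr_eq0 /=.
by move/eqP.
Qed.

Section Yangian.
Variables (F D E : 'M[fps Y]_n).
Hypothesis gT : gauss_factorization (yangian_mx K n) F D E.

Lemma yangian_coords : coords (yangian_mx K n) (famD D) (famE E) (famF F).
Proof. exact: (fam_coords (@yangian_mx_unital K n) gT). Qed.

Lemma yangian_data : Ddata n (famD D) (famE E) (famF F).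
Proof.
have T0 := @yangian_mx_unital K n; have cT := yangian_coords.
have [DU EU FU] := coords_unital T0 cT; split=> //.
exact: (rtt_Drel (@alg_two_reg _) T0 (@yangian_mx_rtt K n) cT).
Qed.

Lemma yangian_respects p q : Drinfeld_rel p q ->
  feval (Drinfeld_elt F D E) p = feval (Drinfeld_elt F D E) q.
Proof.
apply: (Ddata_respects _ _ _ _ yangian_data) => i r /=.
- by rewrite /famD fam_ord.
- by rewrite /famD fam_ord.
- by rewrite /famE fam_ord.
- by rewrite /famF fam_ord.
Qed.

End Yangian.

(** The algebra presented by the Drinfeld relations.  It is not zero, since the
    Yangian satisfies the relations; this makes it a unital algebra for which
    series and RTT matrices are defined. *)
Definition Drinfeld_alg : Type := quot_alg (@Drinfeld_rel K n).
HB.instance Definition _ := GRing.PzRing.on Drinfeld_alg.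
HB.instance Definition _ := GRing.Lmodule.on Drinfeld_alg.

Fact Drinfeld_alg_oner_neq0 : (1 : Drinfeld_alg) != 0.
Proof.
have [[[F D] E] [gT _]] := yangian_gauss K n.
apply/eqP; rewrite -(quot_pi0 (@Drinfeld_rel K n)) => /(quot_piP (@Drinfeld_rel K n) 1 0).
rewrite subr0 => /(ideal_gen_ker (f := feval (Drinfeld_elt F D E)) (yangian_respects gT)).
by rewrite rmorph1; apply/eqP; exact: oner_neq0.
Qed.

HB.instance Definition _ :=
  GRing.PzSemiRing_isNonZero.Build Drinfeld_alg Drinfeld_alg_oner_neq0.
HB.instance Definition _ :=
  GRing.Lmodule_isLalgebra.Build K Drinfeld_alg (@quot_scalerAl _ _ _).
HB.instance Definition _ :=
  GRing.Lalgebra_isAlgebra.Build K Drinfeld_alg (@quot_scalerAr _ _ _).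

Definition drinfeld_pi (p : free_alg K (Drinfeld_gen n)) : Drinfeld_alg :=
  quot_pi (@Drinfeld_rel K n) p.

HB.instance Definition _ := GRing.isZmodMorphism.Build
  (free_alg K (Drinfeld_gen n)) Drinfeld_alg drinfeld_pi (quot_piB (@Drinfeld_rel K n)).
HB.instance Definition _ := GRing.isMonoidMorphism.Build
  (free_alg K (Drinfeld_gen n)) Drinfeld_alg drinfeld_pi
  (erefl, quot_piM (@Drinfeld_rel K n)).
HB.instance Definition _ := GRing.isScalable.Build K
  (free_alg K (Drinfeld_gen n)) Drinfeld_alg _ drinfeld_pi (quot_piZ (@Drinfeld_rel K n)).

Definition drinfeld_gen (g : Drinfeld_gen n) : Drinfeld_alg := drinfeld_pi (fgen K g).

Lemma feval_drinfeld_gen p : feval drinfeld_gen p = drinfeld_pi p.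
Proof. by rewrite -[in RHS](feval_id p) feval_morph. Qed.

Local Notation Yh := Drinfeld_alg.
(** The tautological families over the presented algebra. *)
Definition hD : nat -> fps Yh :=
  fam 1 (fun i : 'I_n => (fun r => drinfeld_gen (Dgen i r)) : fps Yh).
Definition hE : nat -> fps Yh :=
  fam 0 (fun i : 'I_n.-1 => (fun r => drinfeld_pi (fE K i r)) : fps Yh).
Definition hF : nat -> fps Yh :=
  fam 0 (fun i : 'I_n.-1 => (fun r => drinfeld_pi (fF K i r)) : fps Yh).

Let ph : {rmorphism free_alg K (Drinfeld_gen n) -> Yh} := drinfeld_pi.

Let pi_rel p q : Drinfeld_rel p q -> ph p = ph q.
Proof. by move=> pq; apply/quot_piP; exact: ideal_gen_rel. Qed.

Let hDE (i : 'I_n) r : ph (fD K i r) = hD i r.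
Proof. by rewrite /hD fam_ord. Qed.
Let hEE (i : 'I_n.-1) r : ph (fE K i r) = hE i r.
Proof. by rewrite /hE fam_ord. Qed.
Let hFE (i : 'I_n.-1) r : ph (fF K i r) = hF i r.
Proof. by rewrite /hF fam_ord. Qed.

Lemma hD0 i : (i < n)%N -> hD i 0%N = 1.
Proof.
move=> lt_in; have := pi_rel (Drinfeld_D0 K (Ordinal lt_in)).
by rewrite hDE rmorph1.
Qed.

Lemma hDt i r : drinfeld_gen (Dtgen i r) = (- (hD i)^-1) r.
Proof.
have DU : hD i \is a GRing.unit by apply: fps_unit1; rewrite hD0.
pose Dt : fps Yh := fun r => drinfeld_gen (Dtgen i r).
suff -> : - (hD i)^-1 = Dt by [].
apply: (mulrI DU); rewrite mulrN divrr //; apply/fpsP => q.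
have := pi_rel (Drinfeld_DDt K i q); rewrite rmorph_sum rmorphN rmorph_nat => /esym.
rewrite fpsNE fps1E => ->; apply: eq_bigr => t _.
by rewrite rmorphM hDE.
Qed.

Lemma Drinfeld_alg_data : Ddata n hD hE hF.
Proof.
have lt_i i : (i.+1 < n)%N -> (i < n.-1)%N by lia.
split; [split; [split|split|]| | |].
- move=> i j r s li lj; have := pi_rel (Drinfeld_DD K (Ordinal li) (Ordinal lj) r s).
  by rewrite !(rmorphB, rmorphM) !hDE rmorph0.
- move=> i j r s li lj s0.
  have := pi_rel (Drinfeld_DE K (Ordinal li) (Ordinal (lt_i _ lj)) r s0).
  rewrite !(rmorphB, rmorphM, rmorph_nat) rmorph_sum !hDE !hEE => ->.
  by rewrite -!val_eqE /=; congr (_ * _); apply: eq_bigr => t _; rewrite rmorphM hDE hEE.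
- move=> i r s li r0 s0; have := pi_rel (Drinfeld_EE K (Ordinal (lt_i _ li)) r0 s0).
  rewrite !(rmorphB, rmorphM) !rmorph_sum !hEE => ->.
  by congr (_ - _); apply: eq_bigr => t _; rewrite rmorphM !hEE.
- move=> i r s li r0 s0.
  have := pi_rel (@Drinfeld_EE_next K n (Ordinal (lt_i _ (ltnW li))) (Ordinal (lt_i _ li)) r s erefl r0 s0).
  by rewrite !(rmorphB, rmorphN, rmorphM) !hEE.
- move=> i j r s ij lj r0 s0; have li : (i.+1 < n)%N by lia.
  have := pi_rel (@Drinfeld_EE_far K n (Ordinal (lt_i _ li)) (Ordinal (lt_i _ lj)) r s _ r0 s0).
  by rewrite !(rmorphB, rmorphM, rmorph0) !hEE; apply; rewrite ij.
- move=> i r s t li r0 s0 t0.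
  have := pi_rel (@Drinfeld_Serre_E K n (Ordinal (lt_i _ (ltnW li))) (Ordinal (lt_i _ li)) r s t (or_introl erefl) r0 s0 t0).
  by rewrite !(rmorphB, rmorphD, rmorphN, rmorphM, rmorph0) !hEE.
- move=> i r s t li r0 s0 t0.
  have := pi_rel (@Drinfeld_Serre_E K n (Ordinal (lt_i _ li)) (Ordinal (lt_i _ (ltnW li))) r s t (or_intror erefl) r0 s0 t0).
  by rewrite !(rmorphB, rmorphD, rmorphN, rmorphM, rmorph0) !hEE.
- move=> i j r s li lj; have := pi_rel (Drinfeld_DD K (Ordinal lj) (Ordinal li) s r).
  by rewrite !(rmorphB, rmorphM) !hDE rmorph0.
- move=> i j r s li lj s0; rewrite lie_opp.
  have := pi_rel (Drinfeld_DF K (Ordinal li) (Ordinal (lt_i _ lj)) r s0).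
  rewrite !(rmorphB, rmorphM, rmorph_nat) rmorph_sum !hDE !hFE => H.
  rewrite [X in - X]H [X in - X = _]mulrBl !mulr_natl [LHS]opprB.
  rewrite [RHS]mulrBl !mulr_natl -!val_eqE /=.
  suff -> : \sum_(t < r) ph (fF K (Ordinal (lt_i j lj)) (r + s - 1 - t) * fD K (Ordinal li) t)
    = \sum_(t < r) (hD i t : Yh^c) * hF j (r + s - 1 - t)%N by [].
  by apply: eq_bigr => t _; rewrite rmorphM hFE hDE.
- move=> i r s li r0 s0; rewrite lie_opp.
  have := pi_rel (Drinfeld_FF K (Ordinal (lt_i _ li)) r0 s0).
  rewrite !(rmorphB, rmorphM) !rmorph_sum !hFE => H.
  rewrite [X in - X]H [LHS]opprB.
  by congr (_ - _); apply: eq_bigr => t _; rewrite rmorphM !hFE.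
- move=> i r s li r0 s0.
  have := pi_rel (@Drinfeld_FF_next K n (Ordinal (lt_i _ (ltnW li))) (Ordinal (lt_i _ li)) r s erefl r0 s0).
  rewrite !(rmorphB, rmorphN, rmorphM) !hFE => H.
  rewrite lie_opp [X in _ - X]lie_opp opprK addrC; exact: H.
- move=> i j r s ij lj r0 s0; have li : (i.+1 < n)%N by lia.
  have := pi_rel (@Drinfeld_FF_far K n (Ordinal (lt_i _ lj)) (Ordinal (lt_i _ li)) s r _ s0 r0).
  by rewrite !(rmorphB, rmorphM, rmorph0) !hFE; apply; rewrite ij orbT.
- move=> i r s t li r0 s0 t0; rewrite -op_serre.
  have := pi_rel (@Drinfeld_Serre_F K n (Ordinal (lt_i _ (ltnW li))) (Ordinal (lt_i _ li)) r s t (or_introl erefl) r0 s0 t0).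
  by rewrite !(rmorphB, rmorphD, rmorphN, rmorphM, rmorph0) !hFE.
- move=> i r s t li r0 s0 t0; rewrite -op_serre.
  have := pi_rel (@Drinfeld_Serre_F K n (Ordinal (lt_i _ li)) (Ordinal (lt_i _ (ltnW li))) r s t (or_intror erefl) r0 s0 t0).
  by rewrite !(rmorphB, rmorphD, rmorphN, rmorphM, rmorph0) !hFE.
- move=> i j r s li lj r0 s0.
  have := pi_rel (Drinfeld_EF K (Ordinal (lt_i _ li)) (Ordinal (lt_i _ lj)) r0 s0).
  rewrite !(rmorphB, rmorphM, rmorph_nat) rmorph_sum !hEE !hFE => ->.
  rewrite -!val_eqE /=; congr (_ * _); apply: eq_bigr => t _.
  by rewrite rmorphM hDE -[ph _]/(drinfeld_gen _) hDt.
- by move=> i; exact: hD0.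
- by move=> i li; rewrite -(hEE (Ordinal (lt_i _ li))) /= rmorph0.
- by move=> i li; rewrite -(hFE (Ordinal (lt_i _ li))) /= rmorph0.
Qed.

Section Inverse.
Variables (F D E : 'M[fps Y]_n).
Hypothesis gT : gauss_factorization (yangian_mx K n) F D E.

(** Over the presented algebra the tautological families are the coordinates of an
    RTT matrix, which is the image of the matrix of the Yangian under a morphism
    psi.  A morphism maps Gauss factorizations to Gauss factorizations, and
    these are unique. *)
Lemma drinfeld_inverse : exists psi : {lrmorphism Y -> Yh},
  forall g, psi (Drinfeld_elt F D E g) = drinfeld_gen g.
Proof.
have [T [T0 rT cT]] := matrix_of_data (@alg_two_reg _) Drinfeld_alg_data.
have xR := rtt_respects T0 rT.
pose psi : {lrmorphism Y -> Yh} := yangian_lift xR; exists psi.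
have psiT i j r : psi (yangianT K i j r) = T i j r.
  by rewrite -yangian_pi_fT [LHS]yangian_lift_pi feval_fT.
have := gauss_map (fps_map psi) gT; set T1 := map_mx _ (yangian_mx K n).
have -> : T1 = T.
  by apply/matrixP => i j; apply/fpsP => r; rewrite /T1 !mxE; exact: psiT.
move=> /(fam_coords T0) cT1.
have [eD eE eF] := coords_unique T0 cT1 cT.
have psiD i r : psi (D i i r) = hD i r.
  by rewrite -(eD i (ltn_ord i)) /famD fam_ord mxE.
have lt_i (i : 'I_n.-1) : (i.+1 < n)%N by have := ltn_ord i; lia.
case=> i r /=.
- by rewrite psiD /hD fam_ord.
- rewrite hDt -(eD i (ltn_ord i)) /famD fam_ord mxE.
  have DU : D i i \is a GRing.unit.
    have [DU _ _] := coords_unital (@yangian_mx_unital K n) (yangian_coords gT).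
    by apply: fps_unit1; have := DU i (ltn_ord i); rewrite /famD fam_ord.
  by rewrite -[psi _]/(fps_map psi (- (D i i)^-1) r) rmorphN rmorphV.
- have /fpsP/(_ r.+1) := eE i (lt_i i); rewrite /famE fam_ord mxE => H.
  by rewrite [LHS]H /hE fam_ord.
- have /fpsP/(_ r.+1) := eF i (lt_i i); rewrite /famF fam_ord mxE => H.
  by rewrite [LHS]H /hF fam_ord.
Qed.

Let ev : {rmorphism free_alg K (Drinfeld_gen n) -> Y} := feval (Drinfeld_elt F D E).

(** The image is a subring that contains the coordinates, hence the entries of T
    by [rtt_gen], and it contains the scalars. *)
Lemma drinfeld_surjective (y : Y) : exists p, ev p = y.
Proof.
pose P (y : Y) := exists p, ev p = y.
have PB a b : P a -> P b -> P (a - b).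
  by move=> [p <-] [q <-]; exists (p - q); rewrite rmorphB.
have PM a b : P a -> P b -> P (a * b).
  by move=> [p <-] [q <-]; exists (p * q); rewrite rmorphM.
have evg g : P (Drinfeld_elt F D E g) by exists (fgen K g); exact: feval_gen.
have P1 : P 1 by exists 1; rewrite rmorph1.
have P0 : P 0 by exists 0; rewrite rmorph0.
have T0 := @yangian_mx_unital K n.
have PT i j r : P (yangian_mx K n i j r).
  move: i j r; apply: (rtt_gen PB PM T0 (@yangian_mx_rtt K n) (yangian_coords gT)).
  - move=> k r li; rewrite -[k]/(val (Ordinal li)) /famD fam_ord.
    exact: (evg (Dgen _ _)).
  - move=> k r li; have lt : (k < n.-1)%N by lia.
    rewrite -[k]/(val (Ordinal lt)) /famE fam_ord; case: r => [|r].
      have [_ EU _] := coords_unital T0 (yangian_coords gT).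
      have := EU k li; rewrite -[k]/(val (Ordinal lt)) /famE fam_ord => -> //.
    exact: (evg (Egen _ _)).
  - move=> k r li; have lt : (k < n.-1)%N by lia.
    rewrite -[k]/(val (Ordinal lt)) /famF fam_ord; case: r => [|r].
      have [_ _ FU] := coords_unital T0 (yangian_coords gT).
      have := FU k li; rewrite -[k]/(val (Ordinal lt)) /famF fam_ord => -> //.
    exact: (evg (Fgen _ _)).
have [q <-] := (yangian_presents K n).1 y.
have PD a b : P a -> P b -> P (a + b).
  by move=> Pa Pb; rewrite -[b]opprK -[- b]sub0r; exact: (PB _ _ Pa (PB _ _ P0 Pb)).
rewrite -/(P _) /feval /mmap; apply: (big_ind P P0 PD) => m _.
have Palg (c : K) : P c%:A.
  pose evl : {lrmorphism free_alg K (Drinfeld_gen n) -> Y} := feval (Drinfeld_elt F D E).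
  by exists c%:A; exact: (rmorph_alg evl).
apply: (PM _ _ (Palg _)).
apply: (big_ind P P1 PM) => -[[a b] r] _.
by have := PT a b r.+1; rewrite mxE.
Qed.

End Inverse.

End Algebras.

Theorem theorem5p2 (R : realType) (n : nat) (n_gt0 : (0 < n)%N)
    (F D E : 'M[fps (Yangian R[i] n)]_n) :
  gauss_factorization (yangian_mx R[i] n) F D E ->
  presents (Drinfeld_elt F D E) (@Drinfeld_rel R[i] n).
Proof.
move=> gT; split=> [y|p]; first exact: drinfeld_surjective.
split=> [p0|]; last exact: (ideal_gen_ker (f := feval (Drinfeld_elt F D E)) (yangian_respects gT)).
have [psi psiE] := drinfeld_inverse gT.
have : psi (feval (Drinfeld_elt F D E) p) = drinfeld_pi p.
  rewrite feval_morph -feval_drinfeld_gen; congr feval.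
  by apply: funext => g; exact: psiE.
rewrite p0 rmorph0 -(quot_pi0 (@Drinfeld_rel R[i] n)) => /esym.
by move/(quot_piP (@Drinfeld_rel R[i] n) p 0); rewrite subr0.
Qed.
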